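(* Let $Z$ be a germ at $(0,0)\in\mathbb{C}^2$ of a holomorphic vector field, singular at $(0,0)$, whose linear part has eigenvalues $\lambda_1,\lambda_2$ with $\lambda_2\neq0$ and $\lambda:=\lambda_1/\lambda_2\in\mathbb{R}_{<0}\setminus\mathbb{Q}$. Any non-degenerate Lie algebra $\mathcal{L}(Z,Y)$ of ratio $\delta$ is analytically conjugate to some $\mathcal{L}(Z_0,\tilde Y)$, where $Z_0:=\lambda_1x\frac{\partial}{\partial x}+\lambda_2y\frac{\partial}{\partial y}$ is the linear part of $Z$ and $\tilde Y$ is as follows: there exist a unique $(n,m)\in\mathbb{Z}^2$ and $(d,c)\in\mathbb{C}^2$ such that $$\tilde Y(x,y)=x^ny^m\left(dx\frac{\partial}{\partial x}+cy\frac{\partial}{\partial y}\right).$$ The ratio of $\mathcal{L}(Z,Y)$ is given by $\delta=n\lambda_1+m\lambda_2$.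
   Context: A Lie algebra $\mathcal{L}(Z,Y)$ of ratio $\delta\in\mathbb{C}$ is the complex Lie algebra spanned by two non-zero germs at $(0,0)$ of meromorphic vector fields with $[Z,Y]=\delta Y$; it is non-degenerate if $\det(Z,Y)\not\equiv0$. Coordinates are chosen so that the linear part of $Z$ is diagonal, $Z=(\lambda_1x+\cdots)\frac{\partial}{\partial x}+(\lambda_2y+\cdots)\frac{\partial}{\partial y}$, where the dots are terms of homogeneous degree greater than $1$. Analytic conjugacy is by a germ of a biholomorphism fixing $(0,0)$. *)

(* Defs.v *)
From Stdlib Require Import Reals ZArith QArith Qreals.
From Coquelicot Require Import Coquelicot.

Open Scope C_scope.

Definition origin : C * C := (RtoC 0, RtoC 0).

(* A germ at (0,0) is handled through an arbitrary representative, a total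
   function on C * C; two representatives are only ever compared through
   [near0] or [generically] below. *)
Definition near0 (P : C * C -> Prop) : Prop :=
  exists r : R, (0 < r)%R /\
    forall x y : C, (Cmod x < r)%R -> (Cmod y < r)%R -> P (x, y).

(* f is, on some polydisc, the sum of an absolutely convergent power series
   sum_(i,j) a i j x^i y^j; terms are grouped by homogeneous degree k. *)
Definition holomorphic_germ (f : C * C -> C) : Prop :=
  exists a : nat -> nat -> C,
    near0 (fun p =>
      ex_series (fun k : nat =>
        sum_n (fun i => Cmod (a i (k - i)%nat * fst p ^ i * snd p ^ (k - i))) k)
      /\
      is_series (fun k : nat =>
        sum_n (fun i => a i (k - i)%nat * fst p ^ i * snd p ^ (k - i)) k)
        (f p)).

(* P holds, near (0,0), off the zero set of a holomorphic germ that is not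
   identically zero. Equality of meromorphic germs is equality in this sense:
   the values of a representative on an analytic curve carry no information. *)
Definition generically (P : C * C -> Prop) : Prop :=
  exists q : C * C -> C,
    holomorphic_germ q /\ ~ near0 (fun p => q p = 0) /\
    near0 (fun p => q p <> 0 -> P p).

Definition meromorphic_germ (f : C * C -> C) : Prop :=
  exists g h : C * C -> C,
    holomorphic_germ g /\ holomorphic_germ h /\
    ~ near0 (fun p => h p = 0) /\
    near0 (fun p => h p <> 0 -> f p = g p / h p).

(* X p = (A p, B p) stands for A d/dx + B d/dy. *)
Definition vfield : Type := C * C -> C * C.

Definition holomorphic_map (F : C * C -> C * C) : Prop :=
  holomorphic_germ (fun p => fst (F p)) /\ holomorphic_germ (fun p => snd (F p)).

Definition meromorphic_vfield (X : vfield) : Prop :=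
  meromorphic_germ (fun p => fst (X p)) /\ meromorphic_germ (fun p => snd (X p)).

Definition eq_vfield (X X' : vfield) : Prop := generically (fun p => X p = X' p).

Definition zero_vfield : vfield := fun _ => origin.

Definition comb_vfield (a : C) (X : vfield) (b : C) (X' : vfield) : vfield :=
  fun p => (a * fst (X p) + b * fst (X' p), a * snd (X p) + b * snd (X' p)).

(* [C_derive] is the complex derivative wherever it exists, hence at every point
   near (0,0) for a holomorphic germ and at a generic one for a meromorphic
   germ. *)
Definition partial_x (f : C * C -> C) (p : C * C) : C :=
  C_derive (fun x => f (x, snd p)) (fst p).

Definition partial_y (f : C * C -> C) (p : C * C) : C :=
  C_derive (fun y => f (fst p, y)) (snd p).

Definition differential (F : C * C -> C * C) (p v : C * C) : C * C :=
  (partial_x (fun q => fst (F q)) p * fst v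
     + partial_y (fun q => fst (F q)) p * snd v,
   partial_x (fun q => snd (F q)) p * fst v
     + partial_y (fun q => snd (F q)) p * snd v).

(* Sign convention: [Z, Y] f = Z (Y f) - Y (Z f). *)
Definition lie_bracket (Z Y : vfield) : vfield :=
  fun p =>
    (fst (differential Y p (Z p)) - fst (differential Z p (Y p)),
     snd (differential Y p (Z p)) - snd (differential Z p (Y p))).

Definition is_lie_algebra_of_ratio (Z Y : vfield) (delta : C) : Prop :=
  meromorphic_vfield Z /\ meromorphic_vfield Y /\
  ~ eq_vfield Z zero_vfield /\ ~ eq_vfield Y zero_vfield /\
  eq_vfield (lie_bracket Z Y) (comb_vfield 0 Z delta Y).

Definition non_degenerate (Z Y : vfield) : Prop :=
  ~ generically (fun p => fst (Z p) * snd (Y p) - snd (Z p) * fst (Y p) = 0).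

Definition lie_algebra (Z Y : vfield) : vfield -> Prop :=
  fun X => exists a b : C, eq_vfield X (comb_vfield a Z b Y).

Definition biholomorphic_germ (Phi : C * C -> C * C) : Prop :=
  holomorphic_map Phi /\ Phi origin = origin /\
  exists Psi : C * C -> C * C,
    holomorphic_map Psi /\ Psi origin = origin /\
    near0 (fun p => Psi (Phi p) = p) /\ near0 (fun p => Phi (Psi p) = p).

(* Phi_* X = X' *)
Definition is_pushforward (Phi : C * C -> C * C) (X X' : vfield) : Prop :=
  generically (fun p => differential Phi p (X p) = X' (Phi p)).

(* Phi_* L = L' for some Phi. *)
Definition analytically_conjugate (L L' : vfield -> Prop) : Prop :=
  exists Phi : C * C -> C * C,
    biholomorphic_germ Phi /\
    forall X' : vfield,
      L' X' <-> exists X : vfield, L X /\ is_pushforward Phi X X'.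

(* The value for z = 0 and k < 0 is irrelevant. *)
Definition Cpowz (z : C) (k : Z) : C :=
  match k with
  | Z0 => 1
  | Zpos p => z ^ Pos.to_nat p
  | Zneg p => / (z ^ Pos.to_nat p)
  end.

Definition diag_vfield (lambda1 lambda2 : C) : vfield :=
  fun p => (lambda1 * fst p, lambda2 * snd p).

Definition monomial_vfield (n m : Z) (d c : C) : vfield :=
  fun p =>
    let u := Cpowz (fst p) n * Cpowz (snd p) m in
    (u * (d * fst p), u * (c * snd p)).

(* Z = (lambda1 x + ...) d/dx + (lambda2 y + ...) d/dy, the dots being terms of
   homogeneous degree greater than 1. *)
Definition has_diagonal_linear_part (Z : vfield) (lambda1 lambda2 : C) : Prop :=
  Z origin = origin /\
  forall v : C * C,
    differential Z origin v = diag_vfield lambda1 lambda2 v.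

(* Main.v *)
Require Import Defs.
From Stdlib Require Import Reals ZArith QArith Qreals Lia Lra FunctionalExtensionality Classical.
From Coquelicot Require Import Coquelicot.

(** As [lambda] is irrational, distinct monomials [x ^ i y ^ j] have distinct
    weights [i * lambda1 + j * lambda2] under [Z0], so [Z] has formal coordinates
    [X], [W] with [Z X = lambda1 X], [Z W = lambda2 W]. Small divisors may prevent
    them from converging; it is the existence of [Y] that makes them converge.

    Formally, [[Z, Y] = delta Y] says that [Y X / X] and [Y W / W] are
    eigenfunctions of [Z] for the eigenvalue [delta], in the field of fractions.
    Two such eigenfunctions are proportional, since a combination that cancels
    their leading terms would have a leading monomial of the wrong weight
    ([proportional]). So both are multiples of one monomial [X ^ n W ^ m] with
    [delta = n lambda1 + m lambda2], and [Y] is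
    [X ^ n W ^ m (d X d/dX + c W d/dW)] ([monomial_form]).

    For the convergence, the two separatrices of [Z] are analytic, because the
    divisors [j lambda2 - lambda1] that occur along them are large when
    [lambda < 0] ([separatrix]). Let [xi = 0] and [eta = 0] be their equations, so
    that [X = xi F] and [W = eta G] with formal units [F], [G]. In the frame
    [xi d/dxi], [eta d/deta] the field [Z] has analytic coefficients. The
    coefficients of [Y / (xi ^ n eta ^ m)] are formal power series and quotients of
    analytic germs, hence analytic ([conv_quotient]). As [Z] and [Y] are
    independent, the equations for [Z X], [Z W], [Y X], [Y W] can be solved for the
    derivatives of [F] and [G]; with [E = xi d/dxi + eta d/deta] and
    [e = F ^ n G ^ m] they give [E F = F (a1 + b1 e)] and [E G = G (a2 + b2 e)] with
    analytic coefficients, hence [E e = a e + b e ^ 2]. The field [E] acts on the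
    terms of degree [k] as multiplication by [k], up to terms of higher degree, so
    there are no small divisors any more, and formal solutions converge
    ([briot_bouquet]): first [e], then [F] and [G] ([normal_form]). The map
    [(X, W)] is the required conjugacy ([normal_form_conjugacy]).

    Conversely, let a biholomorphism send the Lie algebra of [Z], [Y] to that of
    [Z0], [Y'] with [Y'] monomial of weight [delta'], and [Z] to
    [al Z0 + be Y']. Comparing brackets gives [delta = al delta']
    ([ratio_relation]). If [delta'] is not 0, then [be Y'] does not contribute to the
    trace of the linear part, which is invariant and not 0, so [al = 1]
    ([trace_relation]). Hence [delta = delta'], and the weight determines the
    exponents.

    Convergence is measured by the sums [maj f n] of the moduli of the
    coefficients of total degree [n]. Functional equations then become
    inequalities between power series in one variable [r], in which a partial sum
    is bounded in terms of itself; since it is continuous in [r] and small at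
    [r = 0], it stays bounded for small [r] ([psum_bootstrap]). *)

Open Scope C_scope.

(** * Formal power series over a commutative ring *)

Record rng := Rng {
  car :> Type; r0 : car; r1 : car;
  radd : car -> car -> car; rmul : car -> car -> car;
  rsub : car -> car -> car; ropp : car -> car;
  rth : ring_theory r0 r1 radd rmul rsub ropp eq }.
Arguments r0 {_}. Arguments r1 {_}.
Arguments radd {_}. Arguments rmul {_}. Arguments rsub {_}. Arguments ropp {_}.

Declare Scope rng_scope.
Delimit Scope rng_scope with S.
Notation "0" := r0 : rng_scope.
Notation "1" := r1 : rng_scope.
Infix "+" := radd : rng_scope.
Infix "*" := rmul : rng_scope.
Infix "-" := rsub : rng_scope.
Notation "- f" := (ropp f) : rng_scope.

Canonical Crng : rng := Rng C _ _ _ _ _ _ C_ring_theory.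
Canonical Rrng : rng := Rng R _ _ _ _ _ _ RTheory.

Definition tail {T : Type} (f : nat -> T) : nat -> T := fun n => f (S n).

Section Series.
Context {A : rng}.
Local Open Scope rng_scope.
Add Ring A_ring : (rth A).

(** Reading the Cauchy product off [f = f 0 + t * tail f], rather than as a sum
    over a diagonal, lets the ring laws follow by induction on the degree. *)
Fixpoint cprod (f g : nat -> A) (n : nat) : A :=
  match n with
  | O => f O * g O
  | S m => f O * g (S m) + cprod (tail f) g m
  end.

Definition const (a : A) : nat -> A := fun n => match n with O => a | _ => 0 end.

Lemma cprod_S f g n : cprod f g (S n) = f O * g (S n) + cprod (tail f) g n.
Proof. reflexivity. Qed.

Lemma cprod_add_l n : forall f f' g,
  cprod (fun k => f k + f' k) g n = cprod f g n + cprod f' g n.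
Proof.
  induction n as [|n IH]; intros f f' g; simpl; [ring|].
  change (tail (fun k => f k + f' k)) with (fun k => tail f k + tail f' k).
  rewrite IH; ring.
Qed.

Lemma cprod_scal_l n : forall a f g,
  cprod (fun k => a * f k) g n = a * cprod f g n.
Proof.
  induction n as [|n IH]; intros a f g; simpl; [ring|].
  change (tail (fun k => a * f k)) with (fun k => a * tail f k).
  rewrite IH; ring.
Qed.

Lemma cprod_0_l n : forall f g, (forall k, f k = 0) -> cprod f g n = 0.
Proof.
  induction n as [|n IH]; intros f g H; simpl; rewrite H; [ring|].
  rewrite IH by (intro; apply H); ring.
Qed.

Lemma cprod_const n : forall a g, cprod (const a) g n = a * g n.
Proof.
  destruct n as [|n]; intros a g; simpl; [ring|].
  rewrite cprod_0_l by reflexivity; ring.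
Qed.

Lemma cprod_tail_r n : forall f g,
  cprod f g (S n) = f (S n) * g O + cprod f (tail g) n.
Proof.
  induction n as [|n IH]; intros f g; [simpl; unfold tail; ring|].
  rewrite (cprod_S f g), IH, (cprod_S f (tail g)); unfold tail; ring.
Qed.

Lemma cprod_comm n : forall f g, cprod f g n = cprod g f n.
Proof.
  induction n as [|n IH]; intros f g; [simpl; ring|].
  rewrite cprod_S, cprod_tail_r, IH; ring.
Qed.

Lemma cprod_assoc n : forall f g h,
  cprod f (cprod g h) n = cprod (cprod f g) h n.
Proof.
  induction n as [|n IH]; intros f g h; [simpl; ring|].
  rewrite (cprod_S (cprod f g)), (cprod_S f).
  change (tail (cprod f g)) with
    (fun k => f O * tail g k + cprod (tail f) g k).
  rewrite (cprod_add_l n (fun k => f O * tail g k)), cprod_scal_l, <- IH.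
  simpl; ring.
Qed.

Lemma series_ring_theory :
  @ring_theory (nat -> A) (fun _ => 0) (const 1) (fun f g n => f n + g n) cprod
    (fun f g n => f n - g n) (fun f n => - f n) eq.
Proof.
  constructor; intros; apply functional_extensionality; intro n;
    try ring.
  - rewrite cprod_const; ring.
  - apply cprod_comm.
  - apply cprod_assoc.
  - apply cprod_add_l.
Qed.

Canonical sers : rng := Rng (nat -> A) _ _ _ _ _ _ series_ring_theory.

(** The functional [phi] extracts a coefficient when [A] is itself a ring of
    series; it allows to use the lemma once for each variable. *)
Lemma cprod_zero {B : rng} (phi : A -> B)
  (phi_add : forall a b, phi (a + b) = phi a + phi b) n : forall f g,
  (forall k, (k <= n)%nat -> phi (f k * g (n - k)%nat) = 0) ->
  phi (cprod f g n) = 0.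
Proof.
  induction n as [|n IH]; intros f g H; [exact (H O (Nat.le_refl 0))|].
  rewrite cprod_S, phi_add, IH.
  - pose proof (H O (Nat.le_0_l _)) as H0. simpl in H0. rewrite H0.
    apply (Radd_0_l (rth B)).
  - intros k Hk. apply (H (S k)). lia.
Qed.

Lemma cprod_single {B : rng} (phi : A -> B)
  (phi_add : forall a b, phi (a + b) = phi a + phi b) n : forall f g k0,
  (k0 <= n)%nat ->
  (forall k, (k <= n)%nat -> k <> k0 -> phi (f k * g (n - k)%nat) = 0) ->
  phi (cprod f g n) = phi (f k0 * g (n - k0)%nat).
Proof.
  induction n as [|n IH]; intros f g k0 Hk0 H.
  - replace k0 with O by lia. reflexivity.
  - rewrite cprod_S, phi_add. destruct k0 as [|k0].
    + rewrite (cprod_zero phi phi_add n).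
      * rewrite (Radd_comm (rth B)). apply (Radd_0_l (rth B)).
      * intros k Hk. apply (H (S k)); lia.
    + assert (H0 : phi (f O * g (S n)) = 0) by (apply (H O); lia).
      rewrite H0, (IH _ _ k0) by (try lia; intros k Hk Hne; apply (H (S k)); lia).
      apply (Radd_0_l (rth B)).
Qed.

End Series.
Arguments sers : clear implicits.

Section Derivation.
Context {A : rng}.
Local Open Scope rng_scope.
Add Ring A_ring' : (rth A).
Add Ring SA_ring : (rth (sers A)).

Fixpoint natmul (n : nat) (a : A) : A :=
  match n with O => 0 | S m => a + natmul m a end.

Definition deriv (f : sers A) : sers A := fun n => natmul (S n) (f (S n)).

Lemma natmul_add n a b : natmul n (a + b) = natmul n a + natmul n b.
Proof. induction n as [|n IH]; simpl; [|rewrite IH]; ring. Qed.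

Lemma natmul_mul n a b : natmul n (a * b) = a * natmul n b.
Proof. induction n as [|n IH]; simpl; [|rewrite IH]; ring. Qed.

Lemma deriv_add f g : deriv (f + g) = deriv f + deriv g.
Proof. apply functional_extensionality; intro n. apply natmul_add. Qed.

(* Both sides are computed from [deriv f = tail f + t * deriv (tail f)]. *)
Lemma deriv_mul f g : deriv (f * g) = deriv f * g + f * deriv g.
Proof.
  apply functional_extensionality; intro n. revert f.
  assert (T : forall f : sers A, forall m,
    deriv f (S m) = f (S (S m)) + deriv (tail f) m) by reflexivity.
  induction n as [|n IH]; intro f.
  - unfold deriv; simpl; unfold deriv, tail; simpl; ring.
  - rewrite T.
    change ((f * g) (S (S n))) with (f O * g (S (S n)) + ((tail f : sers A) * g) (S n)).
    replace (deriv (tail (f * g)) n) with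
      (f O * deriv (tail g) n + deriv ((tail f : sers A) * g) n).
    2:{ unfold deriv. rewrite <- natmul_mul, <- natmul_add. reflexivity. }
    rewrite IH.
    change ((deriv f * g + f * deriv g) (S n)) with
      (deriv f O * g (S n) + cprod (tail (deriv f)) g n
       + (f O * deriv g (S n) + cprod (tail f) (deriv g) n)).
    change (tail (deriv f)) with (fun k => tail (tail f) k + deriv (tail f) k).
    rewrite (cprod_add_l n (tail (tail f))), T.
    change (((tail f : sers A) * g) (S n)) with (f 1%nat * g (S n) + cprod (tail (tail f)) g n).
    change (deriv f O) with (f 1%nat + 0).
    change (((deriv (tail f) : sers A) * g + (tail f : sers A) * deriv g) n) with
      (cprod (deriv (tail f)) g n + cprod (tail f) (deriv g) n).
    ring.
Qed.

(** A derivation of the coefficients; with [deriv] it gives the derivative in the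
    inner variable of a series of series. *)
Lemma coefwise_derivation (d : A -> A)
  (d_add : forall a b, d (a + b) = d a + d b)
  (d_mul : forall a b, d (a * b) = d a * b + a * d b) (f g : sers A) :
  ((fun n => d ((f * g) n)) : sers A) = (fun n => d (f n)) * g + f * (fun n => d (g n)).
Proof.
  apply functional_extensionality; intro n. revert f.
  induction n as [|n IH]; intro f; [simpl; apply d_mul|].
  change ((f * g) (S n)) with (f O * g (S n) + ((tail f : sers A) * g) n).
  rewrite d_add, d_mul, IH. simpl. unfold tail. ring.
Qed.

End Derivation.

Section Homomorphisms.
Local Open Scope rng_scope.

Lemma coefwise_hom {A B : rng} (phi : A -> B)
  (phi_add : forall a b, phi (a + b) = phi a + phi b)
  (phi_mul : forall a b, phi (a * b) = phi a * phi b) (f g : sers A) :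
  ((fun n => phi ((f * g) n)) : sers B)
  = ((fun n => phi (f n)) : sers B) * ((fun n => phi (g n)) : sers B).
Proof.
  apply functional_extensionality; intro n. revert f.
  induction n as [|n IH]; intro f; [apply phi_mul|].
  change ((f * g) (S n)) with (f O * g (S n) + ((tail f : sers A) * g) n).
  rewrite phi_add, phi_mul, IH. reflexivity.
Qed.

Context {A : rng}.
Add Ring A_ring2 : (rth A).

Fixpoint rpow (a : A) (n : nat) : A :=
  match n with O => 1 | S m => a * rpow a m end.

(** The substitution [t := z t]. *)
Lemma scale_hom (z : A) (f g : sers A) :
  ((fun n => (f * g) n * rpow z n) : sers A)
  = ((fun n => f n * rpow z n) : sers A) * ((fun n => g n * rpow z n) : sers A).
Proof.
  apply functional_extensionality; intro n. revert f.
  induction n as [|n IH]; intro f; [simpl; ring|].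
  change ((f * g) (S n)) with (f O * g (S n) + ((tail f : sers A) * g) n).
  transitivity (f O * g (S n) * rpow z (S n)
     + z * (((tail f : sers A) * g) n * rpow z n)); [simpl; ring|].
  rewrite IH. simpl.
  rewrite <- (cprod_scal_l n z).
  replace (tail (fun n0 : nat => f n0 * rpow z n0)) with
    (fun k => z * (tail f k * rpow z k)).
  - ring.
  - apply functional_extensionality; intro k. unfold tail; simpl; ring.
Qed.

(** The substitution [x := t, y := t] in a series in two variables: it groups
    the terms by total degree, and being a ring morphism it respects products. *)
Fixpoint diag (f : nat -> nat -> A) (n : nat) : A :=
  f O n + match n with O => 0 | S m => diag (tail f) m end.

Lemma diag_S f n : diag f (S n) = f O (S n) + diag (tail f) n.
Proof. reflexivity. Qed.

Lemma diag_add n : forall f g,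
  diag (fun i j => f i j + g i j) n = diag f n + diag g n.
Proof.
  induction n as [|n IH]; intros f g; simpl; [ring|].
  change (tail (fun i j => f i j + g i j)) with (fun i j => tail f i j + tail g i j).
  rewrite IH; ring.
Qed.

Lemma cprod_diag_S (h : nat -> A) (g : nat -> nat -> A) n :
  cprod h (diag g) (S n) = cprod h (g O) (S n) + cprod h (diag (tail g)) n.
Proof.
  set (shifted := fun k => match k with O => 0 | S m => diag (tail g) m end).
  assert (E : diag g = fun k => g O k + shifted k).
  { apply functional_extensionality; intros [|k]; reflexivity. }
  rewrite (cprod_comm (S n) h (diag g)), E, cprod_add_l, (cprod_comm (S n) (g O)).
  rewrite (cprod_S shifted). change (tail shifted) with (diag (tail g)).
  rewrite (cprod_comm n (diag (tail g))). unfold shifted at 1. ring.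
Qed.

Lemma diag_scal n : forall (f : nat -> A) (g : nat -> nat -> A),
  diag (fun i => f * g i) n = (f * diag g) n.
Proof.
  induction n as [|n IH]; intros f g; [simpl; ring|].
  rewrite diag_S. change (tail (fun i => f * g i)) with (fun i => f * tail g i).
  rewrite IH. symmetry. apply cprod_diag_S.
Qed.

Lemma diag_mul n : forall f g : nat -> nat -> A,
  diag (f * g) n = (diag f * diag g) n.
Proof.
  induction n as [|n IH]; intros f g; [simpl; ring|].
  assert (E : diag (f * g) (S n) = (f O * g O) (S n)
    + (diag (fun i => f O * tail g i) n + diag (tail f * g) n))
    by (rewrite <- diag_add; reflexivity).
  rewrite E, IH, (diag_scal n (f O) (tail g)). clear E.
  change ((diag f * diag g) (S n)) with
    (diag f O * diag g (S n) + cprod (tail (diag f)) (diag g) n).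
  change (tail (diag f)) with (fun k => tail (f O) k + diag (tail f) k).
  rewrite (cprod_add_l n (tail (f O))), (diag_S g).
  change ((f O * g O) (S n)) with (f O O * g O (S n) + cprod (tail (f O)) (g O) n).
  change ((f O * diag (tail g)) n) with (cprod (f O) (diag (tail g)) n).
  change ((diag (tail f) * diag g) n)
    with (cprod (diag (tail f)) (diag g) n).
  assert (E : cprod (f O) (diag (tail g)) n = f O O * diag (tail g) n
    + cprod (tail (f O)) (diag g) n - cprod (tail (f O)) (g O) n).
  { destruct n as [|n]; [simpl; ring|].
    rewrite (cprod_S (f O)), (cprod_diag_S (tail (f O)) g n). ring. }
  rewrite E. simpl (diag f O). ring.
Qed.

Lemma diag_S_r n : forall f, diag f (S n) = f (S n) O + diag (fun i => tail (f i)) n.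
Proof.
  induction n as [|n IH]; intro f; [simpl; unfold tail; ring|].
  rewrite diag_S, IH, (diag_S (fun i => tail (f i))).
  change (diag (fun i => tail (tail f i)) n) with (diag (tail (fun i => tail (f i))) n).
  generalize (diag (tail (fun i => tail (f i))) n). intro d. unfold tail. ring.
Qed.

Lemma diag_transpose n : forall f, diag (fun i j => f j i) n = diag f n.
Proof.
  induction n as [|n IH]; intro f; [reflexivity|].
  rewrite diag_S, diag_S_r. f_equal.
  exact (IH (fun i => tail (f i))).
Qed.

Lemma diag_ext n : forall f g, (forall i j, (i + j = n)%nat -> f i j = g i j) ->
  diag f n = diag g n.
Proof.
  induction n as [|n IH]; intros f g H; simpl; rewrite (H O) by lia; [reflexivity|].
  f_equal. apply IH. intros i j Hij. apply (H (S i)). lia.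
Qed.

End Homomorphisms.

(** * Formal power series in two variables *)

Definition S2 : rng := sers (sers Crng).
(* Otherwise [simpl] turns the ring operations on series into functions of the
   exponents, which [ring] does not recognize. *)
Arguments car _ : simpl never.
Arguments r0 _ : simpl never.
Arguments r1 _ : simpl never.
Arguments radd _ _ _ : simpl never.
Arguments rmul _ _ _ : simpl never.
Arguments rsub _ _ _ : simpl never.
Arguments ropp _ _ : simpl never.
Add Ring S2_ring : (rth S2).
Add Ring S1_ring : (rth (sers Crng)).

(* Coefficients have type [Crng], which [ring] does not identify with [C]. *)
Add Ring coef_ring : (C_ring_theory :
  @ring_theory Crng (RtoC 0) (RtoC 1) Cplus Cmult Cminus Copp eq).
Ltac cring :=
  cbv beta iota delta [radd rmul rsub ropp r0 r1 Crng];
  match goal with |- @eq _ ?a ?b =>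
    first [change (@eq C a b); ring | change (@eq (car Crng) a b); ring] end.

Lemma S2_ext (f g : S2) : (forall i j, f i j = g i j) -> f = g.
Proof.
  intro H. apply functional_extensionality; intro i.
  apply functional_extensionality; intro j. apply H.
Qed.

Definition cst (c : C) : S2 := const (const c).
Definition varx : S2 := fun i => match i with 1%nat => r1 | _ => r0 end.
Definition vary : S2 :=
  const (fun j => match j with 1%nat => RtoC 1 | _ => RtoC 0 end).
Definition dx (f : S2) : S2 := deriv f.
Definition dy (f : S2) : S2 := fun i => deriv (f i).
Definition flip (f : S2) : S2 := fun i j => f j i.

Lemma add_coef (f g : S2) i j : (f + g)%S i j = f i j + g i j.
Proof. reflexivity. Qed.
Lemma sub_coef (f g : S2) i j : (f - g)%S i j = f i j - g i j.
Proof. reflexivity. Qed.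
Lemma opp_coef (f : S2) i j : (- f)%S i j = - f i j.
Proof. reflexivity. Qed.
Lemma one_cst : (1%S : S2) = cst 1.
Proof. reflexivity. Qed.

Lemma cst_coef c i j :
  cst c i j = match i, j with O, O => c | _, _ => RtoC 0 end.
Proof. destruct i, j; reflexivity. Qed.

Lemma cst_mul_coef c (f : S2) i j : (cst c * f)%S i j = c * f i j.
Proof.
  change ((cst c * f)%S i) with (cprod (const (const c)) f i).
  rewrite cprod_const. apply cprod_const.
Qed.

Lemma cst_add a b : cst (a + b) = (cst a + cst b)%S.
Proof.
  apply S2_ext; intros i j. rewrite add_coef, !cst_coef.
  destruct i, j; cring.
Qed.

Lemma cst_mul a b : cst (a * b) = (cst a * cst b)%S.
Proof.
  apply S2_ext; intros i j. rewrite cst_mul_coef, !cst_coef.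
  destruct i, j; cring.
Qed.

Lemma cst_opp a : cst (- a) = (- cst a)%S.
Proof.
  apply S2_ext; intros i j. rewrite opp_coef, !cst_coef.
  destruct i, j; cring.
Qed.

Lemma cst_sub a b : cst (a - b) = (cst a - cst b)%S.
Proof. unfold Cminus. rewrite cst_add, cst_opp. ring. Qed.

Lemma cst_0 : cst 0 = 0%S.
Proof. apply S2_ext; intros [|i] [|j]; reflexivity. Qed.

Lemma varx_mul_S (f : S2) i j : (varx * f)%S (S i) j = f i j.
Proof.
  change ((varx * f)%S (S i)) with
    ((0 * f (S i) + cprod (const 1) f i)%S : sers Crng).
  rewrite cprod_const. replace (0 * f (S i) + 1 * f i)%S with (f i) by ring.
  reflexivity.
Qed.

Lemma varx_mul_0 (f : S2) j : (varx * f)%S O j = RtoC 0.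
Proof.
  change ((varx * f)%S O) with ((0 * f O)%S : sers Crng).
  replace (0 * f O)%S with (0%S : sers Crng) by ring. reflexivity.
Qed.

Lemma vary_mul_S (f : S2) i j : (vary * f)%S i (S j) = f i j.
Proof.
  change ((vary * f)%S i) with
    (cprod (const (fun j => match j with 1%nat => RtoC 1 | _ => RtoC 0 end)) f i).
  rewrite cprod_const.
  change (0 * f i (S j) + cprod (A := Crng) (const (A := Crng) (RtoC 1)) (f i) j = f i j).
  rewrite cprod_const. cring.
Qed.

Lemma vary_mul_0 (f : S2) i : (vary * f)%S i O = RtoC 0.
Proof.
  change ((vary * f)%S i) with
    (cprod (const (fun j => match j with 1%nat => RtoC 1 | _ => RtoC 0 end)) f i).
  rewrite cprod_const. apply Cmult_0_l.
Qed.

Lemma natmul_C n (c : C) : natmul (A := Crng) n c = INR n * c.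
Proof.
  induction n as [|n IH]; [simpl; cring|].
  rewrite S_INR, RtoC_plus. simpl natmul. rewrite IH. cring.
Qed.

Lemma natmul_coef n (g : sers Crng) j : natmul n g j = natmul (A := Crng) n (g j).
Proof.
  induction n as [|n IH]; [reflexivity|].
  simpl. rewrite <- IH. reflexivity.
Qed.

Lemma dx_coef (f : S2) i j : dx f i j = INR (S i) * f (S i) j.
Proof.
  unfold dx, deriv. rewrite natmul_coef. apply natmul_C.
Qed.

Lemma dy_coef (f : S2) i j : dy f i j = INR (S j) * f i (S j).
Proof. unfold dy, deriv. apply natmul_C. Qed.

Lemma dx_add (f g : S2) : dx (f + g)%S = (dx f + dx g)%S.
Proof. apply (@deriv_add (sers Crng)). Qed.

Lemma dy_add (f g : S2) : dy (f + g)%S = (dy f + dy g)%S.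
Proof.
  apply functional_extensionality; intro i. apply (@deriv_add Crng).
Qed.

Lemma dx_mul (f g : S2) : dx (f * g)%S = (dx f * g + f * dx g)%S.
Proof. apply (@deriv_mul (sers Crng)). Qed.

Lemma dy_mul (f g : S2) : dy (f * g)%S = (dy f * g + f * dy g)%S.
Proof.
  apply (@coefwise_derivation (sers Crng) (@deriv Crng)).
  - apply (@deriv_add Crng).
  - apply (@deriv_mul Crng).
Qed.

Lemma dx_cst c : dx (cst c) = 0%S.
Proof.
  apply S2_ext; intros i j. rewrite dx_coef, cst_coef. apply Cmult_0_r.
Qed.

Lemma dy_cst c : dy (cst c) = 0%S.
Proof.
  apply S2_ext; intros i j. rewrite dy_coef, cst_coef.
  destruct i; apply Cmult_0_r.
Qed.

Lemma dx_varx : dx varx = 1%S.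
Proof.
  apply S2_ext; intros i j. rewrite dx_coef.
  destruct i as [|i]; [|apply Cmult_0_r].
  destruct j; [apply Cmult_1_r|apply Cmult_0_r].
Qed.

Lemma dy_varx : dy varx = 0%S.
Proof.
  apply S2_ext; intros i j. rewrite dy_coef.
  destruct i as [|[|i]]; apply Cmult_0_r.
Qed.

Lemma dx_dy (f : S2) : dx (dy f) = dy (dx f).
Proof.
  apply S2_ext; intros i j. rewrite dx_coef, !dy_coef, dx_coef. cring.
Qed.

Lemma mul_coef_00 (f g : S2) : (f * g)%S O O = f O O * g O O.
Proof. reflexivity. Qed.

Lemma const_coefs_mul (a : nat -> C) (g : S2) i : forall j,
  (((fun k => const (A := Crng) (a k)) : S2) * g)%S j i
  = cprod (A := Crng) a (fun k => g k i) j.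
Proof.
  intro j. revert a. induction j as [|j IH]; intro a; [apply (@cprod_const Crng)|].
  change ((const (A := Crng) (a O) * g (S j))%S i
    + (((fun k => const (A := Crng) (tail a k)) : S2) * g)%S j i
    = a O * g (S j) i + cprod (A := Crng) (tail a) (fun k => g k i) j).
  rewrite IH. f_equal. apply (@cprod_const Crng).
Qed.

(** Not visible from the recursive product, which treats the two variables
    differently: split off the terms without [y] and recurse on the other index. *)
Lemma flip_mul (f g : S2) : flip (f * g)%S = (flip f * flip g)%S.
Proof.
  apply S2_ext; intros j i. unfold flip at 1. revert f.
  assert (split_r : forall f : S2, flip f =
    (((fun j => const (A := Crng) (f O j)) : S2) + vary * flip (tail f))%S).
  { intro f. apply S2_ext; intros b [|a]; rewrite add_coef;
      [rewrite vary_mul_0 | rewrite vary_mul_S]; unfold flip, tail; simpl; cring. }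
  induction i as [|i IH]; intro f; rewrite split_r.
  - replace ((((fun j => const (f O j)) : S2) + vary * flip (tail f)) * flip g)%S
      with (((fun j => const (f O j)) : S2) * flip g
            + vary * (flip (tail f) * flip g))%S by ring.
    rewrite add_coef, vary_mul_0, const_coefs_mul.
    rewrite Cplus_0_r. reflexivity.
  - replace ((((fun j => const (f O j)) : S2) + vary * flip (tail f)) * flip g)%S
      with (((fun j => const (f O j)) : S2) * flip g
            + vary * (flip (tail f) * flip g))%S by ring.
    rewrite add_coef, vary_mul_S, const_coefs_mul, <- IH. reflexivity.
Qed.

Lemma flip_dx (f : S2) : flip (dx f) = dy (flip f).
Proof.
  apply S2_ext; intros i j. unfold flip at 1. rewrite dy_coef, dx_coef. reflexivity.
Qed.

Lemma flip_dy (f : S2) : flip (dy f) = dx (flip f).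
Proof.
  apply S2_ext; intros i j. unfold flip at 1. rewrite dy_coef, dx_coef. reflexivity.
Qed.

(** ** Order of vanishing *)

Definition ord (f : S2) (n : nat) : Prop :=
  forall i j, (i + j < n)%nat -> f i j = RtoC 0.

Lemma ord_add f g n : ord f n -> ord g n -> ord (f + g)%S n.
Proof. intros Hf Hg i j H. rewrite add_coef, Hf, Hg by exact H. apply Cplus_0_l. Qed.

Lemma ord_opp f n : ord f n -> ord (- f)%S n.
Proof. intros Hf i j H. rewrite opp_coef, Hf by exact H. apply Copp_0. Qed.

Lemma ord_sub f g n : ord f n -> ord g n -> ord (f - g)%S n.
Proof.
  intros Hf Hg. replace (f - g)%S with (f + - g)%S by ring.
  apply ord_add; [exact Hf | apply ord_opp; exact Hg].
Qed.

Lemma ord_weaken f n m : (m <= n)%nat -> ord f n -> ord f m.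
Proof. intros Hm Hf i j H. apply Hf. lia. Qed.

Lemma ord_zero n : ord 0%S n.
Proof. intros i j _. reflexivity. Qed.

Lemma mul_zero_coef (f g : S2) i j :
  (forall a b, (a <= i)%nat -> (b <= j)%nat ->
     f a b * g (i - a)%nat (j - b)%nat = RtoC 0) ->
  (f * g)%S i j = RtoC 0.
Proof.
  intro H.
  apply (@cprod_zero (sers Crng) Crng (fun h => h j)); [reflexivity|].
  intros a Ha.
  apply (@cprod_zero Crng Crng (fun c => c)); [reflexivity|].
  intros b Hb. apply H; assumption.
Qed.

Lemma mul_single_coef (f g : S2) i j i0 j0 :
  (i0 <= i)%nat -> (j0 <= j)%nat ->
  (forall a b, (a <= i)%nat -> (b <= j)%nat -> (a, b) <> (i0, j0) ->
     f a b * g (i - a)%nat (j - b)%nat = RtoC 0) ->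
  (f * g)%S i j = f i0 j0 * g (i - i0)%nat (j - j0)%nat.
Proof.
  intros Hi Hj H.
  transitivity ((f i0 * g (i - i0)%nat)%S j).
  - apply (@cprod_single (sers Crng) Crng (fun h => h j)); [reflexivity | exact Hi |].
    intros a Ha Hne.
    apply (@cprod_zero Crng Crng (fun c => c)); [reflexivity|].
    intros b Hb. apply H; [assumption | assumption | congruence].
  - apply (@cprod_single Crng Crng (fun c => c)); [reflexivity | exact Hj |].
    intros b Hb Hne. apply H; [assumption | assumption | congruence].
Qed.

Lemma ord_mul f g n m : ord f n -> ord g m -> ord (f * g)%S (n + m).
Proof.
  intros Hf Hg i j H. apply mul_zero_coef. intros a b Ha Hb.
  destruct (Nat.lt_ge_cases (a + b) n) as [L|L].
  - rewrite Hf by exact L. apply Cmult_0_l.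
  - rewrite Hg by lia. apply Cmult_0_r.
Qed.

Lemma ord_mul_l f g n : ord f n -> ord (f * g)%S n.
Proof.
  intro Hf. replace n with (n + 0)%nat by lia. apply ord_mul; [exact Hf|].
  intros i j H; lia.
Qed.

Lemma ord_mul_r f g n : ord g n -> ord (f * g)%S n.
Proof.
  intro Hf. replace (f * g)%S with (g * f)%S by ring. apply ord_mul_l, Hf.
Qed.

Lemma ord_dx f n : ord f (S n) -> ord (dx f) n.
Proof. intros Hf i j H. rewrite dx_coef, Hf by lia. apply Cmult_0_r. Qed.

Lemma ord_dy f n : ord f (S n) -> ord (dy f) n.
Proof. intros Hf i j H. rewrite dy_coef, Hf by lia. apply Cmult_0_r. Qed.

Lemma ord_varx : ord varx 1.
Proof. intros i j H. assert (i = O) by lia; assert (j = O) by lia; subst. reflexivity. Qed.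

Lemma ord_vary : ord vary 1.
Proof. intros i j H. assert (i = O) by lia; assert (j = O) by lia; subst. reflexivity. Qed.

Lemma ord_1 f : f O O = RtoC 0 -> ord f 1.
Proof. intros H i j L. assert (i = O) by lia; assert (j = O) by lia; subst. exact H. Qed.

Lemma ord_2 f : f O O = RtoC 0 -> f 1%nat O = RtoC 0 -> f O 1%nat = RtoC 0 -> ord f 2.
Proof.
  intros H0 H1 H2 i j L. destruct i as [|[|i]], j as [|[|j]]; try lia; assumption.
Qed.

Lemma flip_ord f n : ord f n -> ord (flip f) n.
Proof. intros H i j L. apply H. lia. Qed.

Lemma ord_all_0 f : (forall n, ord f n) -> f = 0%S.
Proof. intro H. apply S2_ext; intros i j. apply (H (S (i + j))). lia. Qed.

(** ** Fixed points of contractions *)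

Definition ord_pair (U : S2 * S2) n := ord (fst U) n /\ ord (snd U) n.
Definition sub_pair (U V : S2 * S2) : S2 * S2 :=
  ((fst U - fst V)%S, (snd U - snd V)%S).

(** The iterates from 0 stabilize in each degree. The invariant [k] is there for
    nonlinear maps, which contract only on series of sufficient order. *)
Lemma contraction_fixpoint_pair (k : nat) (T : S2 * S2 -> S2 * S2) :
  (forall U, ord_pair U k -> ord_pair (T U) k) ->
  (forall U V n, ord_pair U k -> ord_pair V k ->
     ord_pair (sub_pair U V) n -> ord_pair (sub_pair (T U) (T V)) (S n)) ->
  exists U, ord_pair U k /\ T U = U.
Proof.
  intros Hk HT.
  set (u := fun n => Nat.iter n T (0%S : S2, 0%S : S2)).
  assert (u_k : forall n, ord_pair (u n) k).
  { induction n as [|n IH]; [split; apply ord_zero | apply Hk, IH]. }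
  assert (u_step : forall n, ord_pair (sub_pair (u (S n)) (u n)) n).
  { induction n as [|n IH]; [split; intros i j L; lia|].
    exact (HT (u (S n)) (u n) n (u_k (S n)) (u_k n) IH). }
  assert (u_stab : forall m n, ord_pair (sub_pair (u (n + m)%nat) (u n)) n).
  { induction m as [|m IH]; intro n.
    - rewrite Nat.add_0_r. split; intros i j _; simpl; apply Cplus_opp_r.
    - replace (n + S m)%nat with (S (n + m)) by lia.
      destruct (IH n) as [H1 H2], (u_step (n + m)%nat) as [H3 H4].
      unfold sub_pair in *; split; cbn [fst snd] in *.
      + replace (fst (u (S (n + m))) - fst (u n))%S with
          ((fst (u (S (n + m))) - fst (u (n + m)%nat))
           + (fst (u (n + m)%nat) - fst (u n)))%S by ring.
        apply ord_add; [|exact H1]. eapply ord_weaken; [|exact H3]. lia.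
      + replace (snd (u (S (n + m))) - snd (u n))%S with
          ((snd (u (S (n + m))) - snd (u (n + m)%nat))
           + (snd (u (n + m)%nat) - snd (u n)))%S by ring.
        apply ord_add; [|exact H2]. eapply ord_weaken; [|exact H4]. lia. }
  set (U := ((fun i j => fst (u (S (i + j))) i j,
              fun i j => snd (u (S (i + j))) i j) : S2 * S2)).
  assert (U_u : forall n, ord_pair (sub_pair U (u n)) n).
  { intro n. split; intros i j L; simpl; rewrite sub_coef; simpl;
    replace n with (S (i + j) + (n - S (i + j)))%nat by lia;
    destruct (u_stab (n - S (i + j))%nat (S (i + j))) as [H1 H2];
    simpl fst in H1; simpl snd in H2.
    - specialize (H1 i j (Nat.lt_succ_diag_r _)). rewrite sub_coef in H1.
      rewrite <- Copp_0, <- H1. apply eq_sym, Copp_minus_distr.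
    - specialize (H2 i j (Nat.lt_succ_diag_r _)). rewrite sub_coef in H2.
      rewrite <- Copp_0, <- H2. apply eq_sym, Copp_minus_distr. }
  assert (U_k : ord_pair U k).
  { split; intros i j L; apply u_k, L. }
  exists U. split; [exact U_k|].
  assert (D : forall n, ord_pair (sub_pair (T U) U) n).
  { intro n. destruct (HT U (u n) n U_k (u_k n) (U_u n)) as [H1 H2].
    destruct (U_u (S n)) as [H3 H4].
    change (T (u n)) with (u (S n)) in H1, H2.
    unfold sub_pair in *; split; cbn [fst snd] in *.
    - replace (fst (T U) - fst U)%S with
        ((fst (T U) - fst (u (S n))) - (fst U - fst (u (S n))))%S by ring.
      eapply ord_weaken; [|apply ord_sub; [exact H1 | exact H3]]. lia.
    - replace (snd (T U) - snd U)%S with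
        ((snd (T U) - snd (u (S n))) - (snd U - snd (u (S n))))%S by ring.
      eapply ord_weaken; [|apply ord_sub; [exact H2 | exact H4]]. lia. }
  apply injective_projections.
  - replace (fst (T U)) with ((fst (T U) - fst U) + fst U)%S by ring.
    rewrite (ord_all_0 (fst (T U) - fst U)%S); [ring|].
    intro n; apply (D n).
  - replace (snd (T U)) with ((snd (T U) - snd U) + snd U)%S by ring.
    rewrite (ord_all_0 (snd (T U) - snd U)%S); [ring|].
    intro n; apply (D n).
Qed.

Lemma contraction_fixpoint (k : nat) (T : S2 -> S2) :
  (forall f, ord f k -> ord (T f) k) ->
  (forall f g n, ord f k -> ord g k -> ord (f - g)%S n -> ord (T f - T g)%S (S n)) ->
  exists f, ord f k /\ T f = f.
Proof.
  intros Hk HT.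
  destruct (contraction_fixpoint_pair k (fun U => (T (fst U), (0%S : S2))))
    as [U [[Uk _] HU]].
  - intros U [H _]. split; [apply Hk, H | apply ord_zero].
  - intros U V n [H1 _] [H2 _] [H3 _]. split; [apply HT; assumption|].
    simpl. replace (0 - 0)%S with (0%S : S2) by ring. apply ord_zero.
  - exists (fst U). split; [exact Uk|].
    apply (f_equal fst) in HU. exact HU.
Qed.

(** Solve [c g = 1 - (f - c) g] for the constant term [c] of [f]. *)
Lemma unit_inverse (f : S2) : f O O <> RtoC 0 -> exists g, (f * g)%S = 1%S.
Proof.
  intro H. set (h := (f - cst (f O O))%S).
  assert (Hh : ord h 1).
  { apply ord_1. unfold h. rewrite sub_coef, cst_coef. apply Cplus_opp_r. }
  destruct (contraction_fixpoint 0 (fun g => cst (/ f O O) * (1 - h * g))%S)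
    as [g [_ Hg]].
  - intros g _ i j L. lia.
  - intros g1 g2 n _ _ Hn.
    replace (cst (/ f O O) * (1 - h * g1) - cst (/ f O O) * (1 - h * g2))%S
      with (- cst (/ f O O) * (h * (g1 - g2)))%S by ring.
    apply ord_mul_r. apply (ord_mul h (g1 - g2)%S 1 n); assumption.
  - exists g.
    assert (E : (cst (f O O) * g)%S = (1 - h * g)%S).
    { rewrite <- Hg at 1.
      replace (cst (f O O) * (cst (/ f O O) * (1 - h * g)))%S with
        ((cst (f O O) * cst (/ f O O)) * (1 - h * g))%S by ring.
      rewrite <- cst_mul, Cinv_r by exact H. change (cst 1) with (1%S : S2). ring. }
    replace (f * g)%S with (cst (f O O) * g + h * g)%S by (unfold h; ring).
    rewrite E. ring.
Qed.

(** ** Leading monomials *)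

(** The monomial order: by total degree, and among monomials of equal degree
    the larger power of [x] comes first. It refines the total degree, so terms of
    higher degree in a vector field do not affect leading monomials. *)
Definition mono_le (i j a b : nat) : Prop :=
  (i + j < a + b)%nat \/ ((i + j = a + b)%nat /\ (a <= i)%nat).

Definition from (f : S2) (i j : nat) : Prop :=
  forall a b, f a b <> RtoC 0 -> mono_le i j a b.

Lemma leading_monomial (f : S2) : f <> 0%S ->
  exists i j, f i j <> RtoC 0 /\ from f i j.
Proof.
  intro Hf.
  assert (Hex : exists n, exists i, (i <= n)%nat /\ f i (n - i)%nat <> RtoC 0).
  { apply NNPP; intro HN. apply Hf. apply S2_ext; intros i j.
    apply NNPP; intro Hij. apply HN. exists (i + j)%nat, i.
    split; [lia|]. replace (i + j - i)%nat with j by lia. exact Hij. }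
  assert (least : forall P : nat -> Prop, (exists n, P n) ->
    exists n, P n /\ forall m, (m < n)%nat -> ~ P m).
  { intros P [n Hn]. revert Hn. induction n as [n IH] using lt_wf_ind. intro Hn.
    destruct (classic (exists m, (m < n)%nat /\ P m)) as [[m [Lm Pm]]|HN].
    - exact (IH m Lm Pm).
    - exists n. split; [exact Hn|]. intros m Lm Pm. apply HN. exists m. tauto. }
  destruct (least _ Hex) as [n [[i1 [Li1 Hi1]] Hmin]].
  destruct (least (fun j => (j <= n)%nat /\ f (n - j)%nat j <> RtoC 0))
    as [j [[Lj Hj] Hjmin]].
  { exists (n - i1)%nat. split; [lia|].
    replace (n - (n - i1))%nat with i1 by lia. exact Hi1. }
  exists (n - j)%nat, j. split; [exact Hj|].
  intros a b Hab. unfold mono_le.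
  destruct (Nat.lt_trichotomy (a + b) n) as [L|[L|L]].
  - exfalso. apply (Hmin (a + b)%nat L). exists a. split; [lia|].
    replace (a + b - a)%nat with b by lia. exact Hab.
  - right. split; [lia|].
    destruct (Nat.lt_ge_cases b j) as [Lb|Lb]; [|lia].
    exfalso. apply (Hjmin b Lb). split; [lia|].
    replace (n - b)%nat with a by lia. exact Hab.
  - left. lia.
Qed.

Lemma from_mul f g i j k l : from f i j -> from g k l ->
  from (f * g)%S (i + k) (j + l)
  /\ (f * g)%S (i + k)%nat (j + l)%nat = f i j * g k l.
Proof.
  intros Hf Hg. split.
  - intros a b Hab. apply NNPP; intro HN. apply Hab.
    apply mul_zero_coef. intros s t Hs Ht.
    destruct (Ceq_dec (f s t) 0) as [E|E]; [rewrite E; apply Cmult_0_l|].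
    destruct (Ceq_dec (g (a - s)%nat (b - t)%nat) 0) as [E'|E'];
      [rewrite E'; apply Cmult_0_r|].
    exfalso. apply HN. specialize (Hf _ _ E). specialize (Hg _ _ E').
    unfold mono_le in *. lia.
  - rewrite (mul_single_coef f g _ _ i j); try lia.
    + f_equal; f_equal; lia.
    + intros s t Hs Ht Hne.
      destruct (Ceq_dec (f s t) 0) as [E|E]; [rewrite E; apply Cmult_0_l|].
      destruct (Ceq_dec (g (i + k - s)%nat (j + l - t)%nat) 0) as [E'|E'];
        [rewrite E'; apply Cmult_0_r|].
      exfalso. apply Hne. specialize (Hf _ _ E). specialize (Hg _ _ E').
      unfold mono_le in *. f_equal; lia.
Qed.

(** Leading monomials multiply. *)
Lemma S2_integral (f g : S2) : (f * g)%S = 0%S -> f = 0%S \/ g = 0%S.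
Proof.
  intro H. apply NNPP; intro HN.
  assert (Hf : f <> 0%S) by tauto. assert (Hg : g <> 0%S) by tauto.
  destruct (leading_monomial f Hf) as [i [j [Hij Lf]]].
  destruct (leading_monomial g Hg) as [k [l [Hkl Lg]]].
  destruct (from_mul f g i j k l Lf Lg) as [_ E].
  rewrite H in E. symmetry in E. exact (Cmult_neq_0 _ _ Hij Hkl E).
Qed.

Lemma S2_cancel (h f g : S2) : h <> 0%S -> (h * f)%S = (h * g)%S -> f = g.
Proof.
  intros Hh H. destruct (S2_integral h (f - g)%S) as [E|E].
  - replace (h * (f - g))%S with (h * f - h * g)%S by ring. rewrite H. ring.
  - contradiction.
  - replace f with ((f - g) + g)%S by ring. rewrite E. ring.
Qed.

Lemma mul_neq_0 (f g : S2) : f <> 0%S -> g <> 0%S -> (f * g)%S <> 0%S.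
Proof. intros Hf Hg H. destruct (S2_integral _ _ H); contradiction. Qed.

Lemma rpow_neq_0 (f : S2) n : f <> 0%S -> rpow f n <> 0%S.
Proof.
  intro Hf. induction n as [|n IH]; simpl; [|apply mul_neq_0; assumption].
  intro H. apply (f_equal (fun h : S2 => h O O)) in H. apply C1_nz. exact H.
Qed.

(** * Formal vector fields *)

Definition vder (V1 V2 f : S2) : S2 := (V1 * dx f + V2 * dy f)%S.

Lemma vder_add V1 V2 f g : vder V1 V2 (f + g)%S = (vder V1 V2 f + vder V1 V2 g)%S.
Proof. unfold vder. rewrite dx_add, dy_add. ring. Qed.

Lemma vder_mul V1 V2 f g :
  vder V1 V2 (f * g)%S = (vder V1 V2 f * g + f * vder V1 V2 g)%S.
Proof. unfold vder. rewrite dx_mul, dy_mul. ring. Qed.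

Lemma vder_cst V1 V2 c : vder V1 V2 (cst c) = 0%S.
Proof. unfold vder. rewrite dx_cst, dy_cst. ring. Qed.

Lemma vder_cst_mul V1 V2 c f : vder V1 V2 (cst c * f)%S = (cst c * vder V1 V2 f)%S.
Proof. rewrite vder_mul, vder_cst. ring. Qed.

Lemma vder_sub V1 V2 f g : vder V1 V2 (f - g)%S = (vder V1 V2 f - vder V1 V2 g)%S.
Proof.
  replace (f - g)%S with (f + cst (Copp (RtoC 1)) * g)%S.
  - rewrite vder_add, vder_cst_mul, cst_opp. change (cst (RtoC 1)) with (1%S : S2). ring.
  - rewrite cst_opp. change (cst (RtoC 1)) with (1%S : S2). ring.
Qed.

Lemma cst_INR_S n : cst (INR (S n)) = (cst (INR n) + 1)%S.
Proof. rewrite S_INR, RtoC_plus, cst_add. reflexivity. Qed.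

Lemma cst_INR_0 : cst (INR 0) = 0%S.
Proof. apply cst_0. Qed.

(** Powers of an eigenfunction, the eigenvalue [c] being a function. *)
Lemma vder_rpow V1 V2 f c n : vder V1 V2 f = (c * f)%S ->
  vder V1 V2 (rpow f n) = (cst (INR n) * c * rpow f n)%S.
Proof.
  intro H. induction n as [|n IH].
  - rewrite cst_INR_0. change (rpow f 0) with (cst 1). rewrite vder_cst. ring.
  - change (rpow f (S n)) with (f * rpow f n)%S.
    rewrite vder_mul, H, IH, cst_INR_S. ring.
Qed.

Lemma vder_lie V1 V2 W1 W2 f :
  (vder V1 V2 (vder W1 W2 f) - vder W1 W2 (vder V1 V2 f))%S
  = vder (vder V1 V2 W1 - vder W1 W2 V1)%S (vder V1 V2 W2 - vder W1 W2 V2)%S f.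
Proof.
  unfold vder. rewrite !dx_add, !dy_add, !dx_mul, !dy_mul, !dx_dy. ring.
Qed.

Lemma ord_vder V1 V2 f n : ord V1 2 -> ord V2 2 -> ord f n ->
  ord (vder V1 V2 f) (S n).
Proof.
  intros H1 H2 Hf. destruct n as [|n].
  - apply ord_add; apply ord_mul_l; (apply ord_weaken with 2%nat; [lia | assumption]).
  - apply ord_add.
    + apply (ord_mul V1 (dx f) 2 n); [exact H1 | apply ord_dx, Hf].
    + apply (ord_mul V2 (dy f) 2 n); [exact H2 | apply ord_dy, Hf].
Qed.

Lemma euler_x_coef f i j : (varx * dx f)%S i j = INR i * f i j.
Proof.
  destruct i as [|i]; [rewrite varx_mul_0; simpl; cring|].
  rewrite varx_mul_S. apply dx_coef.
Qed.

Lemma euler_y_coef f i j : (vary * dy f)%S i j = INR j * f i j.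
Proof.
  destruct j as [|j]; [rewrite vary_mul_0; simpl; cring|].
  rewrite vary_mul_S. apply dy_coef.
Qed.

Section Linearizable.
Variables (l1 l2 : C) (z1 z2 : S2).
Hypothesis z1_lin : ord (z1 - cst l1 * varx)%S 2.
Hypothesis z2_lin : ord (z2 - cst l2 * vary)%S 2.
Hypothesis nonresonant : forall n m : BinInt.Z,
  IZR n * l1 + IZR m * l2 = 0 -> n = 0%Z /\ m = 0%Z.

Definition weight (i j : nat) : C := INR i * l1 + INR j * l2.

Lemma weight_inj i j k l : weight i j = weight k l -> i = k /\ j = l.
Proof.
  intro H.
  destruct (nonresonant (Z.of_nat i - Z.of_nat k) (Z.of_nat j - Z.of_nat l)) as [H1 H2].
  - rewrite !minus_IZR, <- !INR_IZR_INZ, !RtoC_minus.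
    unfold weight in H.
    replace ((INR i - INR k) * l1 + (INR j - INR l) * l2) with
      ((INR i * l1 + INR j * l2) - (INR k * l1 + INR l * l2)) by ring.
    rewrite H. ring.
  - lia.
Qed.

Lemma vder_split f : vder z1 z2 f =
  (vder (cst l1 * varx) (cst l2 * vary) f
   + vder (z1 - cst l1 * varx) (z2 - cst l2 * vary) f)%S.
Proof. unfold vder. ring. Qed.

Lemma vder_linear_coef f i j :
  vder (cst l1 * varx)%S (cst l2 * vary)%S f i j = weight i j * f i j.
Proof.
  unfold vder.
  replace (cst l1 * varx * dx f + cst l2 * vary * dy f)%S with
    (cst l1 * (varx * dx f) + cst l2 * (vary * dy f))%S by ring.
  rewrite add_coef, !cst_mul_coef, euler_x_coef, euler_y_coef.
  unfold weight. cring.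
Qed.

(** The terms of higher degree of the field only contribute monomials of larger
    total degree, so that the leading term of [f] only sees the diagonal part. *)
Lemma vder_from f i j : from f i j ->
  from (vder z1 z2 f) i j /\ vder z1 z2 f i j = weight i j * f i j.
Proof.
  intro Hf.
  assert (Hr : ord (vder (z1 - cst l1 * varx) (z2 - cst l2 * vary) f)%S (S (i + j))).
  { apply ord_vder; [assumption | assumption |].
    intros a b L. apply NNPP; intro HN. specialize (Hf a b HN).
    unfold mono_le in Hf. lia. }
  rewrite vder_split. split.
  - intros a b Hab. destruct (Ceq_dec (f a b) 0) as [E|E]; [|exact (Hf a b E)].
    rewrite add_coef, vder_linear_coef, E, Cmult_0_r, Cplus_0_l in Hab.
    unfold mono_le.
    destruct (Nat.lt_ge_cases (a + b) (S (i + j))) as [L|L]; [|lia].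
    exfalso. apply Hab, Hr, L.
  - rewrite add_coef, vder_linear_coef, (Hr i j) by lia. cring.
Qed.

(** For [c] without constant term, [Z f = c f] has a formal solution with
    [f(0) = 1], since no monomial but the constant one has weight 0. *)
Lemma formal_eigenfunction (c : S2) : c O O = RtoC 0 ->
  exists f : S2, f O O = RtoC 1 /\ vder z1 z2 f = (c * f)%S.
Proof.
  intro Hc. apply ord_1 in Hc.
  set (r1' := (z1 - cst l1 * varx)%S). set (r2' := (z2 - cst l2 * vary)%S).
  set (L := fun (g : S2) => (fun i j =>
    match i, j with O, O => RtoC 1 | _, _ => g i j / weight i j end) : S2).
  assert (L_ord : forall g h n, ord (g - h)%S n -> ord (L g - L h)%S n).
  { intros g h n H i j Lij. specialize (H i j Lij).
    rewrite sub_coef in *. unfold L.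
    assert (E : g i j = h i j).
    { replace (g i j) with ((g i j - h i j) + h i j) by cring. rewrite H. cring. }
    rewrite E. destruct i, j; cring. }
  destruct (contraction_fixpoint 0 (fun f => L (c * f - vder r1' r2' f)%S))
    as [f [_ Hf]].
  - intros g _ i j Hij; lia.
  - intros f g n _ _ H. apply L_ord.
    replace (c * f - vder r1' r2' f - (c * g - vder r1' r2' g))%S with
      (c * (f - g) - vder r1' r2' (f - g))%S by (rewrite vder_sub; ring).
    apply ord_sub; [exact (ord_mul c (f - g)%S 1 n Hc H)|].
    apply ord_vder; assumption.
  - exists f. split; [rewrite <- Hf; reflexivity|].
    rewrite vder_split. fold r1' r2'. apply S2_ext; intros i j.
    rewrite add_coef, vder_linear_coef.
    assert (H00 : (c * f - vder r1' r2' f)%S O O = RtoC 0).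
    { rewrite sub_coef, mul_coef_00, (Hc O O) by lia.
      rewrite (ord_vder r1' r2' f 0 z1_lin z2_lin) by (try lia; intros a b Lab; lia).
      cring. }
    destruct (Nat.eq_dec (i + j) 0) as [E|E].
    + assert (i = O) by lia; assert (j = O) by lia; subst i j.
      rewrite sub_coef in H00. unfold weight; simpl INR.
      transitivity (vder r1' r2' f O O); [cring|].
      replace (vder r1' r2' f O O) with
        ((c * f)%S O O - ((c * f)%S O O - vder r1' r2' f O O)) by cring.
      rewrite H00. cring.
    + assert (W : weight i j <> 0).
      { intro W. destruct (weight_inj i j 0 0) as [E1 E2]; [|lia].
        rewrite W. unfold weight; simpl; cring. }
      assert (E' : f i j = ((c * f)%S i j - vder r1' r2' f i j) / weight i j).
      { transitivity (L (c * f - vder r1' r2' f)%S i j);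
          [exact (eq_sym (f_equal (fun h : S2 => h i j) Hf))|].
        destruct i as [|i], j as [|j]; try reflexivity. lia. }
      rewrite E' at 1. set (p := (c * f)%S i j). set (q := vder r1' r2' f i j).
      clearbody p q. change (weight i j * ((p - q) / weight i j) + q = p :> C).
      field. exact W.
Qed.

(** Let [X], [W] be eigenfunctions of [Z] with leading monomials [x], [y]. A
    quotient [P / Q] with [Z (P / Q) = delta P / Q] is a monomial in [X], [W]. *)
Variables X W : S2.
Hypothesis X_from : from X 1 0.
Hypothesis W_from : from W 0 1.
Hypothesis X_lead : X 1%nat O = RtoC 1.
Hypothesis W_lead : W O 1%nat = RtoC 1.
Hypothesis X_eig : vder z1 z2 X = (cst l1 * X)%S.
Hypothesis W_eig : vder z1 z2 W = (cst l2 * W)%S.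

(** Compare the coefficients of the product of the two leading monomials. *)
Lemma quotient_weight P Q delta i j k l :
  (vder z1 z2 P * Q - P * vder z1 z2 Q)%S = (cst delta * (P * Q))%S ->
  from P i j -> P i j <> RtoC 0 -> from Q k l -> Q k l <> RtoC 0 ->
  delta = weight i j - weight k l.
Proof.
  intros H HP HPn HQ HQn.
  destruct (vder_from P i j HP) as [HP1 HP2].
  destruct (vder_from Q k l HQ) as [HQ1 HQ2].
  apply (f_equal (fun h : S2 => h (i + k)%nat (j + l)%nat)) in H.
  rewrite sub_coef, cst_mul_coef in H.
  rewrite (proj2 (from_mul _ _ _ _ _ _ HP1 HQ)) in H.
  rewrite (proj2 (from_mul _ _ _ _ _ _ HP HQ1)) in H.
  rewrite (proj2 (from_mul _ _ _ _ _ _ HP HQ)) in H.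
  rewrite HP2, HQ2 in H.
  set (p := P i j) in *. set (q := Q k l) in *. clearbody p q.
  change (p <> RtoC 0 :> C) in HPn. change (q <> RtoC 0 :> C) in HQn.
  change (weight i j * p * q - p * (weight k l * q) = delta * (p * q) :> C) in H.
  assert (E : (delta - (weight i j - weight k l)) * (p * q) = 0).
  { replace ((delta - (weight i j - weight k l)) * (p * q)) with
      (delta * (p * q) - (weight i j * p * q - p * (weight k l * q))) by ring.
    rewrite H. ring. }
  destruct (Ceq_dec (delta - (weight i j - weight k l)) 0) as [E0|E0].
  - replace delta with ((delta - (weight i j - weight k l)) + (weight i j - weight k l))
      by ring. rewrite E0. ring.
  - exfalso. exact (Cmult_neq_0 _ _ E0 (Cmult_neq_0 _ _ HPn HQn) E).
Qed.

Lemma quotient_weight_ex P Q delta :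
  (vder z1 z2 P * Q - P * vder z1 z2 Q)%S = (cst delta * (P * Q))%S ->
  P <> 0%S -> Q <> 0%S ->
  exists n m : BinInt.Z, delta = IZR n * l1 + IZR m * l2.
Proof.
  intros H HP HQ.
  destruct (leading_monomial P HP) as [i [j [Hij LP]]].
  destruct (leading_monomial Q HQ) as [k [l [Hkl LQ]]].
  exists (Z.of_nat i - Z.of_nat k)%Z, (Z.of_nat j - Z.of_nat l)%Z.
  rewrite (quotient_weight P Q delta i j k l) by assumption.
  rewrite !minus_IZR, <- !INR_IZR_INZ, !RtoC_minus. unfold weight. ring.
Qed.

(** Series with the same logarithmic derivative along [Z] as [Q] have the leading
    monomial of [Q], as weights are distinct. A combination of [P] and [Q] that
    cancels this monomial has the same logarithmic derivative, so it is zero. This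
    replaces unique factorization. *)
Lemma proportional P Q : Q <> 0%S ->
  (vder z1 z2 P * Q)%S = (P * vder z1 z2 Q)%S -> exists k, P = (cst k * Q)%S.
Proof.
  intros HQ H.
  destruct (leading_monomial Q HQ) as [k [l [Hkl LQ]]].
  assert (lead : forall R, R <> 0%S -> (vder z1 z2 R * Q)%S = (R * vder z1 z2 Q)%S ->
    R k l <> RtoC 0).
  { intros R HR E.
    destruct (leading_monomial R HR) as [i [j [Hij LR]]].
    assert (E0 : RtoC 0 = weight i j - weight k l).
    { apply (quotient_weight R Q 0 i j k l); try assumption.
      rewrite E, cst_0. ring. }
    destruct (weight_inj i j k l) as [-> ->]; [|exact Hij].
    replace (weight i j) with ((weight i j - weight k l) + weight k l) by ring.
    rewrite <- E0. ring. }
  exists (P k l / Q k l).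
  set (c := P k l / Q k l).
  destruct (classic ((P - cst c * Q)%S = 0%S)) as [E|E].
  - replace P with ((P - cst c * Q) + cst c * Q)%S by ring. rewrite E. ring.
  - exfalso. apply (lead _ E).
    + rewrite vder_sub, vder_cst_mul.
      replace ((vder z1 z2 P - cst c * vder z1 z2 Q) * Q)%S with
        (vder z1 z2 P * Q - cst c * vder z1 z2 Q * Q)%S by ring.
      rewrite H. ring.
    + rewrite sub_coef, cst_mul_coef. unfold c.
      set (p := P k l). set (q := Q k l) in *. clearbody p q.
      change (q <> RtoC 0 :> C) in Hkl.
      change (p - p / q * q = RtoC 0 :> C). field. exact Hkl.
Qed.

Lemma X_neq_0 : X <> 0%S.
Proof. intro E. rewrite E in X_lead. apply C1_nz. symmetry. exact X_lead. Qed.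

Lemma W_neq_0 : W <> 0%S.
Proof. intro E. rewrite E in W_lead. apply C1_nz. symmetry. exact W_lead. Qed.

Definition monomial (i j : nat) : S2 := (rpow X i * rpow W j)%S.

Lemma monomial_neq_0 i j : monomial i j <> 0%S.
Proof. apply mul_neq_0; apply rpow_neq_0; [apply X_neq_0 | apply W_neq_0]. Qed.

Lemma vder_monomial i j :
  vder z1 z2 (monomial i j) = (cst (weight i j) * monomial i j)%S.
Proof.
  unfold monomial. rewrite vder_mul.
  rewrite (vder_rpow _ _ X (cst l1)) by exact X_eig.
  rewrite (vder_rpow _ _ W (cst l2)) by exact W_eig.
  unfold weight. rewrite cst_add, !cst_mul. ring.
Qed.

(** Negative exponents stand on the other side: the quotient of [monomial i j] by
    [monomial k l] has the same weight as [P / Q]. *)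
Lemma quotient_monomial P Q delta i j k l :
  (vder z1 z2 P * Q - P * vder z1 z2 Q)%S = (cst delta * (P * Q))%S ->
  Q <> 0%S -> delta = weight i j - weight k l ->
  exists c, (P * monomial k l)%S = (cst c * (Q * monomial i j))%S.
Proof.
  intros H HQ Hd.
  apply proportional; [apply mul_neq_0; [exact HQ | apply monomial_neq_0]|].
  rewrite !vder_mul, !vder_monomial.
  rewrite Hd, cst_sub in H.
  set (M := monomial k l) in *. set (N := monomial i j) in *.
  replace ((vder z1 z2 P * M + P * (cst (weight k l) * M)) * (Q * N))%S with
    ((vder z1 z2 P * Q - P * vder z1 z2 Q) * (M * N) + P * vder z1 z2 Q * M * N
     + cst (weight k l) * (P * Q * M * N))%S by ring.
  rewrite H. ring.
Qed.

End Linearizable.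

(** * Convergence and majorants *)

Open Scope R_scope.


(** In Horner form, which matches the recursion of [cprod]. *)
Fixpoint psum (K : nat) (r : R) (a : nat -> R) : R :=
  match K with O => a O | S L => a O + r * psum L r (tail a) end.

Lemma psum_S K r a : psum (S K) r a = psum K r a + a (S K) * r ^ S K.
Proof.
  revert a; induction K as [|K IH]; intro a; [simpl; unfold tail; ring|].
  change (psum (S (S K)) r a) with (a O + r * psum (S K) r (tail a)).
  rewrite IH. change (psum (S K) r a) with (a O + r * psum K r (tail a)).
  unfold tail; simpl; ring.
Qed.

Lemma psum_le K r a b : 0 <= r -> (forall n, (n <= K)%nat -> a n <= b n) ->
  psum K r a <= psum K r b.
Proof.
  intro Hr. revert a b; induction K as [|K IH]; intros a b H; simpl;
    [apply H; lia|].
  apply Rplus_le_compat; [apply H; lia|].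
  apply Rmult_le_compat_l; [exact Hr|]. apply IH.
  intros n Hn. apply (H (S n)). lia.
Qed.

Lemma psum_plus K r a b : psum K r (fun n => a n + b n) = psum K r a + psum K r b.
Proof.
  revert a b; induction K as [|K IH]; intros a b; simpl; [ring|].
  change (tail (fun n => a n + b n)) with (fun n => tail a n + tail b n).
  rewrite IH; ring.
Qed.

Lemma psum_scal K r c a : psum K r (fun n => c * a n) = c * psum K r a.
Proof.
  revert a; induction K as [|K IH]; intros a; simpl; [ring|].
  change (tail (fun n => c * a n)) with (fun n => c * tail a n).
  rewrite IH; ring.
Qed.

Lemma psum_zero K r a : (forall n, (n <= K)%nat -> a n = 0) -> psum K r a = 0.
Proof.
  revert a; induction K as [|K IH]; intros a H; simpl; rewrite H by lia; [ring|].
  rewrite IH; [ring|]. intros n Hn. apply (H (S n)). lia.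
Qed.

Lemma psum_pos K r a : 0 <= r -> (forall n, 0 <= a n) -> 0 <= psum K r a.
Proof.
  intros Hr Ha. rewrite <- (psum_zero K r (fun _ => 0)) by reflexivity.
  apply psum_le; auto.
Qed.

Lemma psum_mono_K K L r a : 0 <= r -> (forall n, 0 <= a n) -> (K <= L)%nat ->
  psum K r a <= psum L r a.
Proof.
  intros Hr Ha H. induction H as [|L H IH]; [lra|].
  rewrite psum_S. pose proof (Rmult_le_pos _ _ (Ha (S L)) (pow_le r (S L) Hr)). lra.
Qed.

Lemma psum_mul K r a b : 0 <= r -> (forall n, 0 <= a n) -> (forall n, 0 <= b n) ->
  psum K r (cprod (A := Rrng) a b) <= psum K r a * psum K r b.
Proof.
  intros Hr Ha Hb. revert a Ha; induction K as [|K IH]; intros a Ha;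
    [apply Rle_refl|].
  assert (E : psum (S K) r (cprod (A := Rrng) a b) =
    a O * psum (S K) r b + r * psum K r (cprod (A := Rrng) (tail a) b)).
  { change (a O * b O + r * psum K r (fun n => a O * tail b n + cprod (A := Rrng) (tail a) b n)
      = a O * (b O + r * psum K r (tail b)) + r * psum K r (cprod (A := Rrng) (tail a) b)).
    rewrite psum_plus, psum_scal. ring. }
  rewrite E. change (psum (S K) r a) with (a O + r * psum K r (tail a)).
  rewrite Rmult_plus_distr_r. apply Rplus_le_compat_l.
  rewrite Rmult_assoc. apply Rmult_le_compat_l; [exact Hr|].
  eapply Rle_trans; [apply IH; intro; apply Ha|].
  apply Rmult_le_compat_l.
  - apply psum_pos; [exact Hr | intro; apply Ha].
  - apply psum_mono_K; [exact Hr | exact Hb | lia].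
Qed.

(** A series that starts in degree [k] gains a factor [(r / r') ^ k] when the
    radius decreases from [r'] to [r]. *)
Lemma psum_vanish k K r r' a : 0 <= r <= r' -> 0 < r' -> (forall n, 0 <= a n) ->
  (forall n, (n < k)%nat -> a n = 0) ->
  psum K r a <= (r / r') ^ k * psum K r' a.
Proof.
  intros Hr Hr' Ha. revert k a Ha.
  assert (Hq : 0 <= r / r') by (apply Rdiv_le_0_compat; lra).
  induction K as [|K IH]; intros k a Ha H.
  - destruct k as [|k]; [simpl; lra|].
    simpl psum. rewrite (H O) by lia. lra.
  - destruct k as [|k].
    + rewrite pow_O, Rmult_1_l. simpl. apply Rplus_le_compat_l.
      specialize (IH O (tail a) (fun n => Ha (S n)) ltac:(intros; lia)).
      rewrite pow_O, Rmult_1_l in IH.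
      apply Rmult_le_compat; try lra.
      apply psum_pos; [lra | intro; apply Ha].
    + simpl psum. rewrite (H O) by lia.
      specialize (IH k (tail a) (fun n => Ha (S n))
        (fun n L => H (S n) ltac:(lia))).
      rewrite !Rplus_0_l.
      replace ((r / r') ^ S k * (r' * psum K r' (tail a))) with
        (r * ((r / r') ^ k * psum K r' (tail a))) by (simpl; field; lra).
      apply Rmult_le_compat_l; [lra | exact IH].
Qed.

Lemma psum_mono_r K r r' a : 0 <= r <= r' -> (forall n, 0 <= a n) ->
  psum K r a <= psum K r' a.
Proof.
  intros Hr Ha. revert a Ha; induction K as [|K IH]; intros a Ha; simpl; [lra|].
  apply Rplus_le_compat_l. apply Rmult_le_compat; try lra.
  - apply psum_pos; [lra | intro; apply Ha].
  - apply IH. intro; apply Ha.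
Qed.

Lemma psum_continuity K a : continuity (fun r => psum K r a).
Proof.
  revert a; induction K as [|K IH]; intro a; simpl.
  - apply continuity_const. intros x y. reflexivity.
  - apply continuity_plus; [apply continuity_const; intros x y; reflexivity|].
    apply continuity_mult; [apply derivable_continuous, derivable_id | apply IH].
Qed.

(** Partial sums depend continuously on the radius [r] and are small for [r = 0];
    if they can never equal [rho] for [r <= r'], they stay below it. *)
Lemma psum_bootstrap K a rho r' : 0 <= r' -> a O < rho ->
  (forall r, 0 <= r <= r' -> psum K r a <= rho -> psum K r a < rho) ->
  psum K r' a <= rho.
Proof.
  intros Hr' H0 H. apply Rnot_lt_le. intro HN.
  assert (P0 : psum K 0 a = a O) by (destruct K; simpl; ring).
  assert (Hpos : 0 < r').
  { destruct Hr' as [L|E]; [exact L|]. subst r'. lra. }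
  destruct (IVT (fun r => psum K r a - rho) 0 r') as [r [Hr E]].
  - apply continuity_minus; [apply psum_continuity|].
    apply continuity_const. intros x y. reflexivity.
  - exact Hpos.
  - cbv beta. rewrite P0. lra.
  - lra.
  - cbv beta in E. specialize (H r Hr). lra.
Qed.

(** ** The majorant of a series *)

(** Grouping by total degree suits vector fields with linear part [x d/dx + y d/dy],
    and reduces estimates to power series in one variable. *)
Definition maj (f : S2) (n : nat) : R := diag (A := Rrng) (fun i j => Cmod (f i j)) n.

Lemma diag_le n : forall f g : nat -> nat -> R,
  (forall i j, (i + j = n)%nat -> f i j <= g i j) ->
  diag (A := Rrng) f n <= diag (A := Rrng) g n.
Proof.
  induction n as [|n IH]; intros f g H.
  - change (f O O + 0 <= g O O + 0). specialize (H O O eq_refl). lra.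
  - change (f O (S n) + diag (A := Rrng) (tail f) n
      <= g O (S n) + diag (A := Rrng) (tail g) n).
    apply Rplus_le_compat; [apply H; lia|].
    apply IH. intros i j E. apply (H (S i)). lia.
Qed.

Lemma diag_zero n (f : nat -> nat -> R) : (forall i j, (i + j = n)%nat -> f i j = 0) ->
  diag (A := Rrng) f n = 0.
Proof.
  revert f; induction n as [|n IH]; intros f H.
  - change (f O O + 0 = 0). rewrite H by lia. ring.
  - change (f O (S n) + diag (A := Rrng) (tail f) n = 0). rewrite H by lia.
    rewrite IH; [ring|]. intros i j E. apply (H (S i)). lia.
Qed.

Lemma diag_rscal n c (f : nat -> nat -> R) :
  diag (A := Rrng) (fun i j => c * f i j) n = c * diag (A := Rrng) f n.
Proof.
  revert f; induction n as [|n IH]; intro f.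
  - change (c * f O O + 0 = c * (f O O + 0)). ring.
  - change (c * f O (S n) + diag (A := Rrng) (fun i j => c * tail f i j) n
      = c * (f O (S n) + diag (A := Rrng) (tail f) n)).
    rewrite IH. ring.
Qed.

Lemma maj_pos f n : 0 <= maj f n.
Proof.
  rewrite <- (diag_zero n (fun _ _ => 0)) by reflexivity.
  apply diag_le. intros. apply Cmod_ge_0.
Qed.
#[export] Hint Resolve maj_pos : core.

Lemma maj_le_scal c f g n : 0 <= c ->
  (forall i j, (i + j = n)%nat -> Cmod (g i j) <= c * Cmod (f i j)) ->
  maj g n <= c * maj f n.
Proof. intros Hc H. unfold maj. rewrite <- diag_rscal. apply diag_le, H. Qed.

Lemma maj_add f g n : maj (f + g)%S n <= maj f n + maj g n.
Proof.
  unfold maj. change (diag (A := Rrng) (fun i j => Cmod (f i j)) n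
    + diag (A := Rrng) (fun i j => Cmod (g i j)) n) with
    (radd (diag (A := Rrng) (fun i j => Cmod (f i j)) n)
    (diag (A := Rrng) (fun i j => Cmod (g i j)) n)).
  rewrite <- diag_add. apply diag_le. intros. apply Cmod_triangle.
Qed.

Lemma maj_opp f n : maj (- f)%S n = maj f n.
Proof.
  unfold maj. apply diag_ext. intros i j _. rewrite opp_coef. apply Cmod_opp.
Qed.

Lemma maj_sub f g n : maj (f - g)%S n <= maj f n + maj g n.
Proof.
  replace (f - g)%S with (f + - g)%S by ring. rewrite <- (maj_opp g). apply maj_add.
Qed.

Lemma maj_flip f n : maj (flip f) n = maj f n.
Proof. apply (diag_transpose (A := Rrng) n (fun i j => Cmod (f i j))). Qed.

Lemma maj_ord f k n : ord f k -> (n < k)%nat -> maj f n = 0.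
Proof.
  intros Hf L. apply diag_zero. intros i j E. rewrite Hf by lia. apply Cmod_0.
Qed.

Lemma maj_0 f : maj f O = Cmod (f O O).
Proof. unfold maj. change (Cmod (f O O) + 0 = Cmod (f O O)). ring. Qed.

Lemma Cmod_cprod (f g : nat -> C) n :
  Cmod (cprod (A := Crng) f g n)
  <= cprod (A := Rrng) (fun k => Cmod (f k)) (fun k => Cmod (g k)) n.
Proof.
  revert f; induction n as [|n IH]; intro f.
  - change (Cmod (Cmult (f O) (g O)) <= Cmod (f O) * Cmod (g O)).
    rewrite Cmod_mult. apply Rle_refl.
  - change (Cmod (Cplus (Cmult (f O) (g (S n))) (cprod (A := Crng) (tail f) g n))
      <= Cmod (f O) * Cmod (g (S n))
         + cprod (A := Rrng) (tail (fun k => Cmod (f k))) (fun k => Cmod (g k)) n).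
    eapply Rle_trans; [apply Cmod_triangle|].
    rewrite Cmod_mult. apply Rplus_le_compat_l. apply IH.
Qed.

Lemma Cmod_mul_coef (f g : S2) i j : Cmod ((f * g)%S i j)
  <= rmul (r := sers (sers Rrng)) (fun a b => Cmod (f a b)) (fun a b => Cmod (g a b)) i j.
Proof.
  revert f; induction i as [|i IH]; intro f.
  - apply Cmod_cprod.
  - change (Cmod (Cplus (cprod (A := Crng) (f O) (g (S i)) j) (((tail f : S2) * g)%S i j))
      <= cprod (A := Rrng) (fun b => Cmod (f O b)) (fun b => Cmod (g (S i) b)) j
       + rmul (r := sers (sers Rrng)) (fun a b => Cmod (tail f a b))
          (fun a b => Cmod (g a b)) i j).
    eapply Rle_trans; [apply Cmod_triangle|].
    apply Rplus_le_compat; [apply Cmod_cprod | apply IH].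
Qed.

Lemma maj_mul f g n : maj (f * g)%S n <= cprod (A := Rrng) (maj f) (maj g) n.
Proof.
  eapply Rle_trans; [apply diag_le; intros i j _; apply Cmod_mul_coef|].
  right. apply (diag_mul (A := Rrng) n (fun i j => Cmod (f i j)) (fun i j => Cmod (g i j))).
Qed.

Lemma psum_maj_mul K r f g : 0 <= r ->
  psum K r (maj (f * g)%S) <= psum K r (maj f) * psum K r (maj g).
Proof.
  intro Hr. eapply Rle_trans; [apply psum_le; [exact Hr | intros; apply maj_mul]|].
  apply psum_mul; auto.
Qed.

Lemma psum_maj_add K r f g : 0 <= r ->
  psum K r (maj (f + g)%S) <= psum K r (maj f) + psum K r (maj g).
Proof.
  intro Hr. rewrite <- psum_plus. apply psum_le; [exact Hr | intros; apply maj_add].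
Qed.

Lemma psum_maj_sub K r f g : 0 <= r ->
  psum K r (maj (f - g)%S) <= psum K r (maj f) + psum K r (maj g).
Proof.
  intro Hr. rewrite <- psum_plus. apply psum_le; [exact Hr | intros; apply maj_sub].
Qed.

Lemma maj_cst c n : maj (cst c) n = match n with O => Cmod c | _ => 0 end.
Proof.
  destruct n as [|n]; [apply maj_0|].
  apply diag_zero. intros [|i] [|j] E; try lia; rewrite cst_coef; apply Cmod_0.
Qed.

Lemma psum_maj_cst K r c : psum K r (maj (cst c)) = Cmod c.
Proof.
  destruct K as [|K]; simpl; rewrite maj_cst; [reflexivity|].
  rewrite psum_zero; [ring|]. intros n _. unfold tail. apply maj_cst.
Qed.

Lemma maj_cst_mul c f n : maj (cst c * f)%S n = Cmod c * maj f n.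
Proof.
  unfold maj. rewrite <- diag_rscal. apply diag_ext. intros i j _.
  rewrite cst_mul_coef. apply Cmod_mult.
Qed.

Lemma Cmod_INR n : Cmod (RtoC (INR n)) = INR n.
Proof. rewrite Cmod_R. apply Rabs_pos_eq, pos_INR. Qed.

Lemma maj_tail f n : maj (tail f : S2) n <= maj f (S n).
Proof.
  change (maj (tail f : S2) n <= Cmod (f O (S n)) + maj (tail f : S2) n).
  pose proof (Cmod_ge_0 (f O (S n))). lra.
Qed.

Lemma maj_dx f n : maj (dx f) n <= INR (S n) * maj f (S n).
Proof.
  apply Rle_trans with (INR (S n) * maj (tail f : S2) n).
  - apply maj_le_scal; [apply pos_INR|]. intros i j E. rewrite dx_coef, Cmod_mult, Cmod_INR.
    apply Rmult_le_compat_r; [apply Cmod_ge_0|]. apply le_INR. lia.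
  - apply Rmult_le_compat_l; [apply pos_INR | apply maj_tail].
Qed.

Lemma maj_dy f n : maj (dy f) n <= INR (S n) * maj f (S n).
Proof.
  rewrite <- (maj_flip (dy f)), flip_dy, <- (maj_flip f). apply maj_dx.
Qed.

(** ** Convergent series *)

(** Absolute convergence on the polydisc [|x| <= r], [|y| <= r]. *)
Definition conv (f : S2) : Prop :=
  exists r M, 0 < r /\ forall K, psum K r (maj f) <= M.

(** The form in which convergence is used in estimates: the order of vanishing
    becomes a power of the radius. *)
Lemma conv_ord f k : conv f -> ord f k -> exists r M, 0 < r /\ 0 <= M /\
  forall r' K, 0 <= r' <= r -> psum K r' (maj f) <= M * r' ^ k.
Proof.
  intros [r [M [Hr HM]]] Hf.
  assert (0 <= M).
  { apply Rle_trans with (psum 0 r (maj f)); [apply psum_pos; auto; lra | apply HM]. }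
  exists r, (M / r ^ k). split; [exact Hr|].
  assert (Hk := pow_lt r k Hr).
  split; [apply Rdiv_le_0_compat; assumption|].
  intros r' K Hr'.
  eapply Rle_trans; [apply (psum_vanish k K r' r); auto; intros; eapply maj_ord; eauto|].
  replace (M / r ^ k * r' ^ k) with ((r' / r) ^ k * M).
  - apply Rmult_le_compat_l; [apply pow_le, Rdiv_le_0_compat; lra | apply HM].
  - unfold Rdiv. rewrite Rpow_mult_distr, pow_inv. ring.
Qed.

Lemma conv_bound f : conv f -> exists r M, 0 < r /\ 0 <= M /\
  forall r' K, 0 <= r' <= r -> psum K r' (maj f) <= M.
Proof.
  intro Hf. destruct (conv_ord f 0 Hf) as [r [M [Hr [HM H]]]].
  - intros i j L; lia.
  - exists r, M. repeat split; try assumption.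
    intros r' K Hr'. rewrite <- (Rmult_1_r M). apply (H r' K Hr').
Qed.

Lemma conv_dom f g : (forall n, maj f n <= maj g n) -> conv g -> conv f.
Proof.
  intros H [r [M [Hr HM]]]. exists r, M. split; [exact Hr|].
  intro K. eapply Rle_trans; [apply psum_le; [lra | intros; apply H] | apply HM].
Qed.

Lemma conv_cst c : conv (cst c).
Proof.
  exists 1, (Cmod c). split; [lra|]. intro K. rewrite psum_maj_cst. apply Rle_refl.
Qed.

Lemma conv_add f g : conv f -> conv g -> conv (f + g)%S.
Proof.
  intros Hf Hg. destruct (conv_bound f Hf) as [r1 [M1 [Hr1 [_ H1]]]].
  destruct (conv_bound g Hg) as [r2 [M2 [Hr2 [_ H2]]]].
  exists (Rmin r1 r2), (M1 + M2).
  assert (Hm := Rmin_glb_lt _ _ _ Hr1 Hr2). split; [exact Hm|]. intro K.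
  eapply Rle_trans; [apply psum_maj_add; lra|].
  pose proof (Rmin_l r1 r2). pose proof (Rmin_r r1 r2).
  apply Rplus_le_compat; [apply H1 | apply H2]; lra.
Qed.

Lemma conv_mul f g : conv f -> conv g -> conv (f * g)%S.
Proof.
  intros Hf Hg. destruct (conv_bound f Hf) as [r1 [M1 [Hr1 [P1 H1]]]].
  destruct (conv_bound g Hg) as [r2 [M2 [Hr2 [P2 H2]]]].
  exists (Rmin r1 r2), (M1 * M2).
  assert (Hm := Rmin_glb_lt _ _ _ Hr1 Hr2). split; [exact Hm|]. intro K.
  eapply Rle_trans; [apply psum_maj_mul; lra|].
  pose proof (Rmin_l r1 r2). pose proof (Rmin_r r1 r2).
  apply Rmult_le_compat; try (apply psum_pos; auto; lra); [apply H1 | apply H2]; lra.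
Qed.

Lemma conv_opp f : conv f -> conv (- f)%S.
Proof. apply conv_dom. intro n. rewrite maj_opp. apply Rle_refl. Qed.

Lemma conv_sub f g : conv f -> conv g -> conv (f - g)%S.
Proof.
  intros Hf Hg. replace (f - g)%S with (f + - g)%S by ring.
  apply conv_add; [exact Hf | apply conv_opp, Hg].
Qed.

Lemma conv_flip f : conv f -> conv (flip f).
Proof. apply conv_dom. intro n. rewrite maj_flip. apply Rle_refl. Qed.

Lemma conv_zero : conv 0%S.
Proof. rewrite <- cst_0. apply conv_cst. Qed.

Lemma conv_one : conv 1%S.
Proof. apply (conv_cst (RtoC 1)). Qed.

Lemma maj_varx n : maj varx n <= match n with 1%nat => 1 | _ => 0 end.
Proof.
  assert (H : forall i j, (i + j <> 1)%nat -> varx i j = RtoC 0).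
  { intros [|[|i]] j E; try reflexivity. destruct j; [lia | reflexivity]. }
  destruct n as [|[|n]].
  - right. apply diag_zero. intros i j E. rewrite H by lia. apply Cmod_0.
  - change (Cmod (varx O 1%nat) + (Cmod (varx 1%nat O) + 0) <= 1).
    change (Cmod (RtoC 0) + (Cmod (RtoC 1) + 0) <= 1).
    rewrite Cmod_0, Cmod_1. lra.
  - right. apply diag_zero. intros i j E. rewrite H by lia. apply Cmod_0.
Qed.

Lemma psum_maj_varx K r : 0 <= r -> psum K r (maj varx) <= r.
Proof.
  intro Hr. eapply Rle_trans; [apply psum_le; [exact Hr | intros; apply maj_varx]|].
  destruct K as [|[|K]]; simpl; unfold tail; [lra | lra |].
  rewrite psum_zero; [lra|]. reflexivity.
Qed.

Lemma flip_varx : flip varx = vary.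
Proof. apply S2_ext; intros [|i] [|[|j]]; reflexivity. Qed.

Lemma psum_maj_vary K r : 0 <= r -> psum K r (maj vary) <= r.
Proof.
  intro Hr. rewrite <- flip_varx.
  eapply Rle_trans; [apply psum_le; [exact Hr | intros; right; apply maj_flip]|].
  apply psum_maj_varx, Hr.
Qed.

Lemma conv_varx : conv varx.
Proof. exists 1, 1. split; [lra|]. intro K. apply psum_maj_varx; lra. Qed.

Lemma conv_vary : conv vary.
Proof. exists 1, 1. split; [lra|]. intro K. apply psum_maj_vary; lra. Qed.

Lemma INR_S_pow2 n : INR (S n) <= 2 ^ n.
Proof.
  induction n as [|n IH]; [simpl; lra|].
  rewrite S_INR. simpl pow. assert (1 <= 2 ^ n) by (apply pow_R1_Rle; lra). lra.
Qed.

Lemma psum_half K r a : psum K (r / 2) (fun n => 2 ^ n * a n) = psum K r a.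
Proof.
  revert a; induction K as [|K IH]; intro a; simpl; [ring|].
  change (tail (fun n => 2 ^ n * a n)) with (fun n => 2 * 2 ^ n * tail a n).
  replace (psum K (r / 2) (fun n => 2 * 2 ^ n * tail a n)) with
    (2 * psum K r (tail a)); [field|].
  rewrite <- IH, <- psum_scal. f_equal.
  apply functional_extensionality; intro n. ring.
Qed.

Lemma conv_dx f : conv f -> conv (dx f).
Proof.
  intros [r [M [Hr HM]]]. exists (r / 2), (M / r). split; [lra|]. intro K.
  apply Rle_trans with (psum K (r / 2) (fun n => 2 ^ n * tail (maj f) n)).
  - apply psum_le; [lra|]. intros n _. eapply Rle_trans; [apply maj_dx|].
    apply Rmult_le_compat_r; [apply maj_pos | apply INR_S_pow2].
  - rewrite psum_half. specialize (HM (S K)). simpl in HM.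
    apply Rmult_le_reg_l with r; [exact Hr|].
    replace (r * (M / r)) with M by (field; lra).
    pose proof (maj_pos f O). lra.
Qed.

Lemma conv_dy f : conv f -> conv (dy f).
Proof.
  intro H. apply conv_flip in H. apply conv_dx, conv_flip in H.
  rewrite flip_dx in H. exact H.
Qed.

Lemma conv_rpow f n : conv f -> conv (rpow f n).
Proof.
  intro H. induction n as [|n IH]; [apply conv_one | exact (conv_mul _ _ H IH)].
Qed.

Lemma conv_vder V1 V2 f : conv V1 -> conv V2 -> conv f -> conv (vder V1 V2 f).
Proof.
  intros. apply conv_add; apply conv_mul; try assumption;
    [apply conv_dx | apply conv_dy]; assumption.
Qed.

(** * Division of convergent series *)

Definition scale (x y : C) (f : S2) : S2 :=
  fun i j => (f i j * (x ^ i * y ^ j))%C.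

Lemma rpow_C (x : C) n : rpow (A := Crng) x n = (x ^ n)%C.
Proof. induction n as [|n IH]; [reflexivity|]. simpl. rewrite IH. reflexivity. Qed.

Lemma rpow_const (x : C) n :
  rpow (A := sers Crng) (const (A := Crng) x) n = const (A := Crng) (x ^ n)%C.
Proof.
  induction n as [|n IH]; [reflexivity|]. simpl rpow. rewrite IH.
  apply functional_extensionality; intro j.
  transitivity (Cmult x (const (A := Crng) (x ^ n)%C j));
    [apply (cprod_const (A := Crng))|].
  destruct j; simpl; cring.
Qed.

Lemma scale_mul x y f g : scale x y (f * g)%S = (scale x y f * scale x y g)%S.
Proof.
  set (sy := fun f : S2 => (fun i j => (f i j * rpow (A := Crng) y j)%C) : S2).
  assert (E : forall f, scale x y f = (fun i =>
    (sy f i * rpow (A := sers Crng) (const (A := Crng) x) i)%S)).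
  { intro f0. apply S2_ext; intros i j. rewrite rpow_const.
    transitivity (Cmult (x ^ i)%C (sy f0 i j)).
    - unfold scale, sy. rewrite (rpow_C y j). cring.
    - rewrite (Rmul_comm (rth (sers Crng))). symmetry. apply (cprod_const (A := Crng)). }
  rewrite !E.
  assert (H : sy (f * g)%S = (sy f * sy g)%S).
  { apply (coefwise_hom (A := sers Crng) (B := sers Crng)
      (fun h => (fun j => (h j * rpow (A := Crng) y j)%C))).
    - intros a b. apply functional_extensionality; intro j.
      change (((a j + b j) * rpow (A := Crng) y j)%C
        = (a j * rpow (A := Crng) y j + b j * rpow (A := Crng) y j)%C). cring.
    - intros a b. apply (scale_hom (A := Crng)). }
  rewrite H. apply (scale_hom (A := sers Crng)).
Qed.

Lemma psum_radius K r c a : psum K (r * c) a = psum K r (fun n => c ^ n * a n).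
Proof.
  revert a; induction K as [|K IH]; intro a; simpl; [ring|].
  change (tail (fun n => c ^ n * a n)) with (fun n => c * c ^ n * tail a n).
  replace (psum K r (fun n => c * c ^ n * tail a n)) with
    (c * psum K (r * c) (tail a)); [ring|].
  rewrite IH, <- psum_scal. f_equal. apply functional_extensionality; intro n. ring.
Qed.

Lemma Cmod_pow_R (e : R) n : 0 <= e -> Cmod (RtoC e ^ n)%C = e ^ n.
Proof.
  intro He. induction n as [|n IH]; [apply Cmod_1|].
  simpl. rewrite Cmod_mult, IH, Cmod_R, Rabs_pos_eq by exact He. reflexivity.
Qed.

Lemma scale_y_coef e f i j : 0 <= e ->
  Cmod (scale 1 (RtoC e) f i j) = e ^ j * Cmod (f i j).
Proof.
  intro He. unfold scale. rewrite !Cmod_mult, (Cmod_pow_R e) by exact He.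
  replace (Cmod (1 ^ i)%C) with 1; [ring|].
  symmetry. rewrite (Cmod_pow_R 1) by lra. apply pow1.
Qed.

Lemma conv_scale e f : 0 < e <= 1 -> conv f -> conv (scale 1 (RtoC e) f).
Proof.
  intro He. apply conv_dom. intro n. rewrite <- (Rmult_1_l (maj f n)).
  apply maj_le_scal; [lra|]. intros i j _. rewrite scale_y_coef by lra.
  apply Rmult_le_compat_r; [apply Cmod_ge_0|].
  rewrite <- (pow1 j). apply pow_incr. lra.
Qed.

Lemma conv_unscale e f : 0 < e <= 1 -> conv (scale 1 (RtoC e) f) -> conv f.
Proof.
  intros He [r [M [Hr HM]]]. exists (r * e), M.
  split; [apply Rmult_lt_0_compat; lra|]. intro K. rewrite psum_radius.
  eapply Rle_trans; [|apply (HM K)]. apply psum_le; [lra|]. intros n _.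
  unfold maj. rewrite <- diag_rscal. apply diag_le. intros i j E.
  rewrite scale_y_coef by lra. apply Rmult_le_compat_r; [apply Cmod_ge_0|].
  replace n with (j + i)%nat by lia. rewrite pow_add.
  rewrite <- (Rmult_1_r (e ^ j)) at 2. apply Rmult_le_compat_l; [apply pow_le; lra|].
  rewrite <- (pow1 i). apply pow_incr. lra.
Qed.

Lemma rpow_xy_coef i0 : forall j0 i j,
  ((rpow varx i0 : S2) * rpow vary j0)%S i j =
  if andb (Nat.eqb i i0) (Nat.eqb j j0) then RtoC 1 else RtoC 0.
Proof.
  induction i0 as [|i0 IH]; intros j0.
  - change (rpow varx 0 : S2) with (1%S : S2).
    induction j0 as [|j0 IHj]; intros i j.
    + change (rpow vary 0 : S2) with (1%S : S2). replace (1 * 1)%S with (1%S : S2) by ring.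
      rewrite one_cst, cst_coef. destruct i, j; reflexivity.
    + change (rpow vary (S j0)) with (vary * rpow vary j0)%S.
      replace (1 * (vary * rpow vary j0))%S with (vary * (1 * rpow vary j0))%S by ring.
      destruct j as [|j]; [rewrite vary_mul_0, Bool.andb_false_r; reflexivity|].
      rewrite vary_mul_S. apply IHj.
  - intros i j. change (rpow varx (S i0)) with (varx * rpow varx i0)%S.
    replace (varx * rpow varx i0 * rpow vary j0)%S with
      (varx * (rpow varx i0 * rpow vary j0))%S by ring.
    destruct i as [|i]; [rewrite varx_mul_0; reflexivity|].
    rewrite varx_mul_S. apply IH.
Qed.

Lemma maj_varx_mul f n : maj (varx * f)%S (S n) = maj f n.
Proof.
  change (Cmod ((varx * f)%S O (S n)) + maj (tail (varx * f)%S : S2) n = maj f n).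
  rewrite varx_mul_0, Cmod_0, Rplus_0_l. f_equal.
  apply S2_ext; intros i j. apply varx_mul_S.
Qed.

Lemma maj_vary_mul f n : maj (vary * f)%S (S n) = maj f n.
Proof.
  rewrite <- maj_flip, flip_mul, <- (maj_flip f), <- flip_varx.
  change (flip (flip varx)) with varx. apply maj_varx_mul.
Qed.

Lemma maj_rpow_xy_mul i0 j0 f n :
  maj (rpow varx i0 * rpow vary j0 * f)%S (n + (i0 + j0))%nat = maj f n.
Proof.
  induction i0 as [|i0 IH].
  - induction j0 as [|j0 IHj].
    + replace (rpow varx 0 * rpow vary 0 * f)%S with f;
        [f_equal; lia | change (f = 1 * 1 * f)%S; ring].
    + replace (rpow varx 0 * rpow vary (S j0) * f)%S with
        (vary * (rpow varx 0 * rpow vary j0 * f))%S;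
        [|change (rpow vary (S j0)) with (vary * rpow vary j0)%S; ring].
      replace (n + (0 + S j0))%nat with (S (n + (0 + j0))) by lia.
      rewrite maj_vary_mul. exact IHj.
  - replace (rpow varx (S i0) * rpow vary j0 * f)%S with
      (varx * (rpow varx i0 * rpow vary j0 * f))%S;
      [|change (rpow varx (S i0)) with (varx * rpow varx i0)%S; ring].
    replace (n + (S i0 + j0))%nat with (S (n + (i0 + j0))) by lia.
    rewrite maj_varx_mul. exact IH.
Qed.

(** The factor [a] starts in degree [k], so only the terms of [b] up to degree [K]
    matter in degree [k + K]. *)
Lemma psum_mul_shift k K r a b : 0 <= r ->
  (forall n, 0 <= a n) -> (forall n, 0 <= b n) -> (forall n, (n < k)%nat -> a n = 0) ->
  psum (k + K) r (cprod (A := Rrng) a b) <= psum (k + K) r a * psum K r b.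
Proof.
  intros Hr. revert a. induction k as [|k IH]; intros a Ha Hb H.
  - apply psum_mul; assumption.
  - change (a O * b O + r * psum (k + K) r
        (fun n => a O * b (S n) + cprod (A := Rrng) (tail a) b n)
      <= (a O + r * psum (k + K) r (tail a)) * psum K r b).
    rewrite (H O) by lia.
    specialize (IH (tail a) (fun n => Ha (S n)) Hb (fun n L => H (S n) ltac:(lia))).
    rewrite psum_plus, psum_scal, !Rmult_0_l, !Rplus_0_l, Rmult_assoc.
    apply Rmult_le_compat_l; assumption.
Qed.

Lemma psum_shift_le k K r a : 0 <= r -> (forall n, 0 <= a n) ->
  r ^ k * psum K r (fun n => a (n + k)%nat) <= psum (k + K) r a.
Proof.
  intro Hr. revert a. induction k as [|k IH]; intros a Ha.
  - simpl. rewrite Rmult_1_l. right. f_equal. apply functional_extensionality; intro n.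
    f_equal; lia.
  - specialize (IH (tail a) (fun n => Ha (S n))).
    change (r * r ^ k * psum K r (fun n => a (n + S k)%nat)
      <= a O + r * psum (k + K) r (tail a)).
    replace (fun n => a (n + S k)%nat) with (fun n => tail a (n + k)%nat).
    + pose proof (Ha O). pose proof (Rmult_le_compat_l r _ _ Hr IH). lra.
    + apply functional_extensionality; intro n. unfold tail. f_equal; lia.
Qed.

(** A non-zero convergent series is dominated by its leading monomial on thin
    polydiscs [|x| <= r], [|y| <= e r]: among the terms of lowest degree it has
    the smallest power of [y]. *)
Lemma leading_dominates h : conv h -> h <> 0%S ->
  exists e i0 j0 c rest, 0 < e <= 1 /\ c <> RtoC 0 /\
    scale 1 (RtoC e) h = (cst c * (rpow varx i0 * rpow vary j0) + rest)%S /\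
    ord rest (i0 + j0) /\
    exists r1, 0 < r1 /\ forall r K, 0 <= r <= r1 ->
      psum K r (maj rest) <= Cmod c / 2 * r ^ (i0 + j0).
Proof.
  intros Hc Hn. destruct (leading_monomial h Hn) as [i0 [j0 [H0 Hf]]].
  set (k0 := (i0 + j0)%nat).
  assert (Hm : 0 < Cmod (h i0 j0)) by (apply Cmod_gt_0; exact H0).
  set (m := Cmod (h i0 j0)) in *.
  set (e := Rmin 1 (m / (4 * (maj h k0 + 1)))).
  assert (Hd : 0 < 4 * (maj h k0 + 1)) by (pose proof (maj_pos h k0); lra).
  assert (He : 0 < e <= 1).
  { split; [|apply Rmin_l]. apply Rmin_glb_lt; [lra|]. apply Rdiv_lt_0_compat; lra. }
  assert (Hek : e * maj h k0 <= m / 4).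
  { apply Rle_trans with (m / (4 * (maj h k0 + 1)) * (maj h k0 + 1)).
    - apply Rmult_le_compat; [lra | apply maj_pos | apply Rmin_r | lra].
    - right. field. pose proof (maj_pos h k0); lra. }
  set (h' := scale 1 (RtoC e) h).
  set (c := h' i0 j0).
  assert (Cc : Cmod c = e ^ j0 * m) by (apply scale_y_coef; lra).
  assert (Hcpos : 0 < Cmod c).
  { rewrite Cc. apply Rmult_lt_0_compat; [apply pow_lt; lra | exact Hm]. }
  set (rest := (h' - cst c * (rpow varx i0 * rpow vary j0))%S).
  assert (rest_coef : forall i j, rest i j =
    if andb (Nat.eqb i i0) (Nat.eqb j j0) then RtoC 0 else h' i j).
  { intros i j. unfold rest. rewrite sub_coef, cst_mul_coef, rpow_xy_coef.
    destruct (Nat.eqb_spec i i0); [destruct (Nat.eqb_spec j j0)|]; simpl; subst;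
      unfold c; cring. }
  assert (rest_ord : ord rest k0).
  { intros i j L. rewrite rest_coef.
    destruct (andb (Nat.eqb i i0) (Nat.eqb j j0)); [reflexivity|].
    unfold h', scale. replace (h i j) with (RtoC 0); [cring|].
    symmetry. apply NNPP. intro HN. specialize (Hf i j HN). unfold mono_le in Hf.
    unfold k0 in L. lia. }
  assert (rest_k0 : maj rest k0 <= Cmod c / 4).
  { apply Rle_trans with (e ^ j0 * (e * maj h k0)).
    - rewrite <- Rmult_assoc. apply maj_le_scal.
      + apply Rmult_le_pos; [apply pow_le|]; lra.
      + intros i j E. rewrite rest_coef.
        assert (P : 0 <= e ^ j0 * e * Cmod (h i j)).
        { apply Rmult_le_pos; [|apply Cmod_ge_0].
          apply Rmult_le_pos; [apply pow_le|]; lra. }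
        destruct (Nat.eqb_spec i i0) as [Ei|Ei]; simpl;
          [destruct (Nat.eqb_spec j j0) as [Ej|Ej]; [rewrite Cmod_0; exact P | unfold k0 in E;
            lia]|].
        unfold h'. rewrite scale_y_coef by lra.
        destruct (Ceq_dec (h i j) 0) as [Z|Z].
        * rewrite Z, Cmod_0. lra.
        * specialize (Hf i j Z). unfold mono_le in Hf. unfold k0 in E.
          apply Rmult_le_compat_r; [apply Cmod_ge_0|].
          replace j with (S j0 + (j - S j0))%nat by lia.
          rewrite pow_add. change (e ^ S j0) with (e * e ^ j0).
          assert (e ^ (j - S j0) <= 1) by (rewrite <- (pow1 (j - S j0)); apply pow_incr; lra).
          assert (0 <= e * e ^ j0) by (apply Rmult_le_pos; [|apply pow_le]; lra).
          rewrite (Rmult_comm (e ^ j0) e). rewrite <- (Rmult_1_r (e * e ^ j0)) at 2.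
          apply Rmult_le_compat_l; assumption.
    - rewrite Cc. replace (e ^ j0 * m / 4) with (e ^ j0 * (m / 4)) by field.
      apply Rmult_le_compat_l; [apply pow_le; lra | exact Hek]. }
  assert (rest_conv : conv rest).
  { apply conv_sub; [apply conv_scale; assumption|].
    apply conv_mul; [apply conv_cst|].
    apply conv_mul; apply conv_rpow; [apply conv_varx | apply conv_vary]. }
  destruct (conv_bound rest rest_conv) as [r2 [M [Hr2 [HM HB]]]].
  exists e, i0, j0, c, rest. split; [exact He|].
  split; [apply Cmod_gt_0; exact Hcpos|].
  split; [unfold rest; fold h'; ring|]. split; [exact rest_ord|].
  fold k0.
  set (r1 := Rmin r2 (Cmod c / 4 * r2 ^ S k0 / (M + 1))).
  assert (Hr1 : 0 < r1).
  { apply Rmin_glb_lt; [exact Hr2|].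
    apply Rdiv_lt_0_compat; [|lra]. apply Rmult_lt_0_compat; [lra | apply pow_lt; lra]. }
  exists r1. split; [exact Hr1|]. intros r K Hr.
  (* the term of degree [k0] and the terms of higher degree *)
  set (a := fun n => if Nat.eqb n k0 then 0 else maj rest n).
  assert (Ha : forall n, 0 <= a n).
  { intro n. unfold a. destruct (Nat.eqb n k0); [lra | apply maj_pos]. }
  set (b := fun n => if Nat.eqb n k0 then maj rest n else 0).
  assert (E : psum K r (maj rest) = psum K r b + psum K r a).
  { rewrite <- psum_plus. f_equal. apply functional_extensionality; intro n.
    unfold a, b. destruct (Nat.eqb n k0); ring. }
  rewrite E.
  assert (r1r2 : r1 <= r2) by apply Rmin_l.
  assert (B1 : psum K r a <= Cmod c / 4 * r ^ k0).
  { eapply Rle_trans.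
    - apply (psum_vanish (S k0) K r r2); [lra | lra | exact Ha |].
      intros n L. unfold a. destruct (Nat.eqb_spec n k0); [reflexivity|].
      eapply maj_ord; [exact rest_ord | lia].
    - assert (psum K r2 a <= M).
      { eapply Rle_trans; [|apply (HB r2 K); lra]. apply psum_le; [lra|].
        intros n _. unfold a. destruct (Nat.eqb n k0); [apply maj_pos | lra]. }
      assert (Hk := pow_lt r2 k0 Hr2). assert (Hrk := pow_le r k0 (proj1 Hr)).
      apply Rle_trans with ((r / r2) ^ S k0 * M).
      + apply Rmult_le_compat_l; [apply pow_le, Rdiv_le_0_compat; lra | assumption].
      + unfold Rdiv at 1. rewrite Rpow_mult_distr, pow_inv.
        change (r ^ S k0) with (r * r ^ k0).
        assert (rM : r * M <= Cmod c / 4 * r2 ^ S k0).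
        { assert (r <= Cmod c / 4 * r2 ^ S k0 / (M + 1))
            by (eapply Rle_trans; [apply Hr | apply Rmin_r]).
          apply Rle_trans with (r * (M + 1)); [nra|].
          apply Rmult_le_compat_r with (r := M + 1) in H1; [|lra].
          replace (Cmod c / 4 * r2 ^ S k0 / (M + 1) * (M + 1)) with
            (Cmod c / 4 * r2 ^ S k0) in H1 by (field; lra). exact H1. }
        replace (r * r ^ k0 * / r2 ^ S k0 * M) with (r * M * (r ^ k0 * / r2 ^ S k0)) by ring.
        replace (Cmod c / 4 * r ^ k0) with
          (Cmod c / 4 * r2 ^ S k0 * (r ^ k0 * / r2 ^ S k0))
          by (field; apply pow_nonzero; lra).
        apply Rmult_le_compat_r; [|exact rM].
        apply Rmult_le_pos; [exact Hrk|]. left. apply Rinv_0_lt_compat, pow_lt, Hr2. }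
  assert (B2 : psum K r b <= Cmod c / 4 * r ^ k0).
  { assert (gen : forall k K (f : nat -> R), (forall n, 0 <= f n) ->
      psum K r (fun n => if Nat.eqb n k then f n else 0) <= f k * r ^ k).
    { clear - Hr. induction k as [|k IH]; intros K f Hf'.
      - destruct K as [|K]; simpl; [lra|].
        rewrite psum_zero; [lra|]. reflexivity.
      - destruct K as [|K]; simpl.
        + apply Rmult_le_pos; [apply Hf'|]. apply Rmult_le_pos; [lra|].
          apply pow_le; lra.
        + specialize (IH K (tail f) (fun n => Hf' (S n))).
          rewrite Rplus_0_l. replace (f (S k) * (r * r ^ k)) with (r * (tail f k * r ^ k))
            by (unfold tail; ring).
          apply Rmult_le_compat_l; [lra|]. exact IH. }
    eapply Rle_trans; [apply (gen k0 K (maj rest)); apply maj_pos|].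
    apply Rmult_le_compat_r; [apply pow_le; lra | exact rest_k0]. }
  lra.
Qed.

(** If [h] were its leading monomial, dividing would shift coefficients. On a thin
    polydisc the rest of [h] is at most half of the leading monomial, so the norm
    of [p], truncated in degree [K], is at most twice the quotient of the norms. *)
Theorem conv_quotient h p g : h <> 0%S -> conv h -> conv g -> (h * p)%S = g -> conv p.
Proof.
  intros Hn Hh Hg E.
  destruct (leading_dominates h Hh Hn) as
    [e [i0 [j0 [c [rest [He [Hc [Eh [Ho [r1 [Hr1 HB]]]]]]]]]]].
  apply (conv_unscale e); [exact He|].
  apply (f_equal (scale 1 (RtoC e))) in E. rewrite scale_mul, Eh in E.
  set (q := scale 1 (RtoC e) p) in *.
  destruct (conv_bound _ (conv_scale e g He Hg)) as [r2 [M [Hr2 [HM HMb]]]].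
  set (g' := scale 1 (RtoC e) g) in *.
  set (k0 := (i0 + j0)%nat) in *.
  set (r := Rmin r1 r2).
  assert (Hr : 0 < r) by (apply Rmin_glb_lt; assumption).
  assert (Hcp : 0 < Cmod c) by (apply Cmod_gt_0; exact Hc).
  assert (Hk := pow_lt r k0 Hr).
  exists r, (2 * M / (Cmod c * r ^ k0)). split; [exact Hr|]. intro K.
  set (s := psum K r (maj q)).
  assert (S1 : r ^ k0 * (Cmod c * s) <= M + Cmod c / 2 * r ^ k0 * s).
  { apply Rle_trans with (psum (k0 + K) r (maj (g' - rest * q)%S)).
    - eapply Rle_trans; [|apply psum_shift_le; [lra | apply maj_pos]].
      apply Rmult_le_compat_l; [lra|]. right. unfold s. rewrite <- psum_scal.
      f_equal. apply functional_extensionality; intro n.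
      replace (g' - rest * q)%S with
        (cst c * (rpow varx i0 * rpow vary j0 * q))%S by (rewrite <- E; ring).
      rewrite maj_cst_mul. unfold k0. rewrite maj_rpow_xy_mul. reflexivity.
    - eapply Rle_trans; [apply psum_maj_sub; lra|].
      apply Rplus_le_compat; [apply HMb; split; [lra | apply Rmin_r]|].
      eapply Rle_trans; [apply psum_le; [lra | intros; apply maj_mul]|].
      eapply Rle_trans; [apply psum_mul_shift; auto; try lra|].
      + intros n L. eapply maj_ord; eauto.
      + apply Rmult_le_compat_r; [apply psum_pos; [lra | auto]|].
        apply HB. split; [lra | apply Rmin_l]. }
  apply Rmult_le_reg_l with (Cmod c * r ^ k0); [apply Rmult_lt_0_compat; lra|].
  replace (Cmod c * r ^ k0 * (2 * M / (Cmod c * r ^ k0))) with (2 * M)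
    by (field; split; lra).
  lra.
Qed.

Lemma conv_inverse f g : conv f -> (f * g)%S = 1%S -> conv g.
Proof.
  intros Hf H. apply (conv_quotient f g 1%S); auto using conv_one.
  intro E. rewrite E in H. replace (0 * g)%S with (0%S : S2) in H by ring.
  apply (f_equal (fun h : S2 => h O O)) in H. apply C1_nz. symmetry. exact H.
Qed.

(** * Two convergence theorems *)

(** ** Singular equations of Briot-Bouquet type *)

Lemma euler_maj V n : maj (vder varx vary V) n = INR n * maj V n.
Proof.
  unfold maj. rewrite <- diag_rscal. apply diag_ext. intros i j E.
  unfold vder. rewrite add_coef, euler_x_coef, euler_y_coef.
  replace (INR i * V i j + INR j * V i j)%C with (RtoC (INR n) * V i j)%C.
  - rewrite Cmod_mult, Cmod_INR. reflexivity.
  - rewrite <- E, plus_INR, RtoC_plus. cring.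
Qed.

(** [r * psum L r (maj (dx V))] is bounded by the derivative along the Euler field,
    and [u], starting in degree 2, brings two factors [r]. *)
Lemma psum_maj_dx_le u V K r M : 0 < r -> 0 <= M -> ord u 1 ->
  psum K r (maj u) <= M * r ^ 2 ->
  psum K r (maj (u * dx V)%S) <= M * r * psum K r (maj (vder varx vary V)).
Proof.
  intros Hr HM Hu HB.
  destruct K as [|L].
  - assert (E : psum 0 r (maj (u * dx V)%S) = 0).
    { change (maj (u * dx V)%S O = 0). apply (maj_ord _ 1); [apply ord_mul_l, Hu | lia]. }
    rewrite E. apply Rmult_le_pos; [nra|]. apply psum_pos; auto; lra.
  - eapply Rle_trans; [apply psum_le; [lra | intros; apply maj_mul]|].
    eapply Rle_trans; [apply (psum_mul_shift 1 L); auto; try lra;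
      intros n Ln; eapply maj_ord; eauto|].
    assert (H1 : r * psum L r (maj (dx V)) <= psum (S L) r (maj (vder varx vary V))).
    { simpl psum. rewrite euler_maj. simpl INR. rewrite Rmult_0_l, Rplus_0_l.
      apply Rmult_le_compat_l; [lra|]. apply psum_le; [lra|].
      intros n _. unfold tail. rewrite euler_maj. apply maj_dx. }
    assert (P : 0 <= psum L r (maj (dx V))) by (apply psum_pos; auto; lra).
    apply Rle_trans with (M * r ^ 2 * psum L r (maj (dx V))).
    + apply Rmult_le_compat_r; assumption.
    + replace (M * r ^ 2 * psum L r (maj (dx V))) with
        (M * r * (r * psum L r (maj (dx V)))) by ring.
      apply Rmult_le_compat_l; [nra | exact H1].
Qed.

Lemma psum_maj_dy_le u V K r M : 0 < r -> 0 <= M -> ord u 1 ->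
  psum K r (maj u) <= M * r ^ 2 ->
  psum K r (maj (u * dy V)%S) <= M * r * psum K r (maj (vder varx vary V)).
Proof.
  intros Hr HM Hu HB.
  assert (F : forall f, maj (flip f) = maj f).
  { intro f. apply functional_extensionality; intro n. apply maj_flip. }
  rewrite <- (F (u * dy V)%S), flip_mul, flip_dy.
  replace (maj (vder varx vary V)) with (maj (vder varx vary (flip V))).
  - apply psum_maj_dx_le; try assumption; [apply flip_ord, Hu | rewrite F; exact HB].
  - rewrite <- (F (vder varx vary (flip V))). f_equal. unfold vder.
    apply S2_ext; intros i j. unfold flip at 1.
    rewrite !add_coef, !euler_x_coef, !euler_y_coef. unfold flip. cring.
Qed.

Lemma psum_trunc K : forall k r a, 0 <= r -> (forall n, 0 <= a n) ->
  psum K r (fun n => if Nat.ltb n k then a n else 0) <= psum k r a.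
Proof.
  induction K as [|K IH]; intros [|k] r a Hr Ha.
  - simpl. apply Ha.
  - simpl. assert (0 <= psum k r (tail a)) by (apply psum_pos; [exact Hr | intro; apply Ha]).
    nra.
  - rewrite psum_zero by reflexivity. simpl. apply Ha.
  - simpl. apply Rplus_le_compat_l, Rmult_le_compat_l; [exact Hr|].
    apply (IH k r (tail a) Hr (fun n => Ha (S n))).
Qed.

(** With [U = 1 + V] and the Euler field on the left, the equation bounds [n * maj V n],
    so that beyond some degree the terms that are linear in [V] can be absorbed;
    the finitely many terms below are harmless. The higher order part of the field
    [E1, E2] costs a derivative of [V] but brings a factor [r]. *)
Theorem briot_bouquet (E1 E2 A B U : S2) :
  conv E1 -> conv E2 -> ord (E1 - varx)%S 2 -> ord (E2 - vary)%S 2 ->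
  conv A -> conv B -> U O O = RtoC 1 ->
  vder E1 E2 U = (A * U + B * (U * U))%S -> conv U.
Proof.
  intros HE1 HE2 O1 O2 HA HB HU HEq.
  set (V := (U - 1)%S).
  assert (V0 : ord V 1).
  { apply ord_1. unfold V. rewrite sub_coef, HU. apply Cplus_opp_r. }
  set (al := (A + B)%S). set (be := (A + B + B)%S).
  set (u := (E1 - varx)%S) in *. set (v := (E2 - vary)%S) in *.
  assert (EV : vder varx vary V = (al + be * V + B * (V * V) - u * dx V - v * dy V)%S).
  { assert (H : vder E1 E2 V = (al + be * V + B * (V * V))%S).
    { transitivity (vder E1 E2 U - vder E1 E2 (cst (RtoC 1)))%S; [apply vder_sub|].
      rewrite HEq, vder_cst. unfold al, be, V. ring. }
    rewrite <- H. unfold vder, u, v. ring. }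
  assert (al0 : ord al 1).
  { apply ord_1. replace al with (vder varx vary V - (be * V + B * (V * V)) + u * dx V
    + v * dy V)%S
      by (rewrite EV; ring).
    assert (O : ord (vder varx vary V - (be * V + B * (V * V)) + u * dx V + v * dy V)%S 1);
      [|apply O; lia].
    apply ord_add; [apply ord_add; [apply ord_sub|]|].
    - apply ord_add; apply ord_mul_l; [apply ord_varx | apply ord_vary].
    - apply ord_add; apply ord_mul_r; [|apply ord_mul_l]; exact V0.
    - apply ord_mul_l. apply ord_weaken with 2%nat; [lia | exact O1].
    - apply ord_mul_l. apply ord_weaken with 2%nat; [lia | exact O2]. }
  assert (Hal : conv al) by (apply conv_add; assumption).
  assert (Hbe : conv be) by (apply conv_add; [apply conv_add|]; assumption).
  assert (Hu : conv u) by (apply conv_sub; [assumption | apply conv_varx]).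
  assert (Hv : conv v) by (apply conv_sub; [assumption | apply conv_vary]).
  destruct (conv_ord al 1 Hal al0) as [r1 [M1 [R1 [P1 B1]]]].
  destruct (conv_bound be Hbe) as [r2 [M2 [R2 [P2 B2]]]].
  destruct (conv_bound B HB) as [r3 [M3 [R3 [P3 B3]]]].
  destruct (conv_ord u 2 Hu O1) as [r4 [M4 [R4 [P4 B4]]]].
  destruct (conv_ord v 2 Hv O2) as [r5 [M5 [R5 [P5 B5]]]].
  set (M := M1 + M2 + M3 + M4 + M5 + 1).
  (* from degree [k0] on, [V] is small compared to its Euler derivative *)
  destruct (INR_unbounded (8 * M)) as [k0 Hk0].
  assert (k0pos : 0 < INR k0) by (unfold M in *; lra).
  set (Q := psum k0 1 (maj V)).
  assert (HQ : 0 <= Q) by (apply psum_pos; auto; lra).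
  set (e := vder varx vary V) in *.
  set (r0 := Rmin (Rmin (Rmin r1 r2) (Rmin r3 r4)) (Rmin r5
    (/ (8 * (M + Q + 2 * M * Q + 1))))).
  assert (Hden : 0 < 8 * (M + Q + 2 * M * Q + 1)) by (unfold M in *; nra).
  assert (Hr0 : 0 < r0).
  { repeat apply Rmin_glb_lt; try assumption. apply Rinv_0_lt_compat, Hden. }
  assert (L1 : r0 <= r1 /\ r0 <= r2 /\ r0 <= r3 /\ r0 <= r4 /\ r0 <= r5 /\
    r0 <= / (8 * (M + Q + 2 * M * Q + 1))).
  { pose proof (Rmin_l (Rmin (Rmin r1 r2) (Rmin r3 r4)) (Rmin r5 (/ (8 * (M + Q + 2 * M * Q
    + 1))))).
    pose proof (Rmin_r (Rmin (Rmin r1 r2) (Rmin r3 r4)) (Rmin r5 (/ (8 * (M + Q + 2 * M * Q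
      + 1))))).
    fold r0 in H, H0.
    pose proof (Rmin_l (Rmin r1 r2) (Rmin r3 r4)). pose proof (Rmin_r (Rmin r1 r2) (Rmin r3 r4)).
    pose proof (Rmin_l r1 r2). pose proof (Rmin_r r1 r2).
    pose proof (Rmin_l r3 r4). pose proof (Rmin_r r3 r4).
    pose proof (Rmin_l r5 (/ (8 * (M + Q + 2 * M * Q + 1)))).
    pose proof (Rmin_r r5 (/ (8 * (M + Q + 2 * M * Q + 1)))).
    repeat split; lra. }
  destruct L1 as [L1 [L2 [L3 [L4 [L5 L6]]]]].
  assert (main : forall K, psum K r0 (maj e) <= / 2).
  { intro K. apply psum_bootstrap; [lra | | ].
    { unfold e. rewrite euler_maj. simpl. lra. }
    intros r Hr Hs. destruct (Req_dec r 0) as [Z|Z].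
    { subst r. replace (psum K 0 (maj e)) with (maj e O) by (destruct K; simpl; ring).
      unfold e. rewrite euler_maj. simpl. lra. }
    assert (Hrp : 0 < r) by lra.
    set (s := psum K r (maj e)) in *. set (q := psum K r (maj V)).
    assert (s_pos : 0 <= s) by (apply psum_pos; auto; lra).
    assert (q_pos : 0 <= q) by (apply psum_pos; auto; lra).
    assert (r_small : r * (8 * (M + Q + 2 * M * Q + 1)) <= 1).
    { apply Rle_trans with (/ (8 * (M + Q + 2 * M * Q + 1)) * (8 * (M + Q + 2 * M * Q + 1))).
      - apply Rmult_le_compat_r; lra.
      - right. field. unfold M in *; nra. }
    assert (r_le_1 : r <= 1) by (unfold M in *; nra).
    assert (q_le : q <= r * Q + s / INR k0).
    { set (low := fun n => if Nat.ltb n k0 then maj V n else 0).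
      assert (low_pos : forall n, 0 <= low n).
      { intro n. unfold low. destruct (Nat.ltb n k0); [apply maj_pos | lra]. }
      apply Rle_trans with (psum K r low + psum K r (fun n => / INR k0 * maj e n)).
      - rewrite <- psum_plus. apply psum_le; [lra|]. intros n _.
        unfold low, e. rewrite euler_maj.
        assert (0 <= / INR k0 * (INR n * maj V n)).
        { apply Rmult_le_pos; [left; apply Rinv_0_lt_compat, k0pos|].
          apply Rmult_le_pos; [apply pos_INR | apply maj_pos]. }
        destruct (Nat.ltb_spec n k0) as [Ln|Ln]; [lra|].
        rewrite Rplus_0_l, <- Rmult_assoc. rewrite <- (Rmult_1_l (maj V n)) at 1.
        apply Rmult_le_compat_r; [apply maj_pos|].
        apply le_INR in Ln. apply Rmult_le_reg_l with (INR k0); [exact k0pos|].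
        rewrite <- Rmult_assoc, Rinv_r, Rmult_1_l; lra.
      - apply Rplus_le_compat; [|rewrite psum_scal; unfold s, Rdiv; lra].
        eapply Rle_trans; [apply (psum_vanish 1 K r 1); [lra | lra | exact low_pos |]|].
        + intros n Ln. unfold low. destruct (Nat.ltb n k0); [|reflexivity].
          eapply maj_ord; eauto.
        + unfold Rdiv. rewrite Rinv_1, Rmult_1_r, pow_1.
          apply Rmult_le_compat_l; [lra|].
          apply psum_trunc; [lra | apply maj_pos]. }
    assert (s_le : s <= M1 * r + M2 * q + M3 * (q * q) + M4 * r * s + M5 * r * s).
    { unfold s at 1. rewrite EV.
      eapply Rle_trans; [apply psum_maj_sub; lra|]. apply Rplus_le_compat.
      eapply Rle_trans; [apply psum_maj_sub; lra|]. apply Rplus_le_compat.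
      eapply Rle_trans; [apply psum_maj_add; lra|]. apply Rplus_le_compat.
      eapply Rle_trans; [apply psum_maj_add; lra|]. apply Rplus_le_compat.
      - rewrite <- (pow_1 r) at 2. apply B1; lra.
      - eapply Rle_trans; [apply psum_maj_mul; lra|].
        apply Rmult_le_compat_r; [exact q_pos | apply B2; lra].
      - eapply Rle_trans; [apply psum_maj_mul; lra|].
        apply Rmult_le_compat; try (apply psum_pos; auto; lra); [apply B3; lra|].
        apply psum_maj_mul; lra.
      - apply psum_maj_dx_le; auto; [apply ord_weaken with 2%nat; [lia | exact O1]|].
        apply B4; lra.
      - apply psum_maj_dy_le; auto; [apply ord_weaken with 2%nat; [lia | exact O2]|].
        apply B5; lra. }
    assert (sk : s / INR k0 * (8 * M) <= s).
    { unfold Rdiv. apply Rmult_le_reg_l with (INR k0); [exact k0pos|].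
      replace (INR k0 * (s * / INR k0 * (8 * M))) with (s * (8 * M)) by (field; lra).
      nra. }
    set (w := s / INR k0) in *.
    assert (w_pos : 0 <= w) by (apply Rdiv_le_0_compat; assumption).
    assert (MM : M1 <= M /\ M2 + M3 <= M /\ M4 + M5 <= M /\ 1 <= M) by (unfold M; lra).
    destruct MM as [MM1 [MM2 [MM3 MM4]]]. clearbody M w q s Q.
    clear - s_le sk q_le r_small s_pos q_pos Hs Hrp w_pos MM1 MM2 MM3 MM4
      P1 P2 P3 P4 P5 HQ.
    assert (rM : r * M <= / 8) by nra.
    assert (rQ : r * Q <= / 8) by nra.
    assert (rMQ : r * (M + 2 * M * Q) < / 8) by nra.
    assert (q1 : q <= 1) by nra.
    assert (qq : q * q <= q) by nra.
    assert (A1 : M1 * r <= M * r) by nra.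
    assert (A2 : M2 * q + M3 * (q * q) <= M * q) by nra.
    assert (A3 : M4 * r * s + M5 * r * s <= M * r * s).
    { replace (M4 * r * s + M5 * r * s) with ((M4 + M5) * (r * s)) by ring.
      replace (M * r * s) with (M * (r * s)) by ring.
      apply Rmult_le_compat_r; [nra | lra]. }
    assert (A4 : M * r * s <= s / 8) by nra.
    assert (A5 : M * q <= M * (r * Q) + M * w) by nra.
    nra. }
  replace U with (V + 1)%S by (unfold V; ring).
  apply conv_add; [|apply conv_one].
  exists r0, (/ 2). split; [exact Hr0|]. intro K.
  eapply Rle_trans; [|apply (main K)]. apply psum_le; [lra|].
  intros [|n] _.
  - rewrite (maj_ord V 1) by (exact V0 || lia). apply maj_pos.
  - unfold e. rewrite euler_maj. rewrite <- (Rmult_1_l (maj V (S n))) at 1.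
    apply Rmult_le_compat_r; [apply maj_pos|]. rewrite S_INR. pose proof (pos_INR n). lra.
Qed.

(** ** Separatrices *)

(** The invariant curve [x = phi(y)] of a saddle. With [Z xi = a xi],
    [xi = x - phi(y)] and [a = l1 + a'], the invariance reads
    [(l2 y dy - l1) phi + x a' = w1 - w2 dy phi + a' phi], where [w1], [w2] are
    the terms of higher degree of [Z]. Its right-hand side [R] determines [phi]
    and [a'], so the equation becomes a fixed point problem for [R]. *)
Theorem separatrix (l1 l2 : C) (z1 z2 : S2) (kappa : R) :
  conv z1 -> conv z2 ->
  ord (z1 - cst l1 * varx)%S 2 -> ord (z2 - cst l2 * vary)%S 2 ->
  0 < kappa ->
  (forall j, kappa * INR j <= Cmod (INR j * l2 - l1)) ->
  exists xi a : S2, conv xi /\ conv a /\ ord (xi - varx)%S 2 /\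
    a O O = l1 /\ vder z1 z2 xi = (a * xi)%S.
Proof.
  intros Hz1 Hz2 O1 O2 Hk Hgap.
  set (w1 := (z1 - cst l1 * varx)%S) in *. set (w2 := (z2 - cst l2 * vary)%S) in *.
  set (phi := fun g : S2 => (fun i j => match i with
    | O => (g O j * / (INR j * l2 - l1))%C | _ => RtoC 0 end) : S2).
  set (rest := fun g : S2 => (tail g : S2)).
  assert (phi_sub : forall g h, phi (g - h)%S = (phi g - phi h)%S).
  { intros g h. apply S2_ext; intros [|i] j; unfold phi; rewrite ?sub_coef; cring. }
  assert (phi_ord : forall g n, ord g n -> ord (phi g) n).
  { intros g n H [|i] j L; unfold phi; [|reflexivity]. rewrite H by exact L. cring. }
  assert (rest_sub : forall g h, rest (g - h)%S = (rest g - rest h)%S)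
    by reflexivity.
  assert (rest_ord : forall g n, ord g (S n) -> ord (rest g) n).
  { intros g n H i j L. apply H. lia. }
  destruct (contraction_fixpoint 2
    (fun g => w1 - w2 * dy (phi g) + rest g * phi g)%S) as [g [Og Eg]].
  { intros g Og. apply ord_add; [apply ord_sub; [exact O1 | apply ord_mul_l, O2]|].
    apply ord_mul_r, phi_ord, Og. }
  { intros f g n Of Og H.
    replace (w1 - w2 * dy (phi f) + rest f * phi f
             - (w1 - w2 * dy (phi g) + rest g * phi g))%S with
      (rest (f - g) * phi f + rest g * phi (f - g)
       - vder 0 w2 (phi (f - g)))%S.
    - apply ord_sub; [apply ord_add|].
      + destruct n as [|n].
        * apply ord_mul_r, phi_ord, ord_weaken with 2%nat; [lia | exact Of].
        * replace (S (S n)) with (n + 2)%nat by lia.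
          apply ord_mul; [apply rest_ord, H | apply phi_ord, Of].
      + apply (ord_mul _ _ 1 n); [apply rest_ord, Og | apply phi_ord, H].
      + apply ord_vder; [apply ord_zero | exact O2 | apply phi_ord, H].
    - rewrite phi_sub, rest_sub, vder_sub. unfold vder. ring. }
  set (a' := rest g). set (p := phi g) in *.
  (* the modulus of the divisor is at least [kappa * n] *)
  assert (p_maj : forall n, INR n * maj p n <= / kappa * maj g n).
  { intro n. unfold maj. rewrite <- !diag_rscal. apply diag_le.
    intros i j E. destruct i as [|i].
    - unfold p, phi. simpl in E. subst j.
      destruct n as [|n].
      + simpl INR. rewrite Rmult_0_l. apply Rmult_le_pos;
          [left; apply Rinv_0_lt_compat, Hk | apply Cmod_ge_0].
      + specialize (Hgap (S n)). set (d := (INR (S n) * l2 - l1)%C) in *.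
        assert (Hn : 0 < INR (S n)) by (apply lt_0_INR; lia).
        assert (Hd : 0 < Cmod d) by (apply Rlt_le_trans with (2 := Hgap); nra).
        assert (Hd0 : d <> RtoC 0) by (apply Cmod_gt_0, Hd).
        change (INR (S n) * Cmod (g O (S n) * / d)%C <= / kappa * Cmod (g O (S n))).
        rewrite Cmod_mult, Cmod_inv by exact Hd0.
        apply Rmult_le_reg_l with (kappa * Cmod d); [nra|].
        replace (kappa * Cmod d * (INR (S n) * (Cmod (g O (S n)) * / Cmod d))) with
          (kappa * INR (S n) * Cmod (g O (S n))) by (field; lra).
        replace (kappa * Cmod d * (/ kappa * Cmod (g O (S n)))) with
          (Cmod d * Cmod (g O (S n))) by (field; lra).
        apply Rmult_le_compat_r; [apply Cmod_ge_0 | exact Hgap].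
    - unfold p, phi. rewrite Cmod_0, Rmult_0_r.
      apply Rmult_le_pos; [left; apply Rinv_0_lt_compat, Hk | apply Cmod_ge_0]. }
  assert (Op : ord p 2) by (apply phi_ord, Og).
  assert (p_maj' : forall n, maj p n <= / kappa * maj g n).
  { intro n. destruct n as [|n].
    - rewrite (maj_ord p 2) by (exact Op || lia).
      apply Rmult_le_pos; [left; apply Rinv_0_lt_compat, Hk | apply maj_pos].
    - eapply Rle_trans; [|apply p_maj]. rewrite <- (Rmult_1_l (maj p (S n))) at 1.
      apply Rmult_le_compat_r; [apply maj_pos|]. rewrite S_INR.
      pose proof (pos_INR n). lra. }
  assert (dp_maj : forall n, maj (dy p) n <= / kappa * tail (maj g) n).
  { intro n. eapply Rle_trans; [apply maj_dy | apply p_maj]. }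
  assert (Hw1 : conv w1).
  { apply conv_sub; [exact Hz1|]. apply conv_mul; [apply conv_cst | apply conv_varx]. }
  assert (Hw2 : conv w2).
  { apply conv_sub; [exact Hz2|]. apply conv_mul; [apply conv_cst | apply conv_vary]. }
  destruct (conv_ord w1 2 Hw1 O1) as [r1 [M1 [R1 [P1 B1]]]].
  destruct (conv_ord w2 2 Hw2 O2) as [r2 [M2 [R2 [P2 B2]]]].
  assert (Hik : 0 < / kappa) by (apply Rinv_0_lt_compat, Hk).
  set (r0 := Rmin (Rmin r1 r2) (Rmin (/ (4 * (M2 * / kappa + 1))) (kappa / (16 * (M1 + 1))))).
  assert (Hd1 : 0 < 4 * (M2 * / kappa + 1)) by nra.
  assert (Hd2 : 0 < 16 * (M1 + 1)) by lra.
  assert (Hr0 : 0 < r0).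
  { repeat apply Rmin_glb_lt; try assumption; [apply Rinv_0_lt_compat, Hd1|].
    apply Rdiv_lt_0_compat; assumption. }
  assert (L1 : r0 <= r1) by (eapply Rle_trans; [apply Rmin_l | apply Rmin_l]).
  assert (L2 : r0 <= r2) by (eapply Rle_trans; [apply Rmin_l | apply Rmin_r]).
  assert (L3 : r0 <= / (4 * (M2 * / kappa + 1)))
    by (eapply Rle_trans; [apply Rmin_r | apply Rmin_l]).
  assert (L4 : r0 <= kappa / (16 * (M1 + 1)))
    by (eapply Rle_trans; [apply Rmin_r | apply Rmin_r]).
  assert (tg_pos : forall n, 0 <= tail (maj g) n) by (intro; apply maj_pos).
  assert (main : forall K, psum K r0 (tail (maj g)) <= kappa / 4).
  { intro K. apply psum_bootstrap; [lra | |].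
    { unfold tail. rewrite (maj_ord g 2) by (exact Og || lia). lra. }
    intros r Hr Ht. destruct (Req_dec r 0) as [Z|Z].
    { subst r. replace (psum K 0 (tail (maj g))) with (tail (maj g) O)
        by (destruct K; simpl; ring).
      unfold tail. rewrite (maj_ord g 2) by (exact Og || lia). lra. }
    assert (Hrp : 0 < r) by lra.
    set (t := psum K r (tail (maj g))) in *.
    assert (t_pos : 0 <= t) by (apply psum_pos; auto; lra).
    assert (g_sum : psum (S K) r (maj g) = r * t).
    { simpl. rewrite (maj_ord g 2) by (exact Og || lia). apply Rplus_0_l. }
    assert (le1 : r * t <= M1 * r ^ 2 + M2 * r ^ 2 * (/ kappa * t)
                           + / kappa * (r * t) * t).
    { rewrite <- g_sum at 1. rewrite <- Eg.
      eapply Rle_trans; [apply psum_maj_add; lra|]. apply Rplus_le_compat;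
        [eapply Rle_trans; [apply psum_maj_sub; lra|]; apply Rplus_le_compat|].
      - apply B1; lra.
      - eapply Rle_trans; [apply psum_le; [lra | intros; apply maj_mul]|].
        eapply Rle_trans; [apply (psum_mul_shift 1 K); auto; try lra|].
        + intros n Ln. apply (maj_ord w2 2); [exact O2 | lia].
        + apply Rmult_le_compat; try (apply psum_pos; auto; lra); [apply B2; lra|].
          unfold t. rewrite <- psum_scal. apply psum_le; [lra|]. intros n _. apply dp_maj.
      - replace (rest g * p)%S with (p * rest g)%S by ring.
        eapply Rle_trans; [apply psum_le; [lra | intros; apply maj_mul]|].
        eapply Rle_trans; [apply (psum_mul_shift 1 K); auto; try lra|].
        + intros n Ln. apply (maj_ord p 2); [exact Op | lia].
        + apply Rmult_le_compat; try (apply psum_pos; auto; lra).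
          * change (1 + K)%nat with (S K). rewrite <- g_sum, <- psum_scal.
            apply psum_le; [lra|]. intros n _. apply p_maj'.
          * apply psum_le; [lra|]. intros n _. apply maj_tail. }
    assert (le2 : t <= M1 * r + M2 * / kappa * r * t + / kappa * t * t).
    { apply Rmult_le_reg_l with r; [exact Hrp|].
      eapply Rle_trans; [exact le1|]. right. ring. }
    assert (kt : / kappa * t <= / 4).
    { apply Rmult_le_reg_l with kappa; [exact Hk|].
      rewrite <- Rmult_assoc, Rinv_r, Rmult_1_l; lra. }
    assert (kt2 : / kappa * t * t <= / 4 * t) by (apply Rmult_le_compat_r; assumption).
    assert (rM2 : M2 * / kappa * r <= / 4).
    { apply Rle_trans with ((M2 * / kappa + 1) * / (4 * (M2 * / kappa + 1))).
      - apply Rmult_le_compat; nra.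
      - right. field. split; nra. }
    assert (rM2t : M2 * / kappa * r * t <= / 4 * t) by (apply Rmult_le_compat_r; assumption).
    assert (rM1 : M1 * r < kappa / 8).
    { apply Rle_lt_trans with (M1 * (kappa / (16 * (M1 + 1)))).
      - apply Rmult_le_compat_l; lra.
      - apply Rmult_lt_reg_r with (16 * (M1 + 1)); [lra|].
        replace (M1 * (kappa / (16 * (M1 + 1))) * (16 * (M1 + 1))) with (M1 * kappa)
          by (field; lra). nra. }
    lra. }
  assert (Hg : conv g).
  { exists r0, (r0 * (kappa / 4)). split; [exact Hr0|]. intros [|K].
    - simpl. rewrite (maj_ord g 2) by (exact Og || lia). nra.
    - simpl. rewrite (maj_ord g 2), Rplus_0_l by (exact Og || lia).
      apply Rmult_le_compat_l; [lra | apply main]. }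
  assert (Hp : conv p).
  { apply (conv_dom _ (cst (RtoC (/ kappa)) * g)%S).
    - intro n. rewrite maj_cst_mul, Cmod_R, Rabs_pos_eq by lra. apply p_maj'.
    - apply conv_mul; [apply conv_cst | exact Hg]. }
  assert (Ha' : conv a').
  { exists r0, (kappa / 4). split; [exact Hr0|]. intro K.
    eapply Rle_trans; [|apply main]. apply psum_le; [lra|]. intros n _. apply maj_tail. }
  assert (lin : (cst l2 * (vary * dy p) - cst l1 * p + varx * a')%S = g).
  { apply S2_ext; intros i j.
    rewrite add_coef, sub_coef, !cst_mul_coef, euler_y_coef.
    destruct i as [|i].
    - rewrite varx_mul_0. unfold p, phi.
      destruct (Nat.eq_dec j 0) as [E|E].
      + subst j. rewrite (Og O O) by lia. cring.
      + assert (Hd : (INR j * l2 - l1)%C <> RtoC 0).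
        { apply Cmod_gt_0. apply Rlt_le_trans with (2 := Hgap j).
          assert (0 < INR j) by (apply lt_0_INR; lia). nra. }
        set (gj := g O j). clearbody gj.
        change ((l2 * (INR j * (gj * / (INR j * l2 - l1))) - l1 * (gj * / (INR j * l2 - l1))
          + 0)%C = gj :> C). field. exact Hd.
    - rewrite varx_mul_S. unfold a', rest, tail. unfold p, phi. cring. }
  assert (dxp : dx p = 0%S).
  { apply S2_ext; intros i j. rewrite dx_coef. unfold p, phi. apply Cmult_0_r. }
  exists (varx - p)%S, (cst l1 + a')%S.
  split; [apply conv_sub; [apply conv_varx | exact Hp]|].
  split; [apply conv_add; [apply conv_cst | exact Ha']|].
  split; [replace (varx - p - varx)%S with (- p)%S by ring; apply ord_opp, Op|].
  split.
  - rewrite add_coef, cst_coef. unfold a', rest, tail. rewrite (Og 1%nat O) by lia. cring.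
  - rewrite vder_sub. unfold vder. rewrite dx_varx, dy_varx, dxp.
    assert (E1 : (w1 - w2 * dy p + a' * p)%S = g) by exact Eg.
    replace (z1 * 1 + z2 * 0 - (z1 * 0 + z2 * dy p))%S with
      (cst l1 * varx - cst l2 * (vary * dy p) + (w1 - w2 * dy p + a' * p) - a' * p)%S
      by (unfold w1, w2; ring).
    rewrite E1, <- lin. ring.
Qed.

(** * Evaluation of convergent series *)

(** ** Limits of complex sequences *)

Definition climit (u : nat -> C) (l : C) : Prop :=
  forall eps, 0 < eps -> exists N, forall n, (N <= n)%nat -> Cmod (u n - l)%C < eps.

Lemma climit_unique u l l' : climit u l -> climit u l' -> l = l'.
Proof.
  intros H H'. destruct (Ceq_dec l l') as [E|E]; [exact E|exfalso].
  assert (P : 0 < Cmod (l - l')%C / 2).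
  { assert (0 < Cmod (l - l')%C); [|lra]. apply Cmod_gt_0. intro Z. apply E.
    replace l with ((l - l') + l')%C by ring. rewrite Z. ring. }
  destruct (H _ P) as [N HN]. destruct (H' _ P) as [N' HN'].
  specialize (HN (max N N') ltac:(lia)). specialize (HN' (max N N') ltac:(lia)).
  set (v := u (max N N')) in *.
  assert (Cmod (l - l')%C <= Cmod (v - l)%C + Cmod (v - l')%C); [|lra].
  replace (l - l')%C with ((v - l') + - (v - l))%C by ring.
  eapply Rle_trans; [apply Cmod_triangle|]. rewrite Cmod_opp. lra.
Qed.

Lemma climit_add u v a b : climit u a -> climit v b ->
  climit (fun n => u n + v n)%C (a + b)%C.
Proof.
  intros Hu Hv eps He.
  destruct (Hu (eps / 2) ltac:(lra)) as [N HN]. destruct (Hv (eps / 2) ltac:(lra)) as [N' HN'].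
  exists (max N N'). intros n Hn.
  specialize (HN n ltac:(lia)). specialize (HN' n ltac:(lia)).
  replace (u n + v n - (a + b))%C with ((u n - a) + (v n - b))%C by ring.
  eapply Rle_lt_trans; [apply Cmod_triangle|]. lra.
Qed.

Lemma climit_bounded u l M : climit u l -> (forall n, Cmod (u n) <= M) -> Cmod l <= M.
Proof.
  intros H HM. apply Rnot_lt_le. intro L.
  destruct (H (Cmod l - M) ltac:(lra)) as [N HN]. specialize (HN N (Nat.le_refl N)).
  specialize (HM N).
  assert (Cmod l <= Cmod (u N) + Cmod (u N - l)%C); [|lra].
  replace l with (u N + - (u N - l))%C at 1 by ring.
  eapply Rle_trans; [apply Cmod_triangle|]. rewrite Cmod_opp. lra.
Qed.

Lemma climit_const c : climit (fun _ => c) c.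
Proof.
  intros eps He. exists O. intros n _.
  replace (c - c)%C with (RtoC 0) by ring. rewrite Cmod_0. exact He.
Qed.

Lemma climit_close u v l : climit u l -> climit (fun n => v n - u n)%C 0 -> climit v l.
Proof.
  intros Hu Hv. replace l with (l + 0)%C by ring.
  pose proof (climit_add _ _ _ _ Hu Hv) as H.
  intros eps He. destruct (H eps He) as [N HN]. exists N. intros n Hn.
  replace (v n) with (u n + (v n - u n))%C by ring. apply HN, Hn.
Qed.

Lemma climit_mul u v a b : climit u a -> climit v b ->
  climit (fun n => u n * v n)%C (a * b)%C.
Proof.
  intros Hu Hv eps He.
  set (B := Cmod a + Cmod b + 1).
  assert (HB : 1 <= B) by (unfold B; pose proof (Cmod_ge_0 a); pose proof (Cmod_ge_0 b); lra).
  set (e := Rmin 1 (eps / (3 * B))).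
  assert (H3 : 0 < eps / (3 * B)) by (apply Rdiv_lt_0_compat; lra).
  assert (He' : 0 < e) by (apply Rmin_glb_lt; lra).
  assert (eB : e * (3 * B) <= eps).
  { apply Rle_trans with (eps / (3 * B) * (3 * B)).
    - apply Rmult_le_compat_r; [lra | apply Rmin_r].
    - right. field. lra. }
  assert (e1 : e <= 1) by apply Rmin_l.
  destruct (Hu e He') as [N HN]. destruct (Hv e He') as [N' HN'].
  exists (max N N'). intros n Hn.
  specialize (HN n ltac:(lia)). specialize (HN' n ltac:(lia)).
  replace (u n * v n - a * b)%C with
    ((u n - a) * (v n - b) + (u n - a) * b + a * (v n - b))%C by ring.
  eapply Rle_lt_trans; [apply Cmod_triangle|].
  eapply Rle_lt_trans; [apply Rplus_le_compat_r, Cmod_triangle|].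
  rewrite !Cmod_mult.
  set (p := Cmod (u n - a)%C) in *. set (q := Cmod (v n - b)%C) in *.
  assert (0 <= p) by apply Cmod_ge_0. assert (0 <= q) by apply Cmod_ge_0.
  pose proof (Cmod_ge_0 a). pose proof (Cmod_ge_0 b). unfold B in *. nra.
Qed.

Fixpoint csum (K : nat) (a : nat -> C) : C :=
  match K with O => a O | S L => (a O + csum L (tail a))%C end.

Lemma csum_S K a : csum (S K) a = (csum K a + a (S K))%C.
Proof.
  revert a; induction K as [|K IH]; intro a; [reflexivity|].
  change (csum (S (S K)) a) with (a O + csum (S K) (tail a))%C.
  rewrite IH. change (csum (S K) a) with (a O + csum K (tail a))%C.
  unfold tail. ring.
Qed.

Lemma csum_sum_n K a : sum_n a K = csum K a.
Proof.
  induction K as [|K IH]; [apply sum_O|]. rewrite sum_Sn, csum_S, IH. reflexivity.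
Qed.

Lemma psum_sum_n K r a : sum_n (fun k => a k * r ^ k) K = psum K r a.
Proof.
  induction K as [|K IH]; [rewrite sum_O; simpl; ring|].
  rewrite sum_Sn, psum_S, IH. reflexivity.
Qed.

Lemma sum_n_psum K a : sum_n a K = psum K 1 a.
Proof.
  rewrite <- psum_sum_n. apply sum_n_ext. intro n. rewrite pow1.
  apply eq_sym, Rmult_1_r.
Qed.

Lemma csum_add K a b : csum K (fun n => a n + b n)%C = (csum K a + csum K b)%C.
Proof.
  revert a b; induction K as [|K IH]; intros a b; [reflexivity|]. simpl.
  change (tail (fun n => a n + b n)%C) with (fun n => tail a n + tail b n)%C.
  rewrite IH. ring.
Qed.

Lemma csum_scal K c a : csum K (fun n => c * a n)%C = (c * csum K a)%C.
Proof.
  revert a; induction K as [|K IH]; intros a; [reflexivity|]. simpl.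
  change (tail (fun n => c * a n)%C) with (fun n => c * tail a n)%C.
  rewrite IH. ring.
Qed.

Lemma csum_le K a b : (forall n, Cmod (a n) <= b n) -> Cmod (csum K a) <= psum K 1 b.
Proof.
  revert a b; induction K as [|K IH]; intros a b H; [apply H|]. simpl.
  eapply Rle_trans; [apply Cmod_triangle|].
  apply Rplus_le_compat; [apply H|]. rewrite Rmult_1_l. apply IH. intro n. apply H.
Qed.

Lemma is_series_climit (a : nat -> C) l :
  @is_series C_AbsRing C_NormedModule a l <-> climit (fun n => csum n a) l.
Proof.
  pose proof (filterlim_locally_ball_norm (K := C_AbsRing) (U := C_NormedModule)
    (F := eventually) (sum_n a) l) as [F1 F2].
  split.
  - intros H0 eps He. pose proof (F1 H0) as H. destruct (H (mkposreal eps He)) as [N HN].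
  exists N.
    intros n Hn. specialize (HN n Hn). rewrite csum_sum_n in HN. exact HN.
  - intro H. apply F2. intro eps. destruct (H eps (cond_pos eps)) as [N HN]. exists N.
    intros n Hn. specialize (HN n Hn).
    unfold ball_norm. rewrite csum_sum_n. exact HN.
Qed.

(** The total of a series, real and imaginary parts separately; it means something
    for convergent series only. *)
Definition ctotal (a : nat -> C) : C :=
  (Series (fun n => fst (a n)), Series (fun n => snd (a n))).

Lemma bounded_ex_series (b : nat -> R) M : (forall n, 0 <= b n) ->
  (forall K, psum K 1 b <= M) -> ex_series b.
Proof.
  intros Hb HM.
  pose proof (fun K => sum_n_psum K b) as E.
  destruct (ex_finite_lim_seq_incr (sum_n b) M) as [l Hl].
  - intro n. rewrite sum_Sn. unfold plus; simpl. specialize (Hb (S n)). lra.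
  - intro n. rewrite E. apply HM.
  - exists l. exact Hl.
Qed.

Lemma climit_ctotal (a : nat -> C) (b : nat -> R) M :
  (forall n, Cmod (a n) <= b n) -> (forall K, psum K 1 b <= M) ->
  climit (fun n => csum n a) (ctotal a).
Proof.
  intros Hab HM.
  assert (Hb : forall n, 0 <= b n) by (intro n; eapply Rle_trans; [apply Cmod_ge_0 | apply Hab]).
  pose proof (bounded_ex_series b M Hb HM) as Ex.
  assert (S1 : is_series (fun n => fst (a n)) (fst (ctotal a))).
  { apply Series_correct. apply (ex_series_le (V := R_CompleteNormedModule) _ b); [|exact Ex].
    intro n.
    eapply Rle_trans; [|apply Hab]. eapply Rle_trans; [|apply Rmax_Cmod].
    apply Rmax_l. }
  assert (S2 : is_series (fun n => snd (a n)) (snd (ctotal a))).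
  { apply Series_correct. apply (ex_series_le (V := R_CompleteNormedModule) _ b); [|exact Ex].
    intro n.
    eapply Rle_trans; [|apply Hab]. eapply Rle_trans; [|apply Rmax_Cmod].
    apply Rmax_r. }
  assert (E1 : forall n, sum_n (fun n => fst (a n)) n = fst (csum n a)).
  { induction n as [|n IH]; [apply sum_O|]. rewrite sum_Sn, csum_S, IH. reflexivity. }
  assert (E2 : forall n, sum_n (fun n => snd (a n)) n = snd (csum n a)).
  { induction n as [|n IH]; [apply sum_O|]. rewrite sum_Sn, csum_S, IH. reflexivity. }
  intros eps He.
  pose proof (proj1 (filterlim_locally (U := R_UniformSpace) _ _) S1) as L1.
  pose proof (proj1 (filterlim_locally (U := R_UniformSpace) _ _) S2) as L2.
  assert (He2 : 0 < eps / 2) by lra.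
  destruct (L1 (mkposreal _ He2)) as [N1 H1]. destruct (L2 (mkposreal _ He2)) as [N2 H2].
  exists (max N1 N2). intros n Hn.
  specialize (H1 n ltac:(lia)). specialize (H2 n ltac:(lia)).
  rewrite E1 in H1. rewrite E2 in H2.
  change (Rabs (fst (csum n a) - fst (ctotal a)) < eps / 2) in H1.
  change (Rabs (snd (csum n a) - snd (ctotal a)) < eps / 2) in H2.
  set (z := (csum n a - ctotal a)%C).
  assert (Z1 : Rabs (fst z) < eps / 2) by exact H1.
  assert (Z2 : Rabs (snd z) < eps / 2) by exact H2.
  replace z with (RtoC (fst z) + Ci * RtoC (snd z))%C.
  - eapply Rle_lt_trans; [apply Cmod_triangle|].
    rewrite Cmod_mult, Cmod_Ci, !Cmod_R. lra.
  - clearbody z. destruct z as [p q]. unfold Cplus, Cmult, Ci, RtoC; simpl.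
    f_equal; ring.
Qed.

(** Products of absolutely convergent series: the defect of the product of two
    partial sums is bounded by that of the absolute values. *)
Lemma csum_mul_defect K : forall (a b : nat -> C),
  Cmod (csum K a * csum K b - csum K (cprod (A := Crng) a b))%C
  <= psum K 1 (fun n => Cmod (a n)) * psum K 1 (fun n => Cmod (b n))
     - psum K 1 (cprod (A := Rrng) (fun n => Cmod (a n)) (fun n => Cmod (b n))).
Proof.
  induction K as [|K IH]; intros a b.
  - change (Cmod (a O * b O - a O * b O)%C
      <= Cmod (a O) * Cmod (b O) - Cmod (a O) * Cmod (b O)).
    replace (a O * b O - a O * b O)%C with (RtoC 0) by ring. rewrite Cmod_0. lra.
  - assert (EC : csum (S K) (cprod (A := Crng) a b)
      = (a O * csum (S K) b + csum K (cprod (A := Crng) (tail a) b))%C).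
    { change (a O * b O + csum K (fun n => a O * tail b n
        + cprod (A := Crng) (tail a) b n)
        = a O * (b O + csum K (tail b)) + csum K (cprod (A := Crng) (tail a) b))%C.
      rewrite csum_add, csum_scal. ring. }
    set (na := fun n => Cmod (a n)). set (nb := fun n => Cmod (b n)).
    assert (ER : psum (S K) 1 (cprod (A := Rrng) na nb)
      = na O * psum (S K) 1 nb + psum K 1 (cprod (A := Rrng) (tail na) nb)).
    { change (na O * nb O + 1 * psum K 1 (fun n => na O * tail nb n
        + cprod (A := Rrng) (tail na) nb n)
        = na O * (nb O + 1 * psum K 1 (tail nb)) + psum K 1 (cprod (A := Rrng) (tail na) nb)).
      rewrite psum_plus, psum_scal. ring. }
    rewrite EC, ER.
    specialize (IH (tail a) b).
    change (fun n => Cmod (tail a n)) with (tail na) in IH. fold nb in IH.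
    assert (X1 : (csum (S K) a * csum (S K) b
      - (a O * csum (S K) b + csum K (cprod (A := Crng) (tail a) b))
      = csum K (tail a) * b (S K)
        + (csum K (tail a) * csum K b - csum K (cprod (A := Crng) (tail a) b)))%C).
    { rewrite (csum_S K b). simpl csum. ring. }
    assert (X2 : psum (S K) 1 na * psum (S K) 1 nb
      - (na O * psum (S K) 1 nb + psum K 1 (cprod (A := Rrng) (tail na) nb))
      = psum K 1 (tail na) * nb (S K)
        + (psum K 1 (tail na) * psum K 1 nb - psum K 1 (cprod (A := Rrng) (tail na) nb))).
    { rewrite (psum_S K 1 nb), pow1. simpl psum. ring. }
    rewrite X1, X2. eapply Rle_trans; [apply Cmod_triangle|].
    apply Rplus_le_compat; [|exact IH].
    rewrite Cmod_mult. apply Rmult_le_compat_r; [apply Cmod_ge_0|].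
    apply csum_le. intro n. apply Rle_refl.
Qed.

Lemma psum_mul_ge K L a b : (forall n, 0 <= a n) -> (forall n, 0 <= b n) ->
  psum K 1 a * psum L 1 b <= psum (K + L) 1 (cprod (A := Rrng) a b).
Proof.
  intros Ha Hb. revert a Ha; induction K as [|K IH]; intros a Ha.
  - simpl plus. change (psum 0 1 a) with (a O). rewrite <- psum_scal.
    apply psum_le; [lra|]. intros n _. destruct n as [|n]; [apply Rle_refl|].
    change (a O * b (S n) <= a O * b (S n) + cprod (A := Rrng) (tail a) b n).
    assert (0 <= cprod (A := Rrng) (tail a) b n); [|lra].
    assert (gen : forall m f, (forall k, 0 <= f k) -> 0 <= cprod (A := Rrng) f b m).
    { clear - Hb. induction m as [|m IHm]; intros f Hf.
      - change (0 <= f O * b O). apply Rmult_le_pos; auto.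
      - change (0 <= f O * b (S m) + cprod (A := Rrng) (tail f) b m).
        apply Rplus_le_le_0_compat; [apply Rmult_le_pos; auto | apply IHm].
        intro; apply Hf. }
    apply gen. intro; apply Ha.
  - change (S K + L)%nat with (S (K + L)).
    assert (ER : psum (S (K + L)) 1 (cprod (A := Rrng) a b)
      = a O * psum (S (K + L)) 1 b + psum (K + L) 1 (cprod (A := Rrng) (tail a) b)).
    { change (a O * b O + 1 * psum (K + L) 1 (fun n => a O * tail b n
        + cprod (A := Rrng) (tail a) b n)
        = a O * (b O + 1 * psum (K + L) 1 (tail b))
          + psum (K + L) 1 (cprod (A := Rrng) (tail a) b)).
      rewrite psum_plus, psum_scal. ring. }
    rewrite ER. simpl psum at 1. rewrite Rmult_1_l, Rmult_plus_distr_r.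
    apply Rplus_le_compat; [|apply IH; intro; apply Ha].
    apply Rmult_le_compat_l; [apply Ha|]. apply psum_mono_K; [lra | exact Hb | lia].
Qed.

Lemma climit_mul_series a b A B (la lb : C) :
  (forall K, psum K 1 (fun n => Cmod (a n)) <= A) ->
  (forall K, psum K 1 (fun n => Cmod (b n)) <= B) ->
  climit (fun n => csum n a) la -> climit (fun n => csum n b) lb ->
  climit (fun n => csum n (cprod (A := Crng) a b)) (la * lb)%C.
Proof.
  intros HA HB Ha Hb.
  apply (climit_close (fun n => csum n a * csum n b)%C); [apply climit_mul; assumption|].
  set (na := fun n => Cmod (a n)) in *. set (nb := fun n => Cmod (b n)) in *.
  set (c := cprod (A := Rrng) na nb).
  assert (Hna : forall n, 0 <= na n) by (intro; apply Cmod_ge_0).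
  assert (Hnb : forall n, 0 <= nb n) by (intro; apply Cmod_ge_0).
  assert (Hc : forall n, 0 <= c n).
  { intro n. eapply Rle_trans; [apply Cmod_ge_0 | apply (Cmod_cprod a b n)]. }
  assert (Ex : ex_series c).
  { apply (bounded_ex_series c (A * B) Hc). intro K.
    eapply Rle_trans; [apply psum_mul; auto; lra|].
    apply Rmult_le_compat; auto; apply psum_pos; auto; lra. }
  destruct Ex as [l Hl0].
  pose proof (proj1 (filterlim_locally (U := R_UniformSpace) _ _) Hl0) as Hl.
  pose proof (fun K => sum_n_psum K c) as E.
  intros eps He. assert (He2 : 0 < eps / 2) by lra.
  destruct (Hl (mkposreal _ He2)) as [N HN]. exists N. intros n Hn.
  pose proof (HN n Hn) as H1. pose proof (HN (n + n)%nat ltac:(lia)) as H2.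
  rewrite E in H1, H2.
  change (Rabs (psum n 1 c - l) < eps / 2) in H1.
  change (Rabs (psum (n + n) 1 c - l) < eps / 2) in H2.
  apply Rabs_def2 in H1. apply Rabs_def2 in H2.
  set (d := csum n (cprod (A := Crng) a b)).
  replace (d - csum n a * csum n b - 0)%C with (- (csum n a * csum n b - d))%C by ring.
  rewrite Cmod_opp. eapply Rle_lt_trans; [apply csum_mul_defect|].
  fold na nb c. pose proof (psum_mul_ge n n na nb Hna Hnb). fold c in H. lra.
Qed.

(** ** The value of a series at a point *)

Definition hom (f : S2) (p : C * C) (k : nat) : C :=
  diag (A := Crng) (scale (fst p) (snd p) f) k.

Definition val (f : S2) (p : C * C) : C := ctotal (hom f p).

Definition polydisc (r : R) (p : C * C) : Prop := Cmod (fst p) <= r /\ Cmod (snd p) <= r.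

Definition bounded_on (f : S2) (r : R) : Prop :=
  exists M, forall K, psum K r (maj f) <= M.

Lemma Cmod_diag (g : S2) n :
  Cmod (diag (A := Crng) g n) <= diag (A := Rrng) (fun i j => Cmod (g i j)) n.
Proof.
  revert g; induction n as [|n IH]; intro g.
  - change (Cmod (g O O + 0)%C <= Cmod (g O O) + 0). rewrite Cplus_0_r. lra.
  - change (Cmod (g O (S n) + diag (A := Crng) (tail g) n)%C
      <= Cmod (g O (S n)) + diag (A := Rrng) (tail (fun i j => Cmod (g i j))) n).
    eapply Rle_trans; [apply Cmod_triangle|]. apply Rplus_le_compat_l, IH.
Qed.

Lemma Cmod_pow_le (x : C) r n : Cmod x <= r -> Cmod (x ^ n)%C <= r ^ n.
Proof.
  intro H. induction n as [|n IH]; simpl; [rewrite Cmod_1; lra|].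
  rewrite Cmod_mult. apply Rmult_le_compat; auto using Cmod_ge_0.
Qed.

Lemma hom_le f p r k : polydisc r p -> Cmod (hom f p k) <= maj f k * r ^ k.
Proof.
  intros [Hx Hy]. unfold hom. eapply Rle_trans; [apply Cmod_diag|].
  rewrite Rmult_comm. unfold maj. rewrite <- diag_rscal. apply diag_le.
  intros i j E. unfold scale. rewrite !Cmod_mult, Rmult_comm.
  apply Rmult_le_compat_r; [apply Cmod_ge_0|]. rewrite <- E, pow_add.
  apply Rmult_le_compat; auto using Cmod_ge_0, Cmod_pow_le.
Qed.

Lemma psum_1 K r a : psum K 1 (fun k => a k * r ^ k) = psum K r a.
Proof.
  rewrite <- !psum_sum_n. apply sum_n_ext. intro n. rewrite pow1. apply Rmult_1_r.
Qed.

Lemma val_limit f r p : bounded_on f r -> polydisc r p ->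
  climit (fun n => csum n (hom f p)) (val f p).
Proof.
  intros [M HM] Hp. apply (climit_ctotal _ (fun k => maj f k * r ^ k) M).
  - intro n. apply hom_le, Hp.
  - intro K. rewrite psum_1. apply HM.
Qed.

Lemma val_unique f r p l : bounded_on f r -> polydisc r p ->
  climit (fun n => csum n (hom f p)) l -> val f p = l.
Proof. intros Hf Hp H. exact (climit_unique _ _ _ (val_limit f r p Hf Hp) H). Qed.

Lemma val_le f r p M : polydisc r p -> (forall K, psum K r (maj f) <= M) -> Cmod (val f p) <= M.
Proof.
  intros Hp HM. apply (climit_bounded (fun n => csum n (hom f p))).
  - apply (val_limit f r); [exists M; exact HM | exact Hp].
  - intro n. eapply Rle_trans; [|apply (HM n)].
    rewrite <- psum_1. apply csum_le. intro k. apply hom_le, Hp.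
Qed.

Lemma polydisc_pos r p : polydisc r p -> 0 <= r.
Proof. intros [H _]. eapply Rle_trans; [apply Cmod_ge_0 | exact H]. Qed.

Lemma bounded_on_cst c r : bounded_on (cst c) r.
Proof. exists (Cmod c). intro K. rewrite psum_maj_cst. apply Rle_refl. Qed.

Lemma bounded_on_varx r : 0 <= r -> bounded_on varx r.
Proof. intro Hr. exists r. intro K. apply psum_maj_varx, Hr. Qed.

Lemma bounded_on_vary r : 0 <= r -> bounded_on vary r.
Proof. intro Hr. exists r. intro K. apply psum_maj_vary, Hr. Qed.

Lemma in_polydisc p : exists r, polydisc r p.
Proof.
  exists (Rmax (Cmod (fst p)) (Cmod (snd p))). split; [apply Rmax_l | apply Rmax_r].
Qed.

Lemma bounded_on_add f g r : 0 <= r -> bounded_on f r -> bounded_on g r ->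
  bounded_on (f + g)%S r.
Proof.
  intros Hr [M HM] [N HN]. exists (M + N). intro K.
  eapply Rle_trans; [apply psum_maj_add, Hr|]. apply Rplus_le_compat; auto.
Qed.

Lemma bounded_on_mul f g r : 0 <= r -> bounded_on f r -> bounded_on g r ->
  bounded_on (f * g)%S r.
Proof.
  intros Hr [M HM] [N HN]. exists (M * N). intro K.
  eapply Rle_trans; [apply psum_maj_mul, Hr|].
  apply Rmult_le_compat; auto; apply psum_pos; auto.
Qed.

Lemma hom_add f g p k : hom (f + g)%S p k = (hom f p k + hom g p k)%C.
Proof.
  unfold hom. rewrite <- (diag_add (A := Crng)). apply diag_ext. intros i j _.
  unfold scale. rewrite add_coef. cring.
Qed.

Lemma hom_mul f g p : hom (f * g)%S p = cprod (A := Crng) (hom f p) (hom g p).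
Proof.
  apply functional_extensionality; intro k. unfold hom. rewrite scale_mul.
  apply (diag_mul (A := Crng)).
Qed.

Lemma csum_ext K a b : (forall n, a n = b n) -> csum K a = csum K b.
Proof.
  intro H. f_equal. apply functional_extensionality, H.
Qed.

Lemma val_add_on f g r p : bounded_on f r -> bounded_on g r -> polydisc r p ->
  val (f + g)%S p = (val f p + val g p)%C.
Proof.
  intros Hf Hg Hp. apply (val_unique _ r);
    [apply bounded_on_add; auto; eapply polydisc_pos; eauto | exact Hp |].
  pose proof (climit_add _ _ _ _ (val_limit f r p Hf Hp) (val_limit g r p Hg Hp)) as H.
  intros eps He. destruct (H eps He) as [N HN]. exists N. intros n Hn.
  rewrite (csum_ext n _ _ (hom_add f g p)), csum_add. apply HN, Hn.
Qed.

Lemma val_mul_on f g r p : bounded_on f r -> bounded_on g r -> polydisc r p ->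
  val (f * g)%S p = (val f p * val g p)%C.
Proof.
  intros Hf Hg Hp. apply (val_unique _ r);
    [apply bounded_on_mul; auto; eapply polydisc_pos; eauto | exact Hp |].
  rewrite hom_mul.
  assert (B : forall h, bounded_on h r -> exists M,
    forall K, psum K 1 (fun n => Cmod (hom h p n)) <= M).
  { intros h [M HM]. exists M. intro K. eapply Rle_trans; [|apply (HM K)].
    rewrite <- (psum_1 K r). apply psum_le; [lra|]. intros n _. apply hom_le, Hp. }
  destruct (B f Hf) as [A HA]. destruct (B g Hg) as [A' HA'].
  apply (climit_mul_series _ _ A A'); auto; apply (val_limit _ r); assumption.
Qed.

Lemma hom_cst c p k : hom (cst c) p k = match k with O => c | _ => RtoC 0 end.
Proof.
  unfold hom. destruct k as [|k].
  - change (scale (fst p) (snd p) (cst c) O O + 0 = c)%C. unfold scale.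
    rewrite cst_coef. simpl. cring.
  - assert (gen : forall n (g : S2), (forall i j, (i + j = n)%nat -> g i j = RtoC 0) ->
      diag (A := Crng) g n = RtoC 0).
    { clear. induction n as [|n IH]; intros g H.
      - change (g O O + 0 = 0)%C. rewrite H by lia. cring.
      - change (g O (S n) + diag (A := Crng) (tail g) n = 0)%C.
        rewrite H, IH by (lia || (intros i j E; apply (H (S i)); lia)). cring. }
    apply gen. intros i j E. unfold scale. rewrite cst_coef.
    destruct i, j; try lia; cring.
Qed.

Lemma csum_first K c : csum K (fun k => match k with O => c | _ => RtoC 0 end) = c.
Proof.
  destruct K as [|K]; [reflexivity|]. simpl.
  replace (csum K (tail (fun k => match k with O => c | _ => RtoC 0 end))) with (RtoC 0);
    [ring|].
  clear. induction K as [|K IH]; [reflexivity|]. rewrite csum_S, <- IH. unfold tail. ring.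
Qed.

Lemma val_cst c p : val (cst c) p = c.
Proof.
  destruct (in_polydisc p) as [r Hr]. apply (val_unique _ r); [|exact Hr|].
  - apply bounded_on_cst.
  - intros eps He. exists O. intros n _.
    rewrite (csum_ext n _ _ (hom_cst c p)), csum_first.
    replace (c - c)%C with (RtoC 0) by ring. rewrite Cmod_0. exact He.
Qed.

Lemma val_rpow_on f r p n : bounded_on f r -> polydisc r p ->
  bounded_on (rpow f n) r /\ val (rpow f n) p = (val f p ^ n)%C.
Proof.
  intros Hf Hp. induction n as [|n [IH1 IH2]].
  - change (rpow f 0) with (cst (RtoC 1)).
    split; [apply bounded_on_cst | apply val_cst].
  - change (rpow f (S n)) with (f * rpow f n)%S.
    split; [apply bounded_on_mul; auto; eapply polydisc_pos; eauto|].
    rewrite (val_mul_on f (rpow f n) r p Hf IH1 Hp), IH2. reflexivity.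
Qed.

Lemma hom_varx p k : hom varx p k = match k with 1%nat => fst p | _ => RtoC 0 end.
Proof.
  assert (H : (k <> 1)%nat -> hom varx p k = RtoC 0).
  { intro Hk. apply Cmod_eq_0, Rle_antisym; [|apply Cmod_ge_0].
    eapply Rle_trans; [apply (hom_le varx p (Rmax (Cmod (fst p)) (Cmod (snd p))))|].
    - split; [apply Rmax_l | apply Rmax_r].
    - pose proof (maj_varx k) as B. destruct k as [|[|k]]; try lia;
      (replace (maj varx _) with 0 by (apply Rle_antisym; [apply maj_pos | exact B]); lra). }
  destruct k as [|[|k]]; try (apply H; lia).
  unfold hom. change (scale (fst p) (snd p) varx O 1%nat
    + (scale (fst p) (snd p) varx 1%nat O + 0) = fst p)%C.
  unfold scale. change (0 * (fst p ^ 0 * snd p ^ 1)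
    + (1 * (fst p ^ 1 * snd p ^ 0) + 0) = fst p)%C. simpl. ring.
Qed.

Lemma val_varx p : val varx p = fst p.
Proof.
  destruct p as [x y].
  destruct (in_polydisc (x, y)) as [r Hr]. apply (val_unique _ r); [|exact Hr|].
  - apply bounded_on_varx. eapply polydisc_pos; eauto.
  - intros eps He. exists 1%nat. intros n Hn. destruct n as [|n]; [lia|].
    change (csum (S n) (hom varx (x, y))) with (hom varx (x, y) O
      + csum n (tail (hom varx (x, y))))%C.
    rewrite (csum_ext n (tail (hom varx (x, y)))
      (fun k => match k with O => x | _ => RtoC 0 end)).
    + rewrite csum_first, hom_varx. simpl.
      replace (0 + x - x)%C with (RtoC 0) by ring. rewrite Cmod_0. exact He.
    + intro k. unfold tail. rewrite hom_varx. destruct k; reflexivity.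
Qed.

Lemma val_flip f p : val (flip f) p = val f (snd p, fst p).
Proof.
  unfold val. f_equal. apply functional_extensionality; intro k. unfold hom.
  rewrite <- (diag_transpose (A := Crng)). apply diag_ext. intros i j _.
  unfold scale, flip. simpl. cring.
Qed.

Lemma val_vary p : val vary p = snd p.
Proof. rewrite <- flip_varx, val_flip. apply val_varx. Qed.

(** ** Germs at the origin *)

Lemma near0_and P Q : near0 P -> near0 Q -> near0 (fun p => P p /\ Q p).
Proof.
  intros [r [Hr H]] [s [Hs H']]. exists (Rmin r s).
  split; [apply Rmin_glb_lt; assumption|]. intros x y Hx Hy.
  pose proof (Rmin_l r s). pose proof (Rmin_r r s).
  split; [apply H | apply H']; lra.
Qed.

Lemma near0_mono (P Q : C * C -> Prop) : (forall p, P p -> Q p) -> near0 P -> near0 Q.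
Proof. intros H [r [Hr HP]]. exists r. split; [exact Hr|]. intros. apply H, HP; assumption. Qed.

Lemma near0_all (P : C * C -> Prop) : (forall p, P p) -> near0 P.
Proof. intro H. exists 1. split; [lra|]. intros; apply H. Qed.

Lemma near0_polydisc r : 0 < r -> near0 (polydisc r).
Proof. intro Hr. exists r. split; [exact Hr|]. intros x y Hx Hy. split; simpl; lra. Qed.

(* Intersect the hypothesis [H] with the neighbourhoods met so far. *)
Ltac near H := refine (near0_mono _ _ _ (near0_and _ _ H _)).

Lemma near0_at0 P : near0 P -> P origin.
Proof. intros [r [Hr H]]. apply H; rewrite Cmod_0; exact Hr. Qed.

Lemma bounded_on_shrink f r r' : 0 <= r' <= r -> bounded_on f r -> bounded_on f r'.
Proof.
  intros Hr [M HM]. exists M. intro K. eapply Rle_trans; [|apply HM].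
  apply psum_mono_r; auto.
Qed.

Lemma conv_common f g : conv f -> conv g ->
  exists r, 0 < r /\ bounded_on f r /\ bounded_on g r.
Proof.
  intros [r [M [Hr HM]]] [s [N [Hs HN]]].
  pose proof (Rmin_l r s). pose proof (Rmin_r r s).
  assert (0 < Rmin r s) by (apply Rmin_glb_lt; assumption).
  exists (Rmin r s). split; [assumption|]. split.
  - apply (bounded_on_shrink f r); [lra | exists M; exact HM].
  - apply (bounded_on_shrink g s); [lra | exists N; exact HN].
Qed.

Lemma val_add f g : conv f -> conv g ->
  near0 (fun p => val (f + g)%S p = (val f p + val g p)%C).
Proof.
  intros Hf Hg. destruct (conv_common f g Hf Hg) as [r [Hr [B1 B2]]].
  apply (near0_mono (polydisc r)); [|apply near0_polydisc, Hr].
  intros p Hp. apply (val_add_on f g r p); assumption.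
Qed.

Lemma val_mul f g : conv f -> conv g ->
  near0 (fun p => val (f * g)%S p = (val f p * val g p)%C).
Proof.
  intros Hf Hg. destruct (conv_common f g Hf Hg) as [r [Hr [B1 B2]]].
  apply (near0_mono (polydisc r)); [|apply near0_polydisc, Hr].
  intros p Hp. apply (val_mul_on f g r p); assumption.
Qed.

Lemma val_cst_mul c f : conv f ->
  near0 (fun p => val (cst c * f)%S p = (c * val f p)%C).
Proof.
  intro Hf. apply (near0_mono (fun p => val (cst c * f)%S p = (val (cst c) p * val f p)%C)).
  - intros p E. rewrite E, val_cst. reflexivity.
  - apply val_mul; [apply conv_cst | exact Hf].
Qed.

Lemma val_sub f g : conv f -> conv g ->
  near0 (fun p => val (f - g)%S p = (val f p - val g p)%C).
Proof.
  intros Hf Hg.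
  replace (f - g)%S with (f + cst (Copp (RtoC 1)) * g)%S.
  - near (val_cst_mul (Copp (RtoC 1)) g Hg).
    2: apply (val_add f (cst (Copp (RtoC 1)) * g)%S); [exact Hf | apply conv_mul;
      [apply conv_cst | exact Hg]].
    intros p [E1 E2]. rewrite E2, E1. ring.
  - rewrite cst_opp. change (cst (RtoC 1)) with (1%S : S2). ring.
Qed.

Lemma val_rpow f n : conv f -> near0 (fun p => val (rpow f n) p = (val f p ^ n)%C).
Proof.
  intro Hf. induction n as [|n IH].
  - apply near0_all. intro p. apply (val_cst (RtoC 1)).
  - near IH. 2: exact (val_mul f (rpow f n) Hf (conv_rpow f n Hf)).
    intros p [E1 E2]. change (rpow f (S n)) with (f * rpow f n)%S.
    rewrite E2, E1. reflexivity.
Qed.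

Lemma val_origin f : conv f -> val f origin = f O O.
Proof.
  intros [r [M [Hr HM]]].
  assert (Hd : polydisc 0 origin) by (split; simpl; rewrite Cmod_0; lra).
  apply (val_unique f 0); [|exact Hd|].
  - apply (bounded_on_shrink f r); [lra | exists M; exact HM].
  - assert (E : forall k, hom f origin k = match k with O => f O O | _ => RtoC 0 end).
    { intros [|k].
      - unfold hom. change (f O O * (1 * 1) + 0 = f O O)%C. ring.
      - apply Cmod_eq_0, Rle_antisym; [|apply Cmod_ge_0].
        eapply Rle_trans; [apply (hom_le f origin 0 _ Hd)|]. simpl. lra. }
    intros eps He. exists O. intros n _.
    rewrite (csum_ext n _ _ E), csum_first.
    replace (f O O - f O O)%C with (RtoC 0) by ring. rewrite Cmod_0. exact He.
Qed.

Lemma val_small f : conv f -> f O O = RtoC 0 ->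
  forall eps, 0 < eps -> near0 (fun p => Cmod (val f p) < eps).
Proof.
  intros Hf H0 eps He.
  destruct (conv_ord f 1 Hf (ord_1 f H0)) as [r [M [Hr [HM HB]]]].
  set (s := Rmin r (eps / (M + 1) / 2)).
  assert (He' : 0 < eps / (M + 1)) by (apply Rdiv_lt_0_compat; lra).
  assert (Hs : 0 < s) by (apply Rmin_glb_lt; lra).
  assert (HsM : s * (M + 1) <= eps / 2).
  { apply Rle_trans with (eps / (M + 1) / 2 * (M + 1)).
    - apply Rmult_le_compat_r; [lra | apply Rmin_r].
    - right. field. lra. }
  apply (near0_mono (polydisc s)); [|apply near0_polydisc, Hs].
  intros p Hp. apply Rle_lt_trans with (M * s ^ 1).
  - apply (val_le f s); [exact Hp|]. intro K. apply HB. split; [lra | apply Rmin_l].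
  - rewrite pow_1. nra.
Qed.

Lemma near0_comp (u v : S2) P : conv u -> conv v -> u O O = RtoC 0 -> v O O = RtoC 0 ->
  near0 P -> near0 (fun p => P (val u p, val v p)).
Proof.
  intros Cu Cv u0 v0 [r [Hr HP]].
  near (val_small u Cu u0 r Hr). 2: exact (val_small v Cv v0 r Hr).
  intros p [H1 H2]. apply HP; assumption.
Qed.

(** ** Identity theorem *)

Lemma val_scale e f p : val (scale 1 (RtoC e) f) p = val f (fst p, (RtoC e * snd p)%C).
Proof.
  unfold val. f_equal. apply functional_extensionality; intro k. unfold hom.
  apply diag_ext. intros i j _. unfold scale. simpl.
  replace ((e * snd p) ^ j)%C with (RtoC e ^ j * snd p ^ j)%C.
  - replace (1 ^ i)%C with (RtoC 1); [cring|].
    induction i as [|i IH]; [reflexivity|]. simpl. rewrite <- IH. ring.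
  - induction j as [|j IH]; simpl; [ring|]. rewrite <- IH. ring.
Qed.

(** The leading monomial exceeds the rest at the point [(s, e s)] of a thin
    polydisc. *)
Theorem val_identity f : conv f -> near0 (fun p => val f p = RtoC 0) -> f = 0%S.
Proof.
  intros Hf [r0 [Hr0 H]]. apply NNPP. intro Hn.
  destruct (leading_dominates f Hf Hn) as
    [e [i0 [j0 [c [rest [He [Hc [Ef [Ho [r1 [Hr1 HB]]]]]]]]]]].
  assert (Hcp : 0 < Cmod c) by (apply Cmod_gt_0; exact Hc).
  set (s := Rmin r1 (r0 / 2)).
  assert (Hs : 0 < s) by (apply Rmin_glb_lt; lra).
  set (p := (RtoC s, RtoC s)).
  assert (Cs : Cmod (RtoC s) = s) by (rewrite Cmod_R; apply Rabs_pos_eq; lra).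
  assert (Hp : polydisc s p) by (split; simpl; rewrite Cs; lra).
  set (m := (rpow varx i0 * rpow vary j0 : S2)%S) in *.
  assert (s0 : 0 <= s) by lra.
  destruct (val_rpow_on varx s p i0 (bounded_on_varx s s0) Hp) as [B1 V1].
  destruct (val_rpow_on vary s p j0 (bounded_on_vary s s0) Hp) as [B2 V2].
  assert (Bm : bounded_on m s) by (apply bounded_on_mul; auto; lra).
  pose proof (bounded_on_cst c s) as Bc.
  assert (Hrest : forall K, psum K s (maj rest) <= Cmod c / 2 * s ^ (i0 + j0)).
  { intro K. apply HB. split; [lra | apply Rmin_l]. }
  assert (E : val f (fst p, (RtoC e * snd p)%C) = (c * (s ^ i0 * s ^ j0) + val rest p)%C).
  { rewrite <- val_scale, Ef.
    rewrite (val_add_on (cst c * m)%S rest s p); auto;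
      [|apply bounded_on_mul; auto; lra | eexists; exact Hrest].
    rewrite (val_mul_on (cst c) m s p) by auto. unfold m.
    rewrite (val_mul_on (rpow varx i0) (rpow vary j0) s p) by auto.
    rewrite val_cst, V1, V2, val_varx, val_vary. reflexivity. }
  rewrite H in E.
  - assert (B := val_le rest s p _ Hp Hrest).
    assert (E' : (c * (s ^ i0 * s ^ j0))%C = (- val rest p)%C).
    { replace (c * (s ^ i0 * s ^ j0))%C with
        ((c * (s ^ i0 * s ^ j0) + val rest p) - val rest p)%C by ring.
      rewrite <- E. ring. }
    apply (f_equal Cmod) in E'. rewrite Cmod_opp, !Cmod_mult in E'.
    rewrite !Cmod_pow_R in E' by lra. rewrite <- E', <- pow_add in B.
    assert (0 < s ^ (i0 + j0)) by (apply pow_lt, Hs). nra.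
  - simpl. rewrite Cs. pose proof (Rmin_r r1 (r0 / 2)). fold s in H0. lra.
  - simpl. rewrite Cmod_mult, Cs, Cmod_R, Rabs_pos_eq by lra.
    pose proof (Rmin_r r1 (r0 / 2)). fold s in H0. nra.
Qed.

Lemma val_inj f g : conv f -> conv g -> near0 (fun p => val f p = val g p) -> f = g.
Proof.
  intros Hf Hg H. assert (E : (f - g)%S = 0%S).
  - apply val_identity; [apply conv_sub; assumption|].
    near H. 2: exact (val_sub f g Hf Hg). intros p [E1 E2]. rewrite E2, E1. ring.
  - replace f with ((f - g) + g)%S by ring. rewrite E. ring.
Qed.

(** ** Complex derivatives *)

Definition cderiv (f : C -> C) (x l : C) : Prop :=
  forall eps, 0 < eps -> exists d, 0 < d /\
    forall h, Cmod h < d -> Cmod (f (x + h) - f x - h * l)%C <= eps * Cmod h.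

Lemma cderiv_C_derive f x l : cderiv f x l -> C_derive f x = l.
Proof.
  intro H. apply is_C_derive_unique. split.
  - apply is_linear_scal_l.
  - intros y Hy.
    replace y with x by exact (is_filter_lim_locally_unique (V := AbsRing_NormedModule
      C_AbsRing) x y Hy).
    clear y Hy.
    intro eps. destruct (H eps (cond_pos eps)) as [d [Hd HH]].
    exists (mkposreal d Hd). intros z Hz.
    change (Cmod (z - x)%C < d) in Hz.
    specialize (HH (z - x)%C Hz).
    assert (E : forall w : C, (x + (w - x))%C = w) by (intro; ring).
    rewrite E in HH. exact HH.
Qed.

Lemma power_taylor (x h : C) rho n : 0 < rho -> Cmod x <= rho -> Cmod (x + h)%C <= rho ->
  Cmod ((x + h) ^ n - x ^ n - h * (INR n * x ^ pred n))%C * rho ^ 2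
  <= INR n ^ 2 * Cmod h ^ 2 * rho ^ n.
Proof.
  intros Hr Hx Hxh. induction n as [|n IH].
  - simpl INR. replace ((x + h) ^ 0 - x ^ 0 - h * (0 * x ^ pred 0))%C with (RtoC 0)
      by (simpl; ring). rewrite Cmod_0. lra.
  - set (d := ((x + h) ^ n - x ^ n - h * (INR n * x ^ pred n))%C) in *.
    assert (E : ((x + h) ^ S n - x ^ S n - h * (INR (S n) * x ^ pred (S n)))%C
      = ((x + h) * d + INR n * (h * h) * x ^ pred n)%C).
    { unfold d. rewrite S_INR, RtoC_plus. destruct n as [|n]; simpl pred; simpl Cpow;
        [simpl INR; ring | ring]. }
    rewrite E.
    assert (Hh := Cmod_ge_0 h). assert (Hn := pos_INR n).
    assert (T1 : Cmod ((x + h) * d)%C * rho ^ 2 <= INR n ^ 2 * Cmod h ^ 2 * rho ^ S n).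
    { rewrite Cmod_mult. simpl (rho ^ S n).
      apply Rle_trans with (rho * (Cmod d * rho ^ 2)).
      - rewrite Rmult_assoc. apply Rmult_le_compat_r; [|exact Hxh].
        apply Rmult_le_pos; [apply Cmod_ge_0 | apply pow_le; lra].
      - replace (INR n ^ 2 * Cmod h ^ 2 * (rho * rho ^ n)) with
          (rho * (INR n ^ 2 * Cmod h ^ 2 * rho ^ n)) by ring.
        apply Rmult_le_compat_l; [lra | exact IH]. }
    assert (T2 : Cmod (INR n * (h * h) * x ^ pred n)%C * rho ^ 2
      <= INR n * Cmod h ^ 2 * rho ^ S n).
    { rewrite !Cmod_mult, Cmod_INR. destruct n as [|n].
      - simpl INR. rewrite !Rmult_0_l. lra.
      - simpl pred. pose proof (Cmod_pow_le x rho n Hx).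
        replace (INR (S n) * Cmod h ^ 2 * rho ^ S (S n)) with
          (INR (S n) * (Cmod h * Cmod h) * rho ^ n * rho ^ 2) by (simpl; ring).
        apply Rmult_le_compat_r; [apply pow_le; lra|].
        apply Rmult_le_compat_l; [nra | assumption]. }
    apply Rle_trans with ((Cmod ((x + h) * d)%C
      + Cmod (INR n * (h * h) * x ^ pred n)%C) * rho ^ 2).
    + apply Rmult_le_compat_r; [apply pow_le; lra | apply Cmod_triangle].
    + rewrite Rmult_plus_distr_r. rewrite S_INR.
      assert (0 <= Cmod h ^ 2 * rho ^ S n) by (apply Rmult_le_pos; apply pow_le; lra).
      replace ((INR n + 1) ^ 2 * Cmod h ^ 2 * rho ^ S n) with
        (INR n ^ 2 * Cmod h ^ 2 * rho ^ S n + INR n * Cmod h ^ 2 * rho ^ S n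
         + (INR n + 1) * (Cmod h ^ 2 * rho ^ S n)) by ring.
      nra.
Qed.

Lemma hom_taylor f x h y rho k : 0 < rho -> Cmod x <= rho -> Cmod (x + h)%C <= rho ->
  Cmod y <= rho ->
  Cmod (hom f (x + h, y)%C (S k) - hom f (x, y) (S k) - h * hom (dx f) (x, y) k)%C * rho ^ 2
  <= INR (S k) ^ 2 * maj f (S k) * rho ^ S k * Cmod h ^ 2.
Proof.
  intros Hr Hx Hxh Hy.
  set (G := (fun i j => (f i j * (y ^ j *
    ((x + h) ^ i - x ^ i - h * (INR i * x ^ pred i))))%C) : S2).
  assert (E : (hom f (x + h, y)%C (S k) - hom f (x, y) (S k) - h * hom (dx f) (x, y) k)%C
    = diag (A := Crng) G (S k)).
  { assert (E1 : hom (dx f) (x, y) k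
      = diag (A := Crng) (fun i j => (f i j * (y ^ j * (INR i * x ^ pred i)))%C) (S k)).
    { change (hom (dx f) (x, y) k = (f O (S k) * (y ^ S k * (0 * x ^ 0)) +
        diag (A := Crng) (fun i j => (f (S i) j * (y ^ j * (INR (S i) * x ^ i)))%C) k)%C).
      replace (f O (S k) * (y ^ S k * (0 * x ^ 0)))%C with (RtoC 0) by cring.
      rewrite Cplus_0_l. apply diag_ext. intros i j _.
      unfold scale. rewrite dx_coef. cbn [fst snd]. cring. }
    rewrite E1.
    assert (scal : forall c (g : S2) n, diag (A := Crng) (fun i j => (c * g i j)%C) n
      = (c * diag (A := Crng) g n)%C).
    { clear. intros c g n. revert g; induction n as [|n IH]; intro g.
      - change (c * g O O + 0 = c * (g O O + 0))%C. cring.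
      - change (c * g O (S n) + diag (A := Crng) (fun i j => (c * tail g i j)%C) n
          = c * (g O (S n) + diag (A := Crng) (tail g) n))%C. rewrite IH. cring. }
    set (h1 := (fun i j => (f i j * ((x + h) ^ i * y ^ j))%C) : S2).
    set (h2 := (fun i j => (f i j * (x ^ i * y ^ j))%C) : S2).
    set (h3 := (fun i j => (f i j * (y ^ j * (INR i * x ^ pred i)))%C) : S2).
    change (diag (A := Crng) h1 (S k) - diag (A := Crng) h2 (S k)
      - h * diag (A := Crng) h3 (S k) = diag (A := Crng) G (S k))%C.
    replace (diag (A := Crng) h1 (S k) - diag (A := Crng) h2 (S k)
      - h * diag (A := Crng) h3 (S k))%C with
      (diag (A := Crng) h1 (S k) + (- (1) * diag (A := Crng) h2 (S k)
      + (- h) * diag (A := Crng) h3 (S k)))%C by cring.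
    rewrite <- !scal.
    change Cplus with (@radd Crng). rewrite <- !(diag_add (A := Crng)).
    apply diag_ext. intros i j _. unfold h1, h2, h3, G. cring. }
  rewrite E.
  apply Rle_trans with (diag (A := Rrng) (fun i j => rho ^ 2 * Cmod (G i j)) (S k)).
  - rewrite diag_rscal, Rmult_comm. apply Rmult_le_compat_l; [apply pow_le; lra|].
    apply Cmod_diag.
  - replace (INR (S k) ^ 2 * maj f (S k) * rho ^ S k * Cmod h ^ 2) with
      ((INR (S k) ^ 2 * rho ^ S k * Cmod h ^ 2) * maj f (S k)) by ring.
    unfold maj. rewrite <- diag_rscal. apply diag_le. intros i j Eij.
    unfold G. rewrite !Cmod_mult.
    set (t := Cmod ((x + h) ^ i - x ^ i - h * (INR i * x ^ pred i))%C).
    assert (Ht : t * rho ^ 2 <= INR i ^ 2 * Cmod h ^ 2 * rho ^ i)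
      by (apply power_taylor; assumption).
    assert (Hy' := Cmod_pow_le y rho j Hy).
    replace (rho ^ 2 * (Cmod (f i j) * (Cmod (y ^ j)%C * t))) with
      (Cmod (f i j) * (Cmod (y ^ j)%C * (t * rho ^ 2))) by ring.
    rewrite (Rmult_comm _ (Cmod (f i j))).
    apply Rmult_le_compat_l; [apply Cmod_ge_0|].
    apply Rle_trans with (rho ^ j * (INR i ^ 2 * Cmod h ^ 2 * rho ^ i)).
    + apply Rmult_le_compat; try assumption; [apply Cmod_ge_0|].
      apply Rmult_le_pos; [apply Cmod_ge_0 | apply pow_le; lra].
    + rewrite <- Eij, pow_add.
      replace (rho ^ j * (INR i ^ 2 * Cmod h ^ 2 * rho ^ i)) with
        (INR i ^ 2 * (rho ^ i * rho ^ j * Cmod h ^ 2)) by ring.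
      replace (INR (i + j) ^ 2 * (rho ^ i * rho ^ j) * Cmod h ^ 2) with
        (INR (i + j) ^ 2 * (rho ^ i * rho ^ j * Cmod h ^ 2)) by ring.
      apply Rmult_le_compat_r.
      * apply Rmult_le_pos; [apply Rmult_le_pos|]; apply pow_le; try lra. apply Cmod_ge_0.
      * apply pow_incr. split; [apply pos_INR | apply le_INR; lia].
Qed.

Lemma INR_sqr_pow4 n : INR n ^ 2 <= 4 ^ n.
Proof.
  replace 4 with (2 ^ 2) by ring. rewrite <- pow_mult, Nat.mul_comm, pow_mult.
  apply pow_incr. split; [apply pos_INR|]. destruct n as [|n]; [simpl; lra|].
  eapply Rle_trans; [apply INR_S_pow2|]. apply Rle_pow; [lra | lia].
Qed.

(** The Taylor remainder of order 2, summed over all terms, is at most a constant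
    times [|h| ^ 2]; the factor [k ^ 2] from the second derivatives is absorbed by
    a radius four times smaller. *)
Lemma val_cderiv_x f : conv f -> exists r, 0 < r /\ forall x y,
  Cmod x < r -> Cmod y < r -> cderiv (fun t => val f (t, y)) x (val (dx f) (x, y)).
Proof.
  intro Hf. destruct (conv_common f (dx f) Hf (conv_dx f Hf)) as [s [Hs [Bf Bdf]]].
  set (rho := s / 4). assert (Hrho : 0 < rho) by (unfold rho; lra).
  exists rho. split; [exact Hrho|]. intros x y Hx Hy.
  destruct Bf as [M HM].
  assert (HM0 : 0 <= M).
  { apply Rle_trans with (2 := HM O). apply psum_pos; auto; lra. }
  assert (quad : forall h, Cmod (x + h)%C <= rho ->
    Cmod (val f (x + h, y)%C - val f (x, y) - h * val (dx f) (x, y))%C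
    <= M / rho ^ 2 * Cmod h ^ 2).
  { intros h Hxh.
    assert (D1 : polydisc s (x + h, y)%C) by (split; simpl; unfold rho in *; lra).
    assert (D2 : polydisc s (x, y)) by (split; simpl; unfold rho in *; lra).
    assert (Bf : bounded_on f s) by (exists M; exact HM).
    pose proof (val_limit f s _ Bf D1) as L1. pose proof (val_limit f s _ Bf D2) as L2.
    pose proof (val_limit (dx f) s _ Bdf D2) as L3.
    set (u := fun n => (csum (S n) (hom f (x + h, y)%C) - csum (S n) (hom f (x, y))
      - h * csum n (hom (dx f) (x, y)))%C).
    assert (shift : forall a l, climit (fun n => csum n a) l -> climit (fun n => csum (S n) a) l).
    { intros a l H eps He. destruct (H eps He) as [N HN]. exists N. intros n Hn.
      apply HN. lia. }
    assert (Lu : climit u (val f (x + h, y)%C - val f (x, y) - h * val (dx f) (x, y))%C).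
    { apply shift in L1. apply shift in L2.
      pose proof (climit_add _ _ _ _ L1 (climit_add _ _ _ _
        (climit_mul _ _ _ _ (climit_const (-(1))%C) L2)
        (climit_mul _ _ _ _ (climit_const (- h)%C) L3))) as L.
      intros eps He. destruct (L eps He) as [N HN]. exists N. intros n Hn.
      specialize (HN n Hn). cbv beta in HN. unfold u.
      match goal with |- Cmod ?a < _ => match type of HN with Cmod ?b < _ =>
        replace a with b by ring end end. exact HN. }
    apply (climit_bounded u); [exact Lu|]. intro n.
    assert (EU : u n = csum n (fun k => hom f (x + h, y)%C (S k) - hom f (x, y) (S k)
      - h * hom (dx f) (x, y) k)%C).
    { unfold u. simpl csum.
      assert (E0 : hom f (x + h, y)%C O = hom f (x, y) O).
      { unfold hom. change (scale (x + h)%C y f O O + 0 = scale x y f O O + 0)%C.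
        unfold scale. simpl. cring. }
      rewrite E0.
      rewrite (csum_ext n (fun k => hom f (x + h, y)%C (S k) - hom f (x, y) (S k)
        - h * hom (dx f) (x, y) k)%C (fun k => tail (hom f (x + h, y)%C) k +
        (-(1) * tail (hom f (x, y)) k + - h * hom (dx f) (x, y) k))%C)
        by (intro k; unfold tail; ring).
      rewrite !csum_add, !csum_scal. ring. }
    rewrite EU.
    apply Rmult_le_reg_r with (rho ^ 2); [apply pow_lt, Hrho|].
    replace (M / rho ^ 2 * Cmod h ^ 2 * rho ^ 2) with (M * Cmod h ^ 2)
      by (field; lra).
    apply Rle_trans with (psum n 1 (fun k => INR (S k) ^ 2 * maj f (S k) * rho ^ S k
      * Cmod h ^ 2 / rho ^ 2) * rho ^ 2).
    { apply Rmult_le_compat_r; [apply pow_le; lra|]. apply csum_le. intro k.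
      apply Rmult_le_reg_r with (rho ^ 2); [apply pow_lt, Hrho|].
      replace (INR (S k) ^ 2 * maj f (S k) * rho ^ S k * Cmod h ^ 2 / rho ^ 2 * rho ^ 2)
        with (INR (S k) ^ 2 * maj f (S k) * rho ^ S k * Cmod h ^ 2)
        by (field; lra).
      apply hom_taylor; lra. }
    replace (fun k => INR (S k) ^ 2 * maj f (S k) * rho ^ S k * Cmod h ^ 2 / rho ^ 2)
      with (fun k => (Cmod h ^ 2 / rho ^ 2) * (INR (S k) ^ 2 * maj f (S k) * rho ^ S k))
      by (apply functional_extensionality; intro k; field; lra).
    rewrite psum_scal.
    replace (Cmod h ^ 2 / rho ^ 2 * psum n 1 (fun k => INR (S k) ^ 2 * maj f (S k) * rho ^ S k)
      * rho ^ 2) with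
      (psum n 1 (fun k => INR (S k) ^ 2 * maj f (S k) * rho ^ S k) * Cmod h ^ 2)
      by (field; lra).
    apply Rmult_le_compat_r; [apply pow_le, Cmod_ge_0|].
    (* [k ^ 2 <= 4 ^ k] is absorbed by the smaller radius *)
    apply Rle_trans with (psum n 1 (tail (fun k => maj f k * s ^ k))).
    { apply psum_le; [lra|]. intros k _. unfold tail.
      replace s with (4 * rho) by (unfold rho; field). rewrite Rpow_mult_distr.
      replace (maj f (S k) * (4 ^ S k * rho ^ S k)) with
        (4 ^ S k * (maj f (S k) * rho ^ S k)) by ring.
      rewrite Rmult_assoc. apply Rmult_le_compat_r; [|apply INR_sqr_pow4].
      apply Rmult_le_pos; [apply maj_pos | apply pow_le; lra]. }
    apply Rle_trans with (psum (S n) 1 (fun k => maj f k * s ^ k)).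
    { simpl. pose proof (maj_pos f 0). lra. }
    rewrite psum_1. apply HM. }
  intros eps He. set (B := M / rho ^ 2) in *.
  assert (HB : 0 <= B) by (apply Rdiv_le_0_compat; [exact HM0 | apply pow_lt, Hrho]).
  assert (He' : 0 < eps / (B + 1)) by (apply Rdiv_lt_0_compat; lra).
  exists (Rmin (rho - Cmod x) (eps / (B + 1))).
  split; [apply Rmin_glb_lt; lra|]. intros h Hh.
  assert (H1 : Cmod h < rho - Cmod x) by (eapply Rlt_le_trans; [exact Hh | apply Rmin_l]).
  assert (H2 : Cmod h < eps / (B + 1)) by (eapply Rlt_le_trans; [exact Hh | apply Rmin_r]).
  eapply Rle_trans; [apply quad|].
  - eapply Rle_trans; [apply Cmod_triangle|]. lra.
  - assert (H3 : Cmod h * (B + 1) <= eps).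
    { apply Rmult_lt_compat_r with (r := B + 1) in H2; [|lra].
      replace (eps / (B + 1) * (B + 1)) with eps in H2 by (field; lra). lra. }
    pose proof (Cmod_ge_0 h).
    replace (B * Cmod h ^ 2) with (B * Cmod h * Cmod h) by ring.
    apply Rmult_le_compat_r; [assumption|]. nra.
Qed.

Lemma val_cderiv_y f : conv f -> exists r, 0 < r /\ forall x y,
  Cmod x < r -> Cmod y < r -> cderiv (fun t => val f (x, t)) y (val (dy f) (x, y)).
Proof.
  intro Hf. destruct (val_cderiv_x (flip f) (conv_flip f Hf)) as [r [Hr H]].
  exists r. split; [exact Hr|]. intros x y Hx Hy.
  specialize (H y x Hy Hx). rewrite <- flip_dy, val_flip in H. cbn [fst snd] in H.
  intros eps He. destruct (H eps He) as [d [Hd HH]]. exists d. split; [exact Hd|].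
  intros h Hh. specialize (HH h Hh). rewrite !val_flip in HH. exact HH.
Qed.

(** * Composition and inversion *)

(** ** Locally finite sums of series *)

Fixpoint ssum (K : nat) (c : nat -> S2) : S2 :=
  match K with O => c O | S L => (ssum L c + c (S L))%S end.

(** An infinite sum that makes sense when [c k] has order at least [k], since then
    the coefficients of degree [n] are settled after the term [c n]. *)
Definition lsum (c : nat -> S2) : S2 := fun i j => ssum (i + j) c i j.

Lemma lsum_ssum c n : (forall k, ord (c k) k) -> ord (lsum c - ssum n c)%S (S n).
Proof.
  intros Hc i j L. rewrite sub_coef. unfold lsum.
  assert (E : forall m, ssum (i + j + m) c i j = ssum (i + j) c i j).
  { induction m as [|m IH]; [f_equal; lia|].
    replace (i + j + S m)%nat with (S (i + j + m)) by lia.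
    change (ssum (S (i + j + m)) c) with (ssum (i + j + m) c + c (S (i + j + m)))%S.
    rewrite add_coef, IH, (Hc (S (i + j + m)) i j) by lia. apply Cplus_0_r. }
  replace n with (i + j + (n - (i + j)))%nat by lia. rewrite E. apply Cplus_opp_r.
Qed.

Lemma maj_close f g K n : ord (f - g)%S (S K) -> (n <= K)%nat -> maj f n = maj g n.
Proof.
  intros H L. unfold maj. apply diag_ext. intros i j E. f_equal.
  specialize (H i j ltac:(lia)). rewrite sub_coef in H.
  transitivity ((f i j - g i j) + g i j)%C; [cring|]. rewrite H. cring.
Qed.

Lemma psum_le_eq K r a b : (forall n, (n <= K)%nat -> a n = b n) -> psum K r a = psum K r b.
Proof.
  revert a b; induction K as [|K IH]; intros a b H; simpl; rewrite (H O) by lia;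
    [reflexivity|].
  f_equal. f_equal. apply IH. intros n L. apply (H (S n)). lia.
Qed.

Lemma psum_maj_ssum K r c b n : 0 <= r -> (forall k, psum K r (maj (c k)) <= b k) ->
  psum K r (maj (ssum n c)) <= psum n 1 b.
Proof.
  intros Hr Hb. induction n as [|n IH]; [apply Hb|].
  change (ssum (S n) c) with (ssum n c + c (S n))%S. rewrite psum_S, pow1, Rmult_1_r.
  eapply Rle_trans; [apply psum_maj_add, Hr|]. apply Rplus_le_compat; auto.
Qed.

Lemma psum_maj_lsum K r c b : 0 <= r -> (forall k, ord (c k) k) ->
  (forall k, psum K r (maj (c k)) <= b k) -> psum K r (maj (lsum c)) <= psum K 1 b.
Proof.
  intros Hr Hc Hb. eapply Rle_trans; [|apply (psum_maj_ssum K r c b K Hr Hb)].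
  right. apply psum_le_eq. intros m L. apply (maj_close _ _ K); [|exact L].
  apply lsum_ssum, Hc.
Qed.

Lemma val_ssum c r p n : 0 <= r -> polydisc r p -> (forall k, bounded_on (c k) r) ->
  bounded_on (ssum n c) r /\ val (ssum n c) p = csum n (fun k => val (c k) p).
Proof.
  intros Hr Hp Hc. induction n as [|n [IH1 IH2]]; [split; [apply Hc | reflexivity]|].
  change (ssum (S n) c) with (ssum n c + c (S n))%S.
  split; [apply bounded_on_add; auto|].
  rewrite (val_add_on _ _ r p), csum_S, IH2 by auto. reflexivity.
Qed.

Lemma val_lsum c b r p M : 0 <= r -> polydisc r p -> (forall k, ord (c k) k) ->
  (forall K k, psum K r (maj (c k)) <= b k) -> (forall K, psum K 1 b <= M) ->
  climit (fun n => csum n (fun k => val (c k) p)) (val (lsum c) p).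
Proof.
  intros Hr Hp Hc Hb HM.
  assert (Hcb : forall k, bounded_on (c k) r) by (intro k; exists (b k); intro K; apply Hb).
  assert (b_pos : forall k, 0 <= b k).
  { intro k. eapply Rle_trans; [|apply (Hb O k)]. apply psum_pos; auto. }
  assert (Hl : bounded_on (lsum c) r).
  { exists M. intro K. eapply Rle_trans; [|apply (HM K)]. apply psum_maj_lsum; auto. }
  destruct (bounded_ex_series b M b_pos HM) as [l Hl0].
  pose proof (proj1 (filterlim_locally (U := R_UniformSpace) _ _) Hl0) as Hlim.
  pose proof (fun K => sum_n_psum K b) as E.
  intros eps He. assert (He4 : 0 < eps / 4) by lra.
  destruct (Hlim (mkposreal _ He4)) as [N HN]. exists N. intros n Hn.
  assert (tail_small : forall K, (n <= K)%nat -> psum K 1 b - psum n 1 b < eps / 2).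
  { intros K HK. pose proof (HN n Hn) as H1. pose proof (HN K ltac:(lia)) as H2.
    rewrite E in H1, H2.
    change (Rabs (psum n 1 b - l) < eps / 4) in H1.
    change (Rabs (psum K 1 b - l) < eps / 4) in H2.
    apply Rabs_def2 in H1. apply Rabs_def2 in H2. lra. }
  destruct (val_ssum c r p n Hr Hp Hcb) as [Bs Vs].
  rewrite <- Vs.
  set (d := (lsum c - ssum n c)%S).
  assert (d_small : forall K, psum K r (maj d) <= eps / 2).
  { intro K0. set (K := max K0 n).
    apply Rle_trans with (psum K r (maj d)); [apply psum_mono_K; auto; lia|].
    assert (HK : (n <= K)%nat) by lia. clearbody K. clear K0.
    assert (gen : forall m, psum K r (maj (ssum (n + m) c - ssum n c)%S)
      <= psum (n + m) 1 b - psum n 1 b).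
    { induction m as [|m IH].
      - rewrite Nat.add_0_r. replace (ssum n c - ssum n c)%S with (0%S : S2) by ring.
        rewrite <- cst_0, psum_maj_cst, Cmod_0. lra.
      - replace (n + S m)%nat with (S (n + m)) by lia.
        change (ssum (S (n + m)) c) with (ssum (n + m) c + c (S (n + m)))%S.
        replace (ssum (n + m) c + c (S (n + m)) - ssum n c)%S with
          ((ssum (n + m) c - ssum n c) + c (S (n + m)))%S by ring.
        eapply Rle_trans; [apply psum_maj_add, Hr|].
        rewrite psum_S, pow1. specialize (Hb K (S (n + m))). lra. }
    specialize (gen (K - n)%nat). replace (n + (K - n))%nat with K in gen by lia.
    replace (psum K r (maj d)) with (psum K r (maj (ssum K c - ssum n c)%S)).
    - specialize (tail_small K HK). lra.
    - apply psum_le_eq. intros m Lm. apply (maj_close _ _ K); [|exact Lm].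
      unfold d. replace (ssum K c - ssum n c - (lsum c - ssum n c))%S with
        (- (lsum c - ssum K c))%S by ring.
      apply ord_opp, lsum_ssum, Hc. }
  assert (Vd : val (lsum c) p = (val d p + val (ssum n c) p)%C).
  { rewrite <- (val_add_on d (ssum n c) r p); auto.
    - f_equal. unfold d. ring.
    - eexists; exact d_small. }
  rewrite Vd.
  replace (val (ssum n c) p - (val d p + val (ssum n c) p))%C with (- val d p)%C by ring.
  rewrite Cmod_opp. eapply Rle_lt_trans; [apply (val_le d r p _ Hp d_small)|]. lra.
Qed.

(** ** Composition *)

Definition compose2_term (f u v : S2) (k : nat) : S2 :=
  diag (A := S2) (fun i j => (cst (f i j) * (rpow u i * rpow v j))%S) k.

(** [f(u, v)], for [u] and [v] without constant terms. *)
Definition compose2 (f u v : S2) : S2 := lsum (compose2_term f u v).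

Lemma diag_ord (g : nat -> nat -> S2) m n :
  (forall i j, (i + j = n)%nat -> ord (g i j) m) -> ord (diag (A := S2) g n) m.
Proof.
  revert g; induction n as [|n IH]; intros g H.
  - apply (ord_add (g O O) 0%S); [apply H; lia | apply ord_zero].
  - apply (ord_add (g O (S n)) (diag (A := S2) (tail g) n)); [apply H; lia|].
    apply IH. intros i j E. apply (H (S i)). lia.
Qed.

Lemma rpow_ord u i : ord u 1 -> ord (rpow u i) i.
Proof.
  intro Hu. induction i as [|i IH]; [intros a b L; lia|].
  exact (ord_mul u (rpow u i) 1 i Hu IH).
Qed.

Lemma monomial_ord u v i j : ord u 1 -> ord v 1 -> ord (rpow u i * rpow v j)%S (i + j).
Proof. intros Hu Hv. apply ord_mul; apply rpow_ord; assumption. Qed.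

Lemma compose2_term_ord f u v k : ord u 1 -> ord v 1 -> ord (compose2_term f u v k) k.
Proof.
  intros Hu Hv. apply diag_ord. intros i j E. apply ord_mul_r.
  rewrite <- E. apply monomial_ord; assumption.
Qed.

Lemma psum_maj_diag K r (g : nat -> nat -> S2) n : 0 <= r ->
  psum K r (maj (diag (A := S2) g n))
  <= diag (A := Rrng) (fun i j => psum K r (maj (g i j))) n.
Proof.
  intro Hr. revert g; induction n as [|n IH]; intro g.
  - change (psum K r (maj (g O O + 0)%S) <= psum K r (maj (g O O)) + 0).
    replace (g O O + 0)%S with (g O O) by ring. lra.
  - change (psum K r (maj (g O (S n) + diag (A := S2) (tail g) n)%S)
      <= psum K r (maj (g O (S n)))
         + diag (A := Rrng) (tail (fun i j => psum K r (maj (g i j)))) n).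
    eapply Rle_trans; [apply psum_maj_add, Hr|]. apply Rplus_le_compat_l, IH.
Qed.

Lemma psum_maj_rpow K r u s n : 0 <= r -> psum K r (maj u) <= s ->
  psum K r (maj (rpow u n)) <= s ^ n.
Proof.
  intros Hr Hs. induction n as [|n IH].
  - change (rpow u 0) with (cst (RtoC 1)). rewrite psum_maj_cst, Cmod_1. simpl; lra.
  - change (rpow u (S n)) with (u * rpow u n)%S.
    eapply Rle_trans; [apply psum_maj_mul, Hr|]. simpl.
    apply Rmult_le_compat; auto; apply psum_pos; auto.
Qed.

Lemma psum_maj_compose2_term K r f u v s k : 0 <= r ->
  psum K r (maj u) <= s -> psum K r (maj v) <= s ->
  psum K r (maj (compose2_term f u v k)) <= maj f k * s ^ k.
Proof.
  intros Hr Hu Hv. unfold compose2_term. eapply Rle_trans; [apply psum_maj_diag, Hr|].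
  rewrite Rmult_comm. unfold maj at 2. rewrite <- diag_rscal. apply diag_le.
  intros i j E. eapply Rle_trans; [apply psum_maj_mul, Hr|].
  rewrite psum_maj_cst, Rmult_comm. apply Rmult_le_compat_r; [apply Cmod_ge_0|].
  eapply Rle_trans; [apply psum_maj_mul, Hr|]. rewrite <- E, pow_add.
  apply Rmult_le_compat; try (apply psum_pos; auto);
    apply psum_maj_rpow; assumption.
Qed.

Lemma psum_maj_compose2 K r f u v s : 0 <= r -> ord u 1 -> ord v 1 ->
  psum K r (maj u) <= s -> psum K r (maj v) <= s ->
  psum K r (maj (compose2 f u v)) <= psum K s (maj f).
Proof.
  intros Hr Ou Ov Hu Hv. rewrite <- (psum_1 K s).
  apply psum_maj_lsum; [exact Hr | intro k; apply compose2_term_ord; assumption |].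
  intro k. apply psum_maj_compose2_term; assumption.
Qed.

(** Substituting [u], [v] multiplies the majorant of the terms of degree [k] of [f]
    by [s ^ k], where [s] bounds [u] and [v] on a small polydisc. *)
Lemma conv_compose2 f u v : conv f -> conv u -> conv v -> u O O = RtoC 0 -> v O O = RtoC 0 ->
  conv (compose2 f u v) /\
  near0 (fun p => val (compose2 f u v) p = val f (val u p, val v p)).
Proof.
  intros [s [M [Hs HM]]] Hu Hv u0 v0.
  apply ord_1 in u0. apply ord_1 in v0.
  destruct (conv_ord u 1 Hu u0) as [r1 [M1 [R1 [P1 B1]]]].
  destruct (conv_ord v 1 Hv v0) as [r2 [M2 [R2 [P2 B2]]]].
  set (r := Rmin (Rmin r1 r2) (s / (M1 + M2 + 1))).
  assert (Hr : 0 < r).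
  { repeat apply Rmin_glb_lt; try assumption. apply Rdiv_lt_0_compat; lra. }
  assert (Lr : r * (M1 + M2 + 1) <= s).
  { apply Rle_trans with (s / (M1 + M2 + 1) * (M1 + M2 + 1)).
    - apply Rmult_le_compat_r; [lra | apply Rmin_r].
    - right. field. lra. }
  assert (L1 : r <= r1) by (eapply Rle_trans; [apply Rmin_l | apply Rmin_l]).
  assert (L2 : r <= r2) by (eapply Rle_trans; [apply Rmin_l | apply Rmin_r]).
  assert (Su : forall K, psum K r (maj u) <= s).
  { intro K. eapply Rle_trans; [apply B1; lra|]. rewrite pow_1. nra. }
  assert (Sv : forall K, psum K r (maj v) <= s).
  { intro K. eapply Rle_trans; [apply B2; lra|]. rewrite pow_1. nra. }
  split.
  - exists r, M. split; [exact Hr|]. intro K.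
    eapply Rle_trans; [|apply (HM K)]. apply psum_maj_compose2; auto; lra.
  - apply (near0_mono (polydisc r)); [|apply near0_polydisc, Hr]. intros p Hp.
    assert (Bu : bounded_on u r) by (eexists; exact Su).
    assert (Bv : bounded_on v r) by (eexists; exact Sv).
    assert (Hq : polydisc s (val u p, val v p)).
    { split; [apply (val_le u r) | apply (val_le v r)]; assumption. }
    assert (Hf : bounded_on f s) by (exists M; exact HM).
    apply (climit_unique (fun n => csum n (hom f (val u p, val v p)))).
    2: { apply (val_limit f s); assumption. }
    pose proof (val_lsum (compose2_term f u v) (fun k => maj f k * s ^ k) r p M
      (Rlt_le _ _ Hr) Hp (fun k => compose2_term_ord f u v k u0 v0)) as L.
    assert (L' := L (fun K k => psum_maj_compose2_term K r f u v s k (Rlt_le _ _ Hr) (Su K) (Sv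
      K))
      (fun K => Rle_trans _ _ _ (Req_le _ _ (psum_1 K s (maj f))) (HM K))).
    clear L. intros eps He. destruct (L' eps He) as [N HN]. exists N. intros n Hn.
    specialize (HN n Hn).
    rewrite (csum_ext n (hom f (val u p, val v p)) (fun k => val (compose2_term f u v k) p));
      [exact HN|].
    intro k. symmetry.
    assert (Bt : forall c i j, bounded_on (cst c * (rpow u i * rpow v j))%S r /\
      val (cst c * (rpow u i * rpow v j))%S p = (c * (val u p ^ i * val v p ^ j))%C).
    { intros c i j. destruct (val_rpow_on u r p i Bu Hp) as [X1 X2].
      destruct (val_rpow_on v r p j Bv Hp) as [Y1 Y2].
      pose proof (bounded_on_cst c r) as Bc.
      assert (Bm : bounded_on (rpow u i * rpow v j)%S r) by (apply bounded_on_mul; auto; lra).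
      split; [apply bounded_on_mul; auto; lra|].
      rewrite (val_mul_on _ _ r p Bc Bm Hp), (val_mul_on _ _ r p X1 Y1 Hp).
      rewrite val_cst, X2, Y2. reflexivity. }
    unfold compose2_term, hom. cbn [fst snd].
    assert (gen : forall m (g : S2) (h : nat -> nat -> S2),
      (forall i j, bounded_on (h i j) r /\ val (h i j) p = g i j) ->
      bounded_on (diag (A := S2) h m) r /\
      val (diag (A := S2) h m) p = diag (A := Crng) g m).
    { induction m as [|m IH]; intros g h H.
      - destruct (H O O) as [H1 H2].
        change (bounded_on (h O O + 0)%S r /\ val (h O O + 0)%S p = (g O O + 0)%C).
        replace (h O O + 0)%S with (h O O) by ring. rewrite H2. split; [exact H1 | cring].
      - destruct (H O (S m)) as [H1 H2].
        destruct (IH (tail g) (tail h) (fun i j => H (S i) j)) as [H3 H4].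
        change (bounded_on (h O (S m) + diag (A := S2) (tail h) m)%S r /\
          val (h O (S m) + diag (A := S2) (tail h) m)%S p
          = (g O (S m) + diag (A := Crng) (tail g) m)%C).
        split; [apply bounded_on_add; auto; lra|].
        rewrite (val_add_on _ _ r p H1 H3 Hp), H2, H4. reflexivity. }
    apply (gen k (scale (val u p) (val v p) f)). intros i j. apply Bt.
Qed.

Lemma compose2_linear_part f u v : ord u 1 -> ord v 1 ->
  ord (compose2 f u v - (cst (f O O) + cst (f 1%nat O) * u + cst (f O 1%nat) * v))%S 2.
Proof.
  intros Hu Hv.
  replace (cst (f O O) + cst (f 1%nat O) * u + cst (f O 1%nat) * v)%S with
    (ssum 1 (compose2_term f u v)).
  - apply lsum_ssum. intro k. apply compose2_term_ord; assumption.
  - change ((cst (f O O) * (1 * 1) + 0) + (cst (f O 1%nat) * (1 * (v * 1))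
      + (cst (f 1%nat O) * ((u * 1) * 1) + 0))
      = cst (f O O) + cst (f 1%nat O) * u + cst (f O 1%nat) * v)%S. ring.
Qed.

Lemma rpow_monomial_sub_ord u v u' v' n j : forall i, ord u 1 -> ord v 1 -> ord u' 1 -> ord v'
  1 ->
  ord (u - u')%S n -> ord (v - v')%S n ->
  ord (rpow u i * rpow v j - rpow u' i * rpow v' j)%S (n + (i + j) - 1).
Proof.
  intros i Hu Hv Hu' Hv' Du Dv. induction i as [|i IH].
  - induction j as [|j IHj].
    + replace (rpow u 0 * rpow v 0 - rpow u' 0 * rpow v' 0)%S with (0%S : S2)
        by (change (0 = 1 * 1 - 1 * 1 :> S2)%S; ring). apply ord_zero.
    + replace (rpow u 0 * rpow v (S j) - rpow u' 0 * rpow v' (S j))%S with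
        (v * (rpow u 0 * rpow v j - rpow u' 0 * rpow v' j) + (v - v') * (rpow u' 0 * rpow v' j))%S
        by (change (rpow v (S j)) with (v * rpow v j)%S;
            change (rpow v' (S j)) with (v' * rpow v' j)%S; ring).
      apply ord_add.
      * apply ord_weaken with (1 + (n + (0 + j) - 1))%nat; [lia|]. apply ord_mul; assumption.
      * apply ord_weaken with (n + (0 + j))%nat; [lia|].
        apply ord_mul; [assumption | apply monomial_ord; assumption].
  - replace (rpow u (S i) * rpow v j - rpow u' (S i) * rpow v' j)%S with
      (u * (rpow u i * rpow v j - rpow u' i * rpow v' j) + (u - u') * (rpow u' i * rpow v' j))%S
      by (change (rpow u (S i)) with (u * rpow u i)%S;
          change (rpow u' (S i)) with (u' * rpow u' i)%S; ring).
    apply ord_add.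
    + apply ord_weaken with (1 + (n + (i + j) - 1))%nat; [lia|]. apply ord_mul; assumption.
    + apply ord_weaken with (n + (i + j))%nat; [lia|].
      apply ord_mul; [assumption | apply monomial_ord; assumption].
Qed.

Lemma compose2_contraction f u v u' v' n : ord f 2 ->
  ord u 1 -> ord v 1 -> ord u' 1 -> ord v' 1 ->
  ord (u - u')%S n -> ord (v - v')%S n ->
  ord (compose2 f u v - compose2 f u' v')%S (S n).
Proof.
  intros Hf Hu Hv Hu' Hv' Du Dv.
  assert (T : forall k, ord (compose2_term f u v k - compose2_term f u' v' k)%S (S n)).
  { intro k.
    set (g := fun i j => (cst (f i j) * (rpow u i * rpow v j - rpow u' i * rpow v' j))%S).
    assert (E : (compose2_term f u v k - compose2_term f u' v' k)%S = diag (A := S2) g k).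
    { assert (E1 : compose2_term f u v k = (diag (A := S2) g k + compose2_term f u' v' k)%S).
      { unfold compose2_term. rewrite <- (diag_add (A := S2)). apply diag_ext.
        intros i j _. unfold g. ring. }
      rewrite E1. ring. }
    rewrite E. apply diag_ord. intros i j Eij. unfold g.
    destruct (Nat.lt_ge_cases (i + j) 2) as [L|L].
    - rewrite (Hf i j L), cst_0. apply ord_mul_l, ord_zero.
    - apply ord_mul_r, ord_weaken with (n + (i + j) - 1)%nat; [lia|].
      apply rpow_monomial_sub_ord; assumption. }
  assert (S' : forall m, ord (ssum m (compose2_term f u v)
    - ssum m (compose2_term f u' v'))%S (S n)).
  { induction m as [|m IH]; [apply T|].
    change (ssum (S m) (compose2_term f u v)) with
      (ssum m (compose2_term f u v) + compose2_term f u v (S m))%S.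
    change (ssum (S m) (compose2_term f u' v')) with
      (ssum m (compose2_term f u' v') + compose2_term f u' v' (S m))%S.
    replace (ssum m (compose2_term f u v) + compose2_term f u v (S m)
      - (ssum m (compose2_term f u' v') + compose2_term f u' v' (S m)))%S with
      ((ssum m (compose2_term f u v) - ssum m (compose2_term f u' v'))
       + (compose2_term f u v (S m) - compose2_term f u' v' (S m)))%S by ring.
    apply ord_add; [exact IH | apply T]. }
  intros i j L. exact (S' (i + j)%nat i j L).
Qed.

(** ** The inverse function theorem, for maps tangent to the identity *)

(** With [X = x + f], [W = y + g], the inverse is the fixed point of
    [u = x - f(u, v)], [v = y - g(u, v)]. It contracts as [f], [g] start in degree 2,
    and for the same reason the sum [s] of the norms of [u] and [v] satisfies
    [s <= 2 r + M s ^ 2]. *)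
Lemma conv_right_inverse (X W : S2) : conv X -> conv W ->
  ord (X - varx)%S 2 -> ord (W - vary)%S 2 ->
  exists u v : S2, conv u /\ conv v /\ ord (u - varx)%S 2 /\ ord (v - vary)%S 2 /\
    near0 (fun p => (val X (val u p, val v p), val W (val u p, val v p)) = p).
Proof.
  intros HX HW OX OW. set (f := (X - varx)%S) in *. set (g := (W - vary)%S) in *.
  assert (Hf : conv f) by (apply conv_sub; [assumption | apply conv_varx]).
  assert (Hg : conv g) by (apply conv_sub; [assumption | apply conv_vary]).
  assert (comp_ord : forall h u v, ord h 2 -> ord u 1 -> ord v 1 -> ord (compose2 h u v) 2).
  { intros h u v Hh Hu Hv.
    replace (compose2 h u v) with (compose2 h u v
      - (cst (h O O) + cst (h 1%nat O) * u + cst (h O 1%nat) * v))%S;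
      [apply compose2_linear_part; assumption|].
    rewrite (Hh O O), (Hh 1%nat O), (Hh O 1%nat), cst_0 by lia. ring. }
  destruct (contraction_fixpoint_pair 1 (fun U =>
    ((varx - compose2 f (fst U) (snd U))%S, (vary - compose2 g (fst U) (snd U))%S)))
    as [[u v] [[Ou Ov] E]].
  { intros [u v] [Hu Hv]. cbn [fst snd] in *. split; cbn [fst snd];
      (apply ord_sub; [apply ord_varx || apply ord_vary|];
       apply ord_weaken with 2%nat; [lia | apply comp_ord; assumption]). }
  { intros [u v] [u' v'] n [Hu Hv] [Hu' Hv'] [Du Dv]. unfold sub_pair in *.
    cbn [fst snd] in *. split; cbn [fst snd].
    - replace (varx - compose2 f u v - (varx - compose2 f u' v'))%S with
        (- (compose2 f u v - compose2 f u' v'))%S by ring.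
      apply ord_opp, compose2_contraction; assumption.
    - replace (vary - compose2 g u v - (vary - compose2 g u' v'))%S with
        (- (compose2 g u v - compose2 g u' v'))%S by ring.
      apply ord_opp, compose2_contraction; assumption. }
  cbn [fst snd] in *.
  assert (Eu : (varx - compose2 f u v)%S = u) by (apply (f_equal fst) in E; exact E).
  assert (Ev : (vary - compose2 g u v)%S = v) by (apply (f_equal snd) in E; exact E).
  clear E.
  destruct (conv_ord f 2 Hf OX) as [r1 [M1 [R1 [P1 B1]]]].
  destruct (conv_ord g 2 Hg OW) as [r2 [M2 [R2 [P2 B2]]]].
  set (M := M1 + M2 + 1).
  set (rho := Rmin (Rmin r1 r2) (/ (4 * M))).
  assert (HM : 1 <= M) by (unfold M; lra).
  assert (Hrho : 0 < rho).
  { repeat apply Rmin_glb_lt; try assumption. apply Rinv_0_lt_compat; lra. }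
  assert (L1 : rho <= r1) by (eapply Rle_trans; [apply Rmin_l | apply Rmin_l]).
  assert (L2 : rho <= r2) by (eapply Rle_trans; [apply Rmin_l | apply Rmin_r]).
  assert (L3 : rho * (4 * M) <= 1).
  { apply Rle_trans with (/ (4 * M) * (4 * M)).
    - apply Rmult_le_compat_r; [lra | apply Rmin_r].
    - right. field. lra. }
  set (w := fun n => maj u n + maj v n).
  assert (w_pos : forall n, 0 <= w n).
  { intro n. unfold w. pose proof (maj_pos u n). pose proof (maj_pos v n). lra. }
  assert (main : forall K, psum K (rho / 5) w <= rho).
  { intro K. apply psum_bootstrap; [lra | |].
    { unfold w. rewrite (maj_ord u 1), (maj_ord v 1) by (assumption || lia). lra. }
    intros r Hr Hs. set (s := psum K r w) in *.
    assert (Es : s = psum K r (maj u) + psum K r (maj v)) by apply psum_plus.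
    assert (U0 : 0 <= psum K r (maj u)) by (apply psum_pos; auto; lra).
    assert (V0 : 0 <= psum K r (maj v)) by (apply psum_pos; auto; lra).
    assert (Cf : psum K r (maj (compose2 f u v)) <= M1 * s ^ 2).
    { eapply Rle_trans; [apply (psum_maj_compose2 K r f u v s); auto; lra|]. apply B1; lra. }
    assert (Cg : psum K r (maj (compose2 g u v)) <= M2 * s ^ 2).
    { eapply Rle_trans; [apply (psum_maj_compose2 K r g u v s); auto; lra|]. apply B2; lra. }
    assert (Hu : psum K r (maj u) <= r + M1 * s ^ 2).
    { rewrite <- Eu at 1. eapply Rle_trans; [apply psum_maj_sub; lra|].
      pose proof (psum_maj_varx K r (proj1 Hr)). lra. }
    assert (Hv : psum K r (maj v) <= r + M2 * s ^ 2).
    { rewrite <- Ev at 1. eapply Rle_trans; [apply psum_maj_sub; lra|].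
      pose proof (psum_maj_vary K r (proj1 Hr)). lra. }
    assert (Hs2 : s <= 2 * r + M * s ^ 2).
    { rewrite Es at 1. unfold M. assert (0 <= s ^ 2) by (apply pow2_ge_0). nra. }
    assert (s0 : 0 <= s) by lra.
    assert (sM : M * s ^ 2 <= s / 4).
    { replace (M * s ^ 2) with (M * s * s) by ring.
      replace (s / 4) with (/ 4 * s) by field.
      apply Rmult_le_compat_r; [exact s0|]. nra. }
    lra. }
  assert (Cu : conv u).
  { exists (rho / 5), rho. split; [lra|]. intro K. eapply Rle_trans; [|apply (main K)].
    apply psum_le; [lra|]. intros n _. unfold w. pose proof (maj_pos v n). lra. }
  assert (Cv : conv v).
  { exists (rho / 5), rho. split; [lra|]. intro K. eapply Rle_trans; [|apply (main K)].
    apply psum_le; [lra|]. intros n _. unfold w. pose proof (maj_pos u n). lra. }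
  exists u, v. split; [exact Cu|]. split; [exact Cv|].
  split.
  { rewrite <- Eu at 1. replace (varx - compose2 f u v
    - varx)%S with (- compose2 f u v)%S by ring.
    apply ord_opp, comp_ord; assumption. }
  split.
  { rewrite <- Ev at 1. replace (vary - compose2 g u v
    - vary)%S with (- compose2 g u v)%S by ring.
    apply ord_opp, comp_ord; assumption. }
  assert (u0 : u O O = RtoC 0) by (apply Ou; lia).
  assert (v0 : v O O = RtoC 0) by (apply Ov; lia).
  destruct (conv_compose2 X u v HX Cu Cv u0 v0) as [CX VX].
  destruct (conv_compose2 W u v HW Cu Cv u0 v0) as [CW VW].
  destruct (conv_compose2 f u v Hf Cu Cv u0 v0) as [Cf Vf].
  destruct (conv_compose2 g u v Hg Cu Cv u0 v0) as [Cg Vg].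
  near (near0_comp u v _ Cu Cv u0 v0 (val_sub X varx HX conv_varx)).
  2: near (near0_comp u v _ Cu Cv u0 v0 (val_sub W vary HW conv_vary)).
  3: near Vf. 4: near Vg.
  5: near (val_sub varx (compose2 f u v) conv_varx Cf).
  6: exact (val_sub vary (compose2 g u v) conv_vary Cg).
  2-5: intros p HH; exact HH.
  intros p [H1 [H2 [H3 [H4 [H5 H6]]]]]. fold f in H1. fold g in H2.
  rewrite Eu, val_varx, H3, H1, val_varx in H5.
  rewrite Ev, val_vary, H4, H2, val_vary in H6. cbn [fst snd] in H5, H6.
  destruct p as [x y]. cbn [fst snd] in *. f_equal.
  - set (a := val X _) in *. set (b := val u _) in *. clearbody a b.
    replace a with (b + (a - b))%C by ring. rewrite H5 at 1. ring.
  - set (a := val W _) in *. set (b := val v _) in *. clearbody a b.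
    replace a with (b + (a - b))%C by ring. rewrite H6 at 1. ring.
Qed.

(** ** Holomorphic germs are convergent series *)

Lemma csum_diag k : forall g : nat -> nat -> C,
  csum k (fun i => g i (k - i)%nat) = diag (A := Crng) g k.
Proof.
  induction k as [|k IH]; intro g.
  - change (g O O = g O O + 0)%C. ring.
  - change (g O (S k) + csum k (fun i => tail g i (k - i)%nat)
      = g O (S k) + diag (A := Crng) (tail g) k)%C. rewrite IH. reflexivity.
Qed.

Lemma psum_diag k : forall g : nat -> nat -> R,
  psum k 1 (fun i => g i (k - i)%nat) = diag (A := Rrng) g k.
Proof.
  induction k as [|k IH]; intro g.
  - change (g O O = g O O + 0). ring.
  - change (g O (S k) + 1 * psum k 1 (fun i => tail g i (k - i)%nat)
      = g O (S k) + diag (A := Rrng) (tail g) k). rewrite IH. ring.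
Qed.

Lemma sum_n_hom (a : S2) p k :
  sum_n (fun i => (a i (k - i)%nat * fst p ^ i * snd p ^ (k - i))%C) k = hom a p k.
Proof.
  rewrite csum_sum_n.
  transitivity (csum k (fun i => scale (fst p) (snd p) a i (k - i)%nat)).
  - apply csum_ext. intro i. unfold scale. cring.
  - apply csum_diag.
Qed.

Lemma sum_n_hom_abs (a : S2) p k :
  sum_n (fun i => Cmod (a i (k - i)%nat * fst p ^ i * snd p ^ (k - i))%C) k
  = diag (A := Rrng) (fun i j => Cmod (scale (fst p) (snd p) a i j)) k.
Proof.
  rewrite sum_n_psum, <- psum_diag. f_equal.
  apply functional_extensionality; intro i. f_equal. unfold scale. cring.
Qed.

Lemma holomorphic_germ_of_conv a f : conv a -> near0 (fun p => f p = val a p) ->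
  holomorphic_germ f.
Proof.
  intros [r [M [Hr HM]]] Hf. exists a.
  near Hf. 2: exact (near0_polydisc r Hr).
  intros p [E Hp]. split.
  - apply (bounded_ex_series _ M).
    + intro n. rewrite sum_n_hom_abs. apply Rle_trans with (Cmod (hom a p n));
        [apply Cmod_ge_0 | apply Cmod_diag].
    + intro K. eapply Rle_trans; [|apply (HM K)]. rewrite <- (psum_1 K r).
      apply psum_le; [lra|]. intros n _. rewrite sum_n_hom_abs.
      destruct Hp as [Hx Hy]. rewrite Rmult_comm. unfold maj. rewrite <- diag_rscal.
      apply diag_le. intros i j Eij. unfold scale. rewrite !Cmod_mult, Rmult_comm.
      apply Rmult_le_compat_r; [apply Cmod_ge_0|]. rewrite <- Eij, pow_add.
      apply Rmult_le_compat; auto using Cmod_ge_0, Cmod_pow_le.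
  - apply is_series_climit. rewrite E.
    pose proof (val_limit a r p ltac:(exists M; exact HM) Hp) as L.
    intros eps He. destruct (L eps He) as [N HN]. exists N. intros n Hn.
    rewrite (csum_ext n _ (hom a p)); [apply HN, Hn|].
    intro k. apply sum_n_hom.
Qed.

(** The series converges absolutely at a point [(s, s)] with [s > 0], which bounds
    the majorant for the radius [s]. *)
Lemma holomorphic_germ_conv f : holomorphic_germ f ->
  exists a : S2, conv a /\ near0 (fun p => f p = val a p).
Proof.
  intros [a Ha]. exists a. pose proof Ha as [r [Hr H]].
  set (s := r / 2). assert (Hs : 0 < s) by (unfold s; lra).
  assert (Cs : Cmod (RtoC s) = s) by (rewrite Cmod_R; apply Rabs_pos_eq; lra).
  assert (Hc : bounded_on a s).
  { destruct (H (RtoC s) (RtoC s)) as [[l Hl] _]; try (rewrite Cs; unfold s; lra).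
    exists l. intro K.
    assert (E : psum K s (maj a) = sum_n (fun k => sum_n (fun i =>
      Cmod (a i (k - i)%nat * RtoC s ^ i * RtoC s ^ (k - i))%C) k) K).
    { rewrite <- psum_sum_n. apply sum_n_ext. intro k.
      etransitivity; [|symmetry; exact (sum_n_hom_abs a (RtoC s, RtoC s) k)].
      rewrite Rmult_comm.
      unfold maj. rewrite <- diag_rscal. apply diag_ext. intros i j Eij.
      unfold scale. cbn [fst snd]. rewrite !Cmod_mult, !Cmod_pow_R by lra.
      rewrite <- Eij, pow_add. change (s ^ i * s ^ j * Cmod (a i j)
        = Cmod (a i j) * (s ^ i * s ^ j)). ring. }
    rewrite E.
    apply (is_lim_seq_incr_compare (sum_n (fun k => sum_n (fun i =>
      Cmod (a i (k - i)%nat * RtoC s ^ i * RtoC s ^ (k - i))%C) k)) l); [exact Hl|].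
    intro n. rewrite (sum_Sn _ n).
    assert (P : 0 <= sum_n (fun i =>
      Cmod (a i (S n - i)%nat * RtoC s ^ i * RtoC s ^ (S n - i))%C) (S n)).
    { rewrite sum_n_psum. apply psum_pos; [lra | intro; apply Cmod_ge_0]. }
    unfold plus; simpl (AbelianMonoid.plus _ _ _). cbn in P |- *. lra. }
  split; [destruct Hc as [M HM]; exists s, M; split; assumption|].
  near (near0_polydisc s Hs).
  2: exact Ha.
  intros p [Hp [_ HS]]. symmetry. apply (val_unique a s); [exact Hc | exact Hp|].
  apply is_series_climit in HS.
  intros eps He. destruct (HS eps He) as [N HN]. exists N. intros n Hn.
  rewrite (csum_ext n (hom a p) (fun k => sum_n (fun i =>
    (a i (k - i)%nat * fst p ^ i * snd p ^ (k - i))%C) k)); [apply HN, Hn|].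
  intro k. symmetry. apply sum_n_hom.
Qed.

Open Scope C_scope.

(** * Convergence of the normalizing coordinates *)

Lemma rpow_mul (f g : S2) n : rpow (f * g)%S n = (rpow f n * rpow g n)%S.
Proof.
  induction n as [|n IH]; [change (1 = 1 * 1 :> S2)%S; ring|].
  change (rpow (f * g)%S (S n)) with (f * g * rpow (f * g)%S n)%S.
  rewrite IH. change (rpow f (S n)) with (f * rpow f n)%S.
  change (rpow g (S n)) with (g * rpow g n)%S. ring.
Qed.

Lemma rpow_coef_00 (f : S2) n : f O O = RtoC 1 -> (rpow f n : S2) O O = RtoC 1.
Proof.
  intro H. induction n as [|n IH]; [reflexivity|].
  change (rpow f (S n)) with (f * rpow f n)%S. rewrite mul_coef_00, H, IH. cring.
Qed.

Lemma flip_vder V1 V2 f : flip (vder V1 V2 f) = vder (flip V2) (flip V1) (flip f).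
Proof.
  unfold vder. transitivity (flip (V1 * dx f)%S + flip (V2 * dy f)%S)%S; [reflexivity|].
  rewrite !flip_mul, flip_dx, flip_dy. ring.
Qed.

Lemma flip_cst c : flip (cst c) = cst c.
Proof. apply S2_ext; intros [|i] [|j]; reflexivity. Qed.

Lemma flip_vary : flip vary = varx.
Proof. rewrite <- flip_varx. reflexivity. Qed.

Lemma separatrix_y (l1 l2 : C) (z1 z2 : S2) (kappa : R) :
  conv z1 -> conv z2 ->
  ord (z1 - cst l1 * varx)%S 2 -> ord (z2 - cst l2 * vary)%S 2 ->
  (0 < kappa)%R ->
  (forall j, kappa * INR j <= Cmod (INR j * l1 - l2))%R ->
  exists eta b : S2, conv eta /\ conv b /\ ord (eta - vary)%S 2 /\
    b O O = l2 /\ vder z1 z2 eta = (b * eta)%S.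
Proof.
  intros H1 H2 O1 O2 Hk Hgap.
  destruct (separatrix l2 l1 (flip z2) (flip z1) kappa) as [xi [a [C1 [C2 [Ox [A0 E]]]]]];
    try (apply conv_flip; assumption); try assumption.
  - apply flip_ord in O2.
    replace (flip z2 - cst l2 * varx)%S with (flip (z2 - cst l2 * vary)%S); [exact O2|].
    transitivity (flip z2 - flip (cst l2 * vary)%S)%S; [reflexivity|].
    rewrite flip_mul, flip_cst, flip_vary. reflexivity.
  - apply flip_ord in O1.
    replace (flip z1 - cst l1 * vary)%S with (flip (z1 - cst l1 * varx)%S); [exact O1|].
    transitivity (flip z1 - flip (cst l1 * varx)%S)%S; [reflexivity|].
    rewrite flip_mul, flip_cst, flip_varx. reflexivity.
  - exists (flip xi), (flip a).
    split; [apply conv_flip, C1|]. split; [apply conv_flip, C2|].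
    split; [apply flip_ord in Ox; rewrite <- flip_varx; exact Ox|].
    split; [exact A0|].
    apply (f_equal flip) in E. rewrite flip_vder, flip_mul in E. exact E.
Qed.

Lemma from_near_x (X : S2) : ord (X - varx)%S 2 -> from X 1 0 /\ X 1%nat O = RtoC 1.
Proof.
  intro H.
  assert (E : forall a b, (a + b < 2)%nat -> X a b = varx a b).
  { intros a b L. specialize (H a b L). rewrite sub_coef in H.
    transitivity ((X a b - varx a b) + varx a b)%C; [cring|]. rewrite H. cring. }
  split; [|apply E; lia].
  intros a b Hab. unfold mono_le.
  destruct (Nat.lt_ge_cases (a + b) 2) as [L|L]; [|lia].
  rewrite E in Hab by exact L.
  destruct a as [|[|a]], b as [|[|b]]; try lia; exfalso; apply Hab; reflexivity.
Qed.

Lemma from_near_y (W : S2) : ord (W - vary)%S 2 -> from W 0 1 /\ W O 1%nat = RtoC 1.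
Proof.
  intro H.
  assert (E : forall a b, (a + b < 2)%nat -> W a b = vary a b).
  { intros a b L. specialize (H a b L). rewrite sub_coef in H.
    transitivity ((W a b - vary a b) + vary a b)%C; [cring|]. rewrite H. cring. }
  split; [|apply E; lia].
  intros a b Hab. unfold mono_le.
  destruct (Nat.lt_ge_cases (a + b) 2) as [L|L]; [|lia].
  rewrite E in Hab by exact L.
  destruct a as [|[|a]], b as [|[|b]]; try lia; exfalso; apply Hab; reflexivity.
Qed.

Definition jacobian (X W : S2) : S2 := (dx X * dy W - dy X * dx W)%S.

Lemma dx_near_x (X : S2) : ord (X - varx)%S 2 -> ord (dx X - 1)%S 1 /\ ord (dy X) 1.
Proof.
  intro H. split.
  - replace (dx X - 1)%S with (dx (X - varx)%S); [apply ord_dx, H|].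
    rewrite <- dx_varx. pose proof (vder_sub 1%S 0%S X varx) as E. unfold vder in E.
    replace (dx (X - varx)%S) with (1 * dx (X - varx) + 0 * dy (X - varx))%S by ring.
    rewrite E. ring.
  - replace (dy X) with (dy (X - varx)%S); [apply ord_dy, H|].
    pose proof (vder_sub 0%S 1%S X varx) as E. unfold vder in E. rewrite dy_varx in E.
    replace (dy (X - varx)%S) with (0 * dx (X - varx) + 1 * dy (X - varx))%S by ring.
    rewrite E. ring.
Qed.

Lemma dy_near_y (W : S2) : ord (W - vary)%S 2 -> ord (dy W - 1)%S 1 /\ ord (dx W) 1.
Proof.
  intro H. destruct (dx_near_x (flip W)) as [H1 H2].
  - rewrite <- flip_vary. apply flip_ord in H. exact H.
  - rewrite <- flip_dy in H1. rewrite <- flip_dx in H2.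
    apply flip_ord in H1. apply flip_ord in H2. split; [|exact H2].
    replace (dy W - 1)%S with (flip (flip (dy W) - 1)%S); [exact H1|].
    apply S2_ext; intros i j. unfold flip. rewrite !sub_coef.
    change (1%S : S2) with (cst (RtoC 1)). rewrite !cst_coef. destruct i, j; reflexivity.
Qed.

Lemma coef_00_of_ord f c : ord (f - cst c)%S 1 -> f O O = c.
Proof.
  intro H. specialize (H O O (Nat.lt_0_1)). rewrite sub_coef, cst_coef in H.
  transitivity ((f O O - c) + c)%C; [cring|]. rewrite H. cring.
Qed.

Lemma jacobian_00 X W : ord (X - varx)%S 2 -> ord (W - vary)%S 2 ->
  jacobian X W O O = RtoC 1.
Proof.
  intros HX HW. destruct (dx_near_x X HX) as [H1 H2]. destruct (dy_near_y W HW) as [H3 H4].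
  unfold jacobian. rewrite sub_coef, !mul_coef_00.
  rewrite (coef_00_of_ord _ _ H1), (coef_00_of_ord _ _ H3), (H2 O O), (H4 O O) by lia.
  cring.
Qed.

Lemma neq_0_of_coef (f : S2) i j c : f i j = c -> c <> RtoC 0 -> f <> 0%S.
Proof. intros H Hc E. apply Hc. rewrite <- H, E. reflexivity. Qed.

Lemma jacobian_vder z1 z2 A B X W :
  (vder z1 z2 X * vder A B W - vder z1 z2 W * vder A B X)%S
  = ((z1 * B - z2 * A) * jacobian X W)%S.
Proof. unfold vder, jacobian. ring. Qed.

Section NormalForm.
Variables (l1 l2 delta : C) (z1 z2 A B H : S2).
Hypotheses (conv_z1 : conv z1) (conv_z2 : conv z2).
Hypotheses (conv_A : conv A) (conv_B : conv B) (conv_H : conv H).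
Hypothesis z1_lin : ord (z1 - cst l1 * varx)%S 2.
Hypothesis z2_lin : ord (z2 - cst l2 * vary)%S 2.
Hypothesis nonresonant : forall n m : BinInt.Z,
  IZR n * l1 + IZR m * l2 = 0 -> n = 0%Z /\ m = 0%Z.
Hypothesis H_neq_0 : H <> 0%S.
Hypothesis non_degenerate_series : (z1 * B - z2 * A)%S <> 0%S.
(* [Z, Y] = delta Y for Y = (A / H, B / H), multiplied by [H ^ 2] *)
Hypothesis bracket_1 :
  (vder z1 z2 A * H - A * vder z1 z2 H - H * vder A B z1)%S = (cst delta * (A * H))%S.
Hypothesis bracket_2 :
  (vder z1 z2 B * H - B * vder z1 z2 H - H * vder A B z2)%S = (cst delta * (B * H))%S.

Let Zd := vder z1 z2.
Let Yd := vder A B.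

Lemma bracket_act f : (H * (Zd (Yd f) - Yd (Zd f)))%S = ((Zd H + cst delta * H) * Yd f)%S.
Proof.
  unfold Zd, Yd. rewrite vder_lie. unfold vder at 1.
  replace (H * ((vder z1 z2 A - vder A B z1) * dx f + (vder z1 z2 B - vder A B z2) * dy f))%S
    with ((vder z1 z2 A * H - A * vder z1 z2 H - H * vder A B z1) * dx f
      + (vder z1 z2 B * H - B * vder z1 z2 H - H * vder A B z2) * dy f
      + vder z1 z2 H * (A * dx f + B * dy f))%S by ring.
  rewrite bracket_1, bracket_2. unfold vder at 3. ring.
Qed.

Lemma eigen_quotient X l : Zd X = (cst l * X)%S ->
  (Zd (Yd X) * (H * X) - Yd X * Zd (H * X))%S = (cst delta * (Yd X * (H * X)))%S.
Proof.
  intro E. pose proof (bracket_act X) as R.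
  rewrite E in R.
  assert (Y1 : Yd (cst l * X)%S = (cst l * Yd X)%S) by apply vder_cst_mul. rewrite Y1 in R.
  assert (Z1 : Zd (H * X)%S = (Zd H * X + H * Zd X)%S) by apply vder_mul.
  rewrite Z1, E.
  replace (Zd (Yd X) * (H * X) - Yd X * (Zd H * X + H * (cst l * X)))%S with
    (X * (H * (Zd (Yd X) - cst l * Yd X)) - Yd X * Zd H * X)%S by ring.
  rewrite R. ring.
Qed.

(** The quotients [Y X / X] and [Y W / W] are eigenfunctions for the same
    eigenvalue [delta], whence the same exponents [n], [m] for both; at least one
    of them is not 0, as [Z] and [Y] are independent. The determinant of [Z] and [Y]
    in the new coordinates gives the condition on [d], [c]. *)
Lemma monomial_form X W :
  ord (X - varx)%S 2 -> ord (W - vary)%S 2 ->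
  Zd X = (cst l1 * X)%S -> Zd W = (cst l2 * W)%S ->
  exists (n m : BinInt.Z) (d c : C), delta = IZR n * l1 + IZR m * l2 /\
    l1 * c - l2 * d <> RtoC 0 /\
    (Yd X * monomial X W (Z.to_nat (- n)) (Z.to_nat (- m)))%S
      = (cst d * (H * X * monomial X W (Z.to_nat n) (Z.to_nat m)))%S /\
    (Yd W * monomial X W (Z.to_nat (- n)) (Z.to_nat (- m)))%S
      = (cst c * (H * W * monomial X W (Z.to_nat n) (Z.to_nat m)))%S.
Proof.
  intros OX OW EX EW.
  destruct (from_near_x X OX) as [FX LX]. destruct (from_near_y W OW) as [FW LW].
  assert (J0 : jacobian X W <> 0%S).
  { apply (neq_0_of_coef _ O O (RtoC 1)); [apply jacobian_00; assumption | exact C1_nz]. }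
  assert (X0 : X <> 0%S) by (apply (neq_0_of_coef _ _ _ _ LX), C1_nz).
  assert (W0 : W <> 0%S) by (apply (neq_0_of_coef _ _ _ _ LW), C1_nz).
  pose proof (eigen_quotient X l1 EX) as QX. pose proof (eigen_quotient W l2 EW) as QW.
  assert (HX0 : (H * X)%S <> 0%S) by (apply mul_neq_0; assumption).
  assert (HW0 : (H * W)%S <> 0%S) by (apply mul_neq_0; assumption).
  assert (Hnm : exists n m : BinInt.Z, delta = IZR n * l1 + IZR m * l2).
  { destruct (classic (Yd X = 0%S)) as [E1|E1].
    - destruct (classic (Yd W = 0%S)) as [E2|E2].
      + exfalso. apply (mul_neq_0 _ _ non_degenerate_series J0).
        rewrite <- jacobian_vder. fold Yd. rewrite E1, E2. ring.
      + apply (quotient_weight_ex l1 l2 z1 z2 z1_lin z2_lin (Yd W) (H * W)%S); assumption.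
    - apply (quotient_weight_ex l1 l2 z1 z2 z1_lin z2_lin (Yd X) (H * X)%S); assumption. }
  destruct Hnm as [n [m Hd]]. exists n, m.
  assert (Hw : delta = weight l1 l2 (Z.to_nat n) (Z.to_nat m)
                       - weight l1 l2 (Z.to_nat (- n)) (Z.to_nat (- m))).
  { rewrite Hd. unfold weight. rewrite !INR_IZR_INZ.
    assert (E : forall k, RtoC (IZR k) = RtoC (IZR (Z.of_nat (Z.to_nat k)))
      - RtoC (IZR (Z.of_nat (Z.to_nat (- k))))).
    { intro k. rewrite <- RtoC_minus, <- minus_IZR. do 2 f_equal. lia. }
    rewrite (E n) at 1. rewrite (E m) at 1. ring. }
  destruct (quotient_monomial l1 l2 z1 z2 z1_lin z2_lin nonresonant X W LX LW EX EW
    (Yd X) (H * X)%S delta _ _ _ _ QX HX0 Hw) as [d Ed].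
  destruct (quotient_monomial l1 l2 z1 z2 z1_lin z2_lin nonresonant X W LX LW EX EW
    (Yd W) (H * W)%S delta _ _ _ _ QW HW0 Hw) as [c Ec].
  exists d, c. split; [exact Hd|]. split; [|split; assumption].
  intro E0.
  set (Mp := monomial X W (Z.to_nat n) (Z.to_nat m)) in *.
  set (Mm := monomial X W (Z.to_nat (- n)) (Z.to_nat (- m))) in *.
  assert (Mm0 : Mm <> 0%S) by (apply mul_neq_0; apply rpow_neq_0; assumption).
  apply (mul_neq_0 _ _ (mul_neq_0 _ _ non_degenerate_series J0) Mm0).
  rewrite <- jacobian_vder. fold Zd Yd. rewrite EX, EW.
  replace ((cst l1 * X * Yd W - cst l2 * W * Yd X) * Mm)%S with
    (cst l1 * X * (Yd W * Mm) - cst l2 * W * (Yd X * Mm))%S by ring.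
  rewrite Ed, Ec.
  replace (cst l1 * X * (cst c * (H * W * Mp)) - cst l2 * W * (cst d * (H * X * Mp)))%S
    with ((cst l1 * cst c - cst l2 * cst d) * (H * X * W * Mp))%S by ring.
  rewrite <- !cst_mul, <- cst_sub, E0, cst_0. ring.
Qed.

Variables kappa1 kappa2 : R.
Hypotheses (kappa1_pos : (0 < kappa1)%R) (kappa2_pos : (0 < kappa2)%R).
Hypothesis gap_1 : forall j, (kappa1 * INR j <= Cmod (INR j * l2 - l1))%R.
Hypothesis gap_2 : forall j, (kappa2 * INR j <= Cmod (INR j * l1 - l2))%R.

(** A formal normal form, with [X = xi F] and [W = eta G] where [xi], [eta] are the
    equations of the separatrices, in which [F] and [G] are shown to converge
    through an ordinary differential equation along [xi d/dxi + eta d/deta]. *)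
Theorem normal_form : exists (X W : S2) (n m : BinInt.Z) (d c : C),
  conv X /\ conv W /\ ord (X - varx)%S 2 /\ ord (W - vary)%S 2 /\
  Zd X = (cst l1 * X)%S /\ Zd W = (cst l2 * W)%S /\
  delta = IZR n * l1 + IZR m * l2 /\
  (Yd X * monomial X W (Z.to_nat (- n)) (Z.to_nat (- m)))%S
    = (cst d * (H * X * monomial X W (Z.to_nat n) (Z.to_nat m)))%S /\
  (Yd W * monomial X W (Z.to_nat (- n)) (Z.to_nat (- m)))%S
    = (cst c * (H * W * monomial X W (Z.to_nat n) (Z.to_nat m)))%S.
Proof.
  destruct (separatrix l1 l2 z1 z2 kappa1) as [xi [a [Cxi [Ca [Oxi [a0 Exi]]]]]];
    try assumption.
  destruct (separatrix_y l1 l2 z1 z2 kappa2) as [eta [b [Ceta [Cb [Oeta [b0 Eeta]]]]]];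
    try assumption.
  destruct (formal_eigenfunction l1 l2 z1 z2 z1_lin z2_lin nonresonant (cst l1 - a)%S)
    as [F [F0 EF]].
  { rewrite sub_coef, cst_coef, a0. apply Cplus_opp_r. }
  destruct (formal_eigenfunction l1 l2 z1 z2 z1_lin z2_lin nonresonant (cst l2 - b)%S)
    as [G [G0 EG]].
  { rewrite sub_coef, cst_coef, b0. apply Cplus_opp_r. }
  fold Zd in Exi, Eeta, EF, EG.
  assert (Z_mul : forall f g, Zd (f * g)%S = (Zd f * g + f * Zd g)%S)
    by (intros; apply vder_mul).
  assert (Y_mul : forall f g, Yd (f * g)%S = (Yd f * g + f * Yd g)%S)
    by (intros; apply vder_mul).
  set (X := (xi * F)%S). set (W := (eta * G)%S).
  assert (EX : Zd X = (cst l1 * X)%S).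
  { unfold X. rewrite Z_mul, Exi, EF. ring. }
  assert (EW : Zd W = (cst l2 * W)%S).
  { unfold W. rewrite Z_mul, Eeta, EG. ring. }
  assert (one_ord : forall f : S2, f O O = RtoC 1 -> ord (f - 1)%S 1).
  { intros f Hf. apply ord_1. rewrite sub_coef, Hf. apply Cplus_opp_r. }
  assert (OX : ord (X - varx)%S 2).
  { unfold X. replace (xi * F - varx)%S with ((xi - varx) * F + varx * (F - 1))%S by ring.
    apply ord_add; [apply ord_mul_l, Oxi | apply (ord_mul _ _ 1 1); [apply ord_varx | auto]]. }
  assert (OW : ord (W - vary)%S 2).
  { unfold W. replace (eta * G - vary)%S with ((eta - vary) * G + vary * (G - 1))%S by ring.
    apply ord_add; [apply ord_mul_l, Oeta | apply (ord_mul _ _ 1 1); [apply ord_vary | auto]]. }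
  destruct (monomial_form X W OX OW EX EW) as [n [m [d [c [Hdelta [Hdc [RX RW]]]]]]].
  set (n1 := Z.to_nat n) in *. set (n2 := Z.to_nat (- n)) in *.
  set (m1 := Z.to_nat m) in *. set (m2 := Z.to_nat (- m)) in *.
  assert (xi0 : xi <> 0%S).
  { apply (neq_0_of_coef _ 1 0 (RtoC 1)); [apply from_near_x, Oxi | exact C1_nz]. }
  assert (eta0 : eta <> 0%S).
  { apply (neq_0_of_coef _ 0 1 (RtoC 1)); [apply from_near_y, Oeta | exact C1_nz]. }
  (* the frame [E1 = xi d/dxi], [E2 = eta d/deta] *)
  set (j := jacobian xi eta).
  assert (j0 : j O O = RtoC 1) by (apply jacobian_00; assumption).
  destruct (unit_inverse j) as [k Hk]; [rewrite j0; exact C1_nz|].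
  assert (k0 : k O O = RtoC 1).
  { apply (f_equal (fun f : S2 => f O O)) in Hk. rewrite mul_coef_00, j0 in Hk.
    transitivity (RtoC 1 * k O O)%C; [cring | exact Hk]. }
  set (D1 := fun f => (k * xi * (dy eta * dx f - dx eta * dy f))%S).
  set (D2 := fun f => (k * eta * (dx xi * dy f - dy xi * dx f))%S).
  assert (frame : forall V1 V2 f, (xi * eta * vder V1 V2 f)%S =
    (vder V1 V2 xi * eta * D1 f + vder V1 V2 eta * xi * D2 f)%S).
  { intros V1 V2 f.
    replace (xi * eta * vder V1 V2 f)%S with (xi * eta * (j * k) * vder V1 V2 f)%S
      by (rewrite Hk; ring).
    unfold j, jacobian, D1, D2, vder. ring. }
  assert (Y_frame : forall f, (xi * eta * Yd f)%S =
    (Yd xi * eta * D1 f + Yd eta * xi * D2 f)%S) by (intro f; apply frame).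
  assert (Z_frame : forall f, Zd f = (a * D1 f + b * D2 f)%S).
  { intro f. apply (S2_cancel (xi * eta)%S); [apply mul_neq_0; assumption|].
    unfold Zd. rewrite frame. fold Zd. rewrite Exi, Eeta. ring. }
  set (f1 := (F + D1 F)%S). set (f2 := D2 F).
  set (g1 := D1 G). set (g2 := (G + D2 G)%S).
  assert (Za : (a * f1 + b * f2)%S = (cst l1 * F)%S).
  { unfold f1, f2. replace (a * (F + D1 F) + b * D2 F)%S with (a * F + Zd F)%S
      by (rewrite Z_frame; ring). rewrite EF. ring. }
  assert (Zb : (a * g1 + b * g2)%S = (cst l2 * G)%S).
  { unfold g1, g2. replace (a * D1 G + b * (G + D2 G))%S with (b * G + Zd G)%S
      by (rewrite Z_frame; ring). rewrite EG. ring. }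
  set (p1 := (eta * Yd xi)%S). set (q1 := (xi * Yd eta)%S).
  assert (Ya : (p1 * f1 + q1 * f2)%S = (eta * Yd X)%S).
  { unfold X. rewrite Y_mul.
    replace (eta * (Yd xi * F + xi * Yd F))%S with (eta * Yd xi * F + xi * eta * Yd F)%S by ring.
    rewrite Y_frame. unfold p1, q1, f1, f2. ring. }
  assert (Yb : (p1 * g1 + q1 * g2)%S = (xi * Yd W)%S).
  { unfold W. rewrite Y_mul.
    replace (xi * (Yd eta * G + eta * Yd G))%S with (xi * Yd eta * G + xi * eta * Yd G)%S by ring.
    rewrite Y_frame. unfold p1, q1, g1, g2. ring. }
  (* [D1 f] and [D2 f] vanish at the origin, because of the factors [xi] and [eta] *)
  assert (D1_00 : forall f, D1 f O O = RtoC 0).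
  { intro f. unfold D1. rewrite !mul_coef_00.
    destruct (from_near_x xi Oxi) as [Hx _].
    replace (xi O O) with (RtoC 0); [cring|]. symmetry. apply NNPP. intro HN.
    specialize (Hx _ _ HN). unfold mono_le in Hx. lia. }
  assert (D2_00 : forall f, D2 f O O = RtoC 0).
  { intro f. unfold D2. rewrite !mul_coef_00.
    destruct (from_near_y eta Oeta) as [Hx _].
    replace (eta O O) with (RtoC 0); [cring|]. symmetry. apply NNPP. intro HN.
    specialize (Hx _ _ HN). unfold mono_le in Hx. lia. }
  assert (f1_0 : f1 O O = RtoC 1) by (unfold f1; rewrite add_coef, F0, D1_00; cring).
  assert (f2_0 : f2 O O = RtoC 0) by apply D2_00.
  assert (g1_0 : g1 O O = RtoC 0) by apply D1_00.
  assert (g2_0 : g2 O O = RtoC 1) by (unfold g2; rewrite add_coef, G0, D2_00; cring).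
  set (t := (f1 * g2 - f2 * g1)%S).
  assert (t0 : t O O = RtoC 1).
  { unfold t. rewrite sub_coef, !mul_coef_00, f1_0, f2_0, g1_0, g2_0. cring. }
  destruct (unit_inverse t) as [tau Htau]; [rewrite t0; exact C1_nz|].
  assert (tau0 : tau O O = RtoC 1).
  { apply (f_equal (fun f : S2 => f O O)) in Htau. rewrite mul_coef_00, t0 in Htau.
    transitivity (RtoC 1 * tau O O)%C; [cring | exact Htau]. }
  (* the unit [e = F ^ n * G ^ m] *)
  set (ep := (rpow F n1 * rpow G m1 : S2)%S). set (em := (rpow F n2 * rpow G m2 : S2)%S).
  set (mp := (rpow xi n1 * rpow eta m1 : S2)%S). set (mm := (rpow xi n2 * rpow eta m2 : S2)%S).
  assert (Mp : monomial X W n1 m1 = (mp * ep)%S).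
  { unfold monomial, X, W, mp, ep. rewrite !rpow_mul. ring. }
  assert (Mm : monomial X W n2 m2 = (mm * em)%S).
  { unfold monomial, X, W, mm, em. rewrite !rpow_mul. ring. }
  assert (ep0 : ep O O = RtoC 1).
  { unfold ep. rewrite mul_coef_00, !rpow_coef_00 by assumption. cring. }
  assert (em0 : em O O = RtoC 1).
  { unfold em. rewrite mul_coef_00, !rpow_coef_00 by assumption. cring. }
  destruct (unit_inverse em) as [ie Hie]; [rewrite em0; exact C1_nz|].
  set (e := (ep * ie)%S).
  assert (e_em : (e * em)%S = ep).
  { unfold e. replace (ep * ie * em)%S with (ep * (em * ie))%S by ring. rewrite Hie. ring. }
  assert (e0 : e O O = RtoC 1).
  { apply (f_equal (fun f : S2 => f O O)) in e_em. rewrite mul_coef_00, em0, ep0 in e_em.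
    transitivity (e O O * RtoC 1)%C; [cring | exact e_em]. }
  (* [Y] in the frame, divided by [xi ^ n * eta ^ m] *)
  set (p := (e * tau * (cst d * F * g2 - cst c * G * f2))%S).
  set (q := (e * tau * (cst c * G * f1 - cst d * F * g1))%S).
  set (h := (H * xi * eta * mp)%S).
  assert (h0 : h <> 0%S).
  { unfold h, mp. repeat apply mul_neq_0; try assumption; apply rpow_neq_0; assumption. }
  assert (Ch : conv h).
  { unfold h, mp. repeat apply conv_mul; try assumption; apply conv_rpow; assumption. }
  assert (Cmm : conv mm) by (apply conv_mul; apply conv_rpow; assumption).
  rewrite Mp, Mm in RX, RW.
  assert (em_neq : em <> 0%S) by (apply (neq_0_of_coef _ _ _ _ em0), C1_nz).
  assert (t_neq : t <> 0%S) by (apply (neq_0_of_coef _ _ _ _ t0), C1_nz).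
  assert (Hp : (h * p)%S = (p1 * mm)%S).
  { apply (S2_cancel (t * em)%S); [apply mul_neq_0; assumption|].
    transitivity ((t * tau) * (e * em) * h * (cst d * F * g2 - cst c * G * f2))%S;
      [unfold p; ring|].
    rewrite Htau, e_em.
    transitivity ((g2 * (p1 * f1 + q1 * f2) - f2 * (p1 * g1 + q1 * g2)) * (mm * em))%S;
      [|unfold t; ring].
    rewrite Ya, Yb.
    replace ((g2 * (eta * Yd X) - f2 * (xi * Yd W)) * (mm * em))%S with
      (g2 * eta * (Yd X * (mm * em)) - f2 * xi * (Yd W * (mm * em)))%S by ring.
    rewrite RX, RW. unfold h, X, W. ring. }
  assert (Hq : (h * q)%S = (q1 * mm)%S).
  { apply (S2_cancel (t * em)%S); [apply mul_neq_0; assumption|].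
    transitivity ((t * tau) * (e * em) * h * (cst c * G * f1 - cst d * F * g1))%S;
      [unfold q; ring|].
    rewrite Htau, e_em.
    transitivity ((f1 * (p1 * g1 + q1 * g2) - g1 * (p1 * f1 + q1 * f2)) * (mm * em))%S;
      [|unfold t; ring].
    rewrite Ya, Yb.
    replace ((f1 * (xi * Yd W) - g1 * (eta * Yd X)) * (mm * em))%S with
      (f1 * xi * (Yd W * (mm * em)) - g1 * eta * (Yd X * (mm * em)))%S by ring.
    rewrite RX, RW. unfold h, X, W. ring. }
  assert (Cp : conv p).
  { apply (conv_quotient h p (p1 * mm)%S h0 Ch); [|exact Hp].
    apply conv_mul; [apply conv_mul; [assumption | apply conv_vder; assumption] | exact Cmm]. }
  assert (Cq : conv q).
  { apply (conv_quotient h q (q1 * mm)%S h0 Ch); [|exact Hq].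
    apply conv_mul; [apply conv_mul; [assumption | apply conv_vder; assumption] | exact Cmm]. }
  assert (Pf : (p * f1 + q * f2)%S = (cst d * e * F)%S).
  { transitivity ((t * tau) * (cst d * e * F))%S; [unfold p, q, t; ring|].
    rewrite Htau. ring. }
  assert (Pg : (p * g1 + q * g2)%S = (cst c * e * G)%S).
  { transitivity ((t * tau) * (cst c * e * G))%S; [unfold p, q, t; ring|].
    rewrite Htau. ring. }
  (* solve for f1 + f2 and g1 + g2 *)
  set (N := (a * q - b * p)%S).
  assert (N0 : N O O <> RtoC 0).
  { replace (N O O) with (l1 * c - l2 * d)%C; [exact Hdc|].
    unfold N, p, q. rewrite sub_coef, !mul_coef_00, !sub_coef, !mul_coef_00, !cst_coef.
    rewrite a0, b0, e0, tau0, F0, G0, f1_0, f2_0, g1_0, g2_0. cring. }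
  destruct (unit_inverse N N0) as [nu Hnu].
  assert (CN : conv N) by (apply conv_sub; apply conv_mul; assumption).
  assert (Cnu : conv nu) by (apply (conv_inverse N nu CN Hnu)).
  set (th1 := (nu * cst l1 * (q - p) - 1)%S). set (be1 := (nu * cst d * (a - b))%S).
  set (th2 := (nu * cst l2 * (q - p) - 1)%S). set (be2 := (nu * cst c * (a - b))%S).
  set (V1 := (k * (xi * dy eta - eta * dy xi))%S).
  set (V2 := (k * (eta * dx xi - xi * dx eta))%S).
  assert (V_frame : forall f, vder V1 V2 f = (D1 f + D2 f)%S).
  { intro f. unfold vder, V1, V2, D1, D2. ring. }
  assert (VF : vder V1 V2 F = ((th1 + be1 * e) * F)%S).
  { rewrite V_frame. replace (D1 F + D2 F)%S with ((N * nu) * (f1 + f2) - F)%S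
      by (rewrite Hnu; unfold f1, f2; ring).
    replace ((N * nu) * (f1 + f2))%S with
      (nu * (q * (a * f1 + b * f2) - b * (p * f1 + q * f2)
             + (a * (p * f1 + q * f2) - p * (a * f1 + b * f2))))%S by (unfold N; ring).
    rewrite Za, Pf. unfold th1, be1. ring. }
  assert (VG : vder V1 V2 G = ((th2 + be2 * e) * G)%S).
  { rewrite V_frame. replace (D1 G + D2 G)%S with ((N * nu) * (g1 + g2) - G)%S
      by (rewrite Hnu; unfold g1, g2; ring).
    replace ((N * nu) * (g1 + g2))%S with
      (nu * (q * (a * g1 + b * g2) - b * (p * g1 + q * g2)
             + (a * (p * g1 + q * g2) - p * (a * g1 + b * g2))))%S by (unfold N; ring).
    rewrite Zb, Pg. unfold th2, be2. ring. }
  assert (V_mon : forall i i', vder V1 V2 (rpow F i * rpow G i' : S2)%S =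
    ((cst (INR i) * (th1 + be1 * e) + cst (INR i') * (th2 + be2 * e))
     * (rpow F i * rpow G i'))%S).
  { intros i i'. rewrite vder_mul, (vder_rpow _ _ F _ i VF), (vder_rpow _ _ G _ i' VG). ring. }
  set (cn := (cst (INR n1) - cst (INR n2))%S). set (cm := (cst (INR m1) - cst (INR m2))%S).
  assert (Ve : vder V1 V2 e =
    ((cn * th1 + cm * th2) * e + (cn * be1 + cm * be2) * (e * e))%S).
  { apply (S2_cancel em); [exact em_neq|].
    replace (em * vder V1 V2 e)%S with (vder V1 V2 (e * em)%S - e * vder V1 V2 em)%S
      by (rewrite vder_mul; ring).
    rewrite e_em. unfold ep at 1, em at 1. rewrite !V_mon. fold ep em.
    rewrite <- e_em. unfold cn, cm. ring. }
  destruct (dx_near_x xi Oxi) as [Dx1 Dx2]. destruct (dy_near_y eta Oeta) as [Dy1 Dy2].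
  assert (xi1 : ord xi 1).
  { replace xi with ((xi - varx) + varx)%S by ring. apply ord_add; [|apply ord_varx].
    apply ord_weaken with 2%nat; [lia | exact Oxi]. }
  assert (eta1 : ord eta 1).
  { replace eta with ((eta - vary) + vary)%S by ring. apply ord_add; [|apply ord_vary].
    apply ord_weaken with 2%nat; [lia | exact Oeta]. }
  assert (OV1 : ord (V1 - varx)%S 2).
  { replace (V1 - varx)%S with ((k - 1) * (xi * dy eta) + (xi - varx) * dy eta
      + varx * (dy eta - 1) - k * (eta * dy xi))%S by (unfold V1; ring).
    apply ord_sub; [apply ord_add; [apply ord_add|]|].
    - apply (ord_mul _ _ 1 1); [auto | apply ord_mul_l, xi1].
    - apply ord_mul_l, Oxi.
    - apply (ord_mul _ _ 1 1); [apply ord_varx | exact Dy1].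
    - apply ord_mul_r, (ord_mul _ _ 1 1); assumption. }
  assert (OV2 : ord (V2 - vary)%S 2).
  { replace (V2 - vary)%S with ((k - 1) * (eta * dx xi) + (eta - vary) * dx xi
      + vary * (dx xi - 1) - k * (xi * dx eta))%S by (unfold V2; ring).
    apply ord_sub; [apply ord_add; [apply ord_add|]|].
    - apply (ord_mul _ _ 1 1); [auto | apply ord_mul_l, eta1].
    - apply ord_mul_l, Oeta.
    - apply (ord_mul _ _ 1 1); [apply ord_vary | exact Dx1].
    - apply ord_mul_r, (ord_mul _ _ 1 1); assumption. }
  assert (Cj : conv j).
  { apply conv_sub; apply conv_mul; (apply conv_dx || apply conv_dy); assumption. }
  assert (Ck : conv k) by (apply (conv_inverse j k Cj Hk)).
  assert (CV1 : conv V1).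
  { apply conv_mul; [exact Ck|].
    apply conv_sub; apply conv_mul; try assumption; apply conv_dy; assumption. }
  assert (CV2 : conv V2).
  { apply conv_mul; [exact Ck|].
    apply conv_sub; apply conv_mul; try assumption; apply conv_dx; assumption. }
  assert (Cth : forall s, conv (nu * cst s * (q - p) - 1)%S).
  { intro s. apply conv_sub; [|apply conv_one].
    apply conv_mul; [apply conv_mul; [exact Cnu | apply conv_cst] | apply conv_sub; assumption]. }
  assert (Cbe : forall s, conv (nu * cst s * (a - b))%S).
  { intro s. apply conv_mul; [apply conv_mul; [exact Cnu | apply conv_cst] |
      apply conv_sub; assumption]. }
  assert (Ccn : conv cn) by (apply conv_sub; apply conv_cst).
  assert (Ccm : conv cm) by (apply conv_sub; apply conv_cst).
  assert (Ce : conv e).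
  { apply (briot_bouquet V1 V2 (cn * th1 + cm * th2)%S (cn * be1 + cm * be2)%S); auto.
    - apply conv_add; apply conv_mul; auto; apply Cth.
    - apply conv_add; apply conv_mul; auto; apply Cbe. }
  assert (CF : conv F).
  { apply (briot_bouquet V1 V2 (th1 + be1 * e)%S 0%S); auto using conv_zero.
    - apply conv_add; [apply Cth | apply conv_mul; [apply Cbe | exact Ce]].
    - rewrite VF. ring. }
  assert (CG : conv G).
  { apply (briot_bouquet V1 V2 (th2 + be2 * e)%S 0%S); auto using conv_zero.
    - apply conv_add; [apply Cth | apply conv_mul; [apply Cbe | exact Ce]].
    - rewrite VG. ring. }
  exists X, W, n, m, d, c. fold n1 n2 m1 m2. rewrite Mp, Mm.
  split; [apply conv_mul; assumption|]. split; [apply conv_mul; assumption|].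
  repeat split; assumption.
Qed.

End NormalForm.

(** * From germs to series *)

(** ** Generic identities *)

Lemma generically_series P : generically P ->
  exists a : S2, conv a /\ a <> 0%S /\ near0 (fun p => val a p <> RtoC 0 -> P p).
Proof.
  intros [q [Hq [Hn HP]]]. destruct (holomorphic_germ_conv q Hq) as [a [Ca Ha]].
  exists a. split; [exact Ca|]. split.
  - intro E. apply Hn. refine (near0_mono _ _ _ Ha). intros p Hp.
    rewrite Hp, E, <- cst_0. apply val_cst.
  - near Ha. 2: exact HP. intros p [H1 H2] H3. apply H2. rewrite H1. exact H3.
Qed.

Lemma generically_of_series (a : S2) (P : C * C -> Prop) : conv a -> a <> 0%S ->
  near0 (fun p => val a p <> RtoC 0 -> P p) -> generically P.
Proof.
  intros Ca Ha HP. exists (val a). split; [|split; [|exact HP]].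
  - apply (holomorphic_germ_of_conv a); [exact Ca|]. apply near0_all. reflexivity.
  - intro H. apply Ha, val_identity; assumption.
Qed.

Lemma generically_near P : near0 P -> generically P.
Proof.
  intro H. apply (generically_of_series (cst (RtoC 1))).
  - apply conv_cst.
  - apply (neq_0_of_coef _ O O (RtoC 1)); [reflexivity | exact C1_nz].
  - refine (near0_mono _ _ _ H). intros p Hp _. exact Hp.
Qed.

Lemma generically_mono (P Q : C * C -> Prop) : (forall p, P p -> Q p) ->
  generically P -> generically Q.
Proof.
  intros H [q [H1 [H2 H3]]]. exists q. split; [exact H1|]. split; [exact H2|].
  refine (near0_mono _ _ _ H3). intros p Hp Hq. apply H, Hp, Hq.
Qed.

Lemma generically_and P Q : generically P -> generically Q ->
  generically (fun p => P p /\ Q p).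
Proof.
  intros HP HQ. destruct (generically_series P HP) as [a [Ca [Ha Ea]]].
  destruct (generically_series Q HQ) as [b [Cb [Hb Eb]]].
  apply (generically_of_series (a * b)%S); [apply conv_mul; assumption |
    apply mul_neq_0; assumption |].
  near Ea. 2: near Eb. 3: exact (val_mul a b Ca Cb). 2: intros p HH; exact HH.
  intros p [H1 [H2 H3]] H4. rewrite H3 in H4.
  split; [apply H1 | apply H2]; intro E; apply H4; rewrite E; ring.
Qed.

Ltac gen H := refine (generically_mono _ _ _ (generically_and _ _ H _)).

Lemma generically_neq_0 (a : S2) : conv a -> a <> 0%S -> generically (fun p => val a p <> RtoC 0).
Proof.
  intros Ca Ha. apply (generically_of_series a); [exact Ca | exact Ha |].
  apply near0_all. intros p H; exact H.
Qed.

(** Multiply by the series whose zeros are excluded: there are no zero divisors. *)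
Lemma generically_eq (f g : S2) : conv f -> conv g ->
  generically (fun p => val f p = val g p) -> f = g.
Proof.
  intros Cf Cg H. destruct (generically_series _ H) as [a [Ca [Ha Ea]]].
  assert (Cd : conv (f - g)%S) by (apply conv_sub; assumption).
  assert (E : (a * (f - g))%S = 0%S).
  { apply val_identity; [apply conv_mul; assumption|].
    near Ea. 2: near (val_mul a (f - g)%S Ca Cd). 3: exact (val_sub f g Cf Cg).
    2: intros p HH; exact HH.
    intros p [H1 [H2 H3]]. rewrite H2, H3.
    destruct (Ceq_dec (val a p) 0) as [E|E]; [rewrite E; ring|].
    rewrite (H1 E). ring. }
  destruct (S2_integral _ _ E) as [E'|E']; [contradiction|].
  replace f with ((f - g) + g)%S by ring. rewrite E'. ring.
Qed.

Definition is_germ (f : S2) (phi : C * C -> C) : Prop :=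
  conv f /\ near0 (fun p => val f p = phi p).

Lemma is_germ_val f : conv f -> is_germ f (val f).
Proof. intro H. split; [exact H|]. apply near0_all. reflexivity. Qed.

Lemma is_germ_add f g phi psi : is_germ f phi -> is_germ g psi ->
  is_germ (f + g)%S (fun p => phi p + psi p).
Proof.
  intros [C1 H1] [C2 H2]. split; [apply conv_add; assumption|].
  near H1. 2: near H2. 3: exact (val_add f g C1 C2). 2: intros p HH; exact HH.
  intros p [E1 [E2 E3]]. rewrite E3, E1, E2. reflexivity.
Qed.

Lemma is_germ_sub f g phi psi : is_germ f phi -> is_germ g psi ->
  is_germ (f - g)%S (fun p => phi p - psi p).
Proof.
  intros [C1 H1] [C2 H2]. split; [apply conv_sub; assumption|].
  near H1. 2: near H2. 3: exact (val_sub f g C1 C2). 2: intros p HH; exact HH.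
  intros p [E1 [E2 E3]]. rewrite E3, E1, E2. reflexivity.
Qed.

Lemma is_germ_mul f g phi psi : is_germ f phi -> is_germ g psi ->
  is_germ (f * g)%S (fun p => phi p * psi p).
Proof.
  intros [C1 H1] [C2 H2]. split; [apply conv_mul; assumption|].
  near H1. 2: near H2. 3: exact (val_mul f g C1 C2). 2: intros p HH; exact HH.
  intros p [E1 [E2 E3]]. rewrite E3, E1, E2. reflexivity.
Qed.

Lemma is_germ_cst c : is_germ (cst c) (fun _ => c).
Proof. split; [apply conv_cst|]. apply near0_all. intro p. apply val_cst. Qed.

Lemma is_germ_rpow f phi n : is_germ f phi -> is_germ (rpow f n) (fun p => phi p ^ n).
Proof.
  intros [C1 H1]. split; [apply conv_rpow, C1|].
  near H1. 2: exact (val_rpow f n C1). intros p [E1 E2]. rewrite E2, E1. reflexivity.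
Qed.

Lemma is_germ_vder V1 V2 f : conv V1 -> conv V2 -> conv f ->
  is_germ (vder V1 V2 f) (fun p => val V1 p * val (dx f) p + val V2 p * val (dy f) p).
Proof.
  intros C1 C2 C3. apply is_germ_add; apply is_germ_mul; apply is_germ_val; try assumption;
    [apply conv_dx | apply conv_dy]; assumption.
Qed.

(** Computes the germ of function of a polynomial expression in convergent series. *)
Ltac germ :=
  lazymatch goal with
  | |- is_germ (cst _) _ => apply is_germ_cst
  | |- is_germ (vder _ _ _) _ => apply is_germ_vder; assumption
  | |- is_germ (radd _ _) _ => apply is_germ_add; germ
  | |- is_germ (rsub _ _) _ => apply is_germ_sub; germ
  | |- is_germ (rmul _ _) _ => apply is_germ_mul; germ
  | |- is_germ (rpow _ _) _ => apply is_germ_rpow; germ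
  | |- is_germ _ _ => apply is_germ_val; assumption
  end.

Lemma is_germ_eq f g phi psi : is_germ f phi -> is_germ g psi ->
  generically (fun p => phi p = psi p) -> f = g.
Proof.
  intros [C1 H1] [C2 H2] H. apply generically_eq; try assumption.
  gen (generically_near _ H1). 2: gen (generically_near _ H2). 3: exact H.
  2: intros p HH; exact HH.
  intros p [E1 [E2 E3]]. rewrite E1, E2. exact E3.
Qed.

Lemma is_germ_eq_near f g phi psi : f = g -> is_germ f phi -> is_germ g psi ->
  near0 (fun p => phi p = psi p).
Proof.
  intros E [C1 H1] [C2 H2]. near H1. 2: exact H2. intros p [E1 E2].
  rewrite <- E1, <- E2, E. reflexivity.
Qed.

(** ** Partial derivatives *)

Lemma cderiv_local f g x l d : (0 < d)%R ->
  (forall h, (Cmod h < d)%R -> f (x + h) = g (x + h)) -> cderiv f x l -> cderiv g x l.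
Proof.
  intros Hd E H eps He. destruct (H eps He) as [e [He' HH]].
  exists (Rmin d e). split; [apply Rmin_glb_lt; assumption|]. intros h Hh.
  assert (H1 : (Cmod h < d)%R) by (eapply Rlt_le_trans; [exact Hh | apply Rmin_l]).
  assert (H2 : (Cmod h < e)%R) by (eapply Rlt_le_trans; [exact Hh | apply Rmin_r]).
  rewrite <- (E h H1). replace (g x) with (f x); [apply HH, H2|].
  specialize (E (RtoC 0)). rewrite Cplus_0_r in E. apply E. rewrite Cmod_0. exact Hd.
Qed.

Open Scope R_scope.

(** Only the relation [f = A / H] off the zeros of [H] is available, so [H f = A] is
    expanded to first order instead. *)
Lemma cderiv_quotient (f A H : C -> C) x A' H' d :
  cderiv A x A' -> cderiv H x H' -> H x <> RtoC 0 -> 0 < d ->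
  (forall h, Cmod h < d -> H (x + h)%C <> RtoC 0 -> f (x + h)%C = (A (x + h) / H (x + h))%C) ->
  cderiv f x ((A' * H x - A x * H') / (H x * H x))%C.
Proof.
  intros HA HH Hx Hd Hf.
  assert (fx : f x = (A x / H x)%C).
  { specialize (Hf (RtoC 0)). rewrite Cplus_0_r in Hf. apply Hf; [rewrite Cmod_0;
    exact Hd | exact Hx]. }
  set (l := ((A' * H x - A x * H') / (H x * H x))%C).
  assert (Hl : (A' - f x * H' - l * H x)%C = RtoC 0) by (rewrite fx; unfold l; field; exact Hx).
  set (m := Cmod (H x)). assert (Hm : 0 < m) by (apply Cmod_gt_0, Hx).
  set (cf := Cmod (f x)). set (cl := Cmod l). set (ch := Cmod H').
  assert (Hcf : 0 <= cf) by apply Cmod_ge_0.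
  assert (Hcl : 0 <= cl) by apply Cmod_ge_0.
  assert (Hch : 0 <= ch) by apply Cmod_ge_0.
  intros eps He.
  set (e1 := Rmin 1 (eps * m / (4 * (1 + cf + cl)))).
  assert (P1 : 0 < eps * m) by (apply Rmult_lt_0_compat; assumption).
  assert (He1 : 0 < e1) by (apply Rmin_glb_lt; [lra | apply Rdiv_lt_0_compat; lra]).
  assert (He1b : e1 * (1 + cf + cl) <= eps * m / 4).
  { apply Rle_trans with (eps * m / (4 * (1 + cf + cl)) * (1 + cf + cl)).
    - apply Rmult_le_compat_r; [lra | apply Rmin_r].
    - right. field. lra. }
  assert (He11 : e1 <= 1) by apply Rmin_l.
  destruct (HA e1 He1) as [d1 [Hd1 HA1]]. destruct (HH e1 He1) as [d2 [Hd2 HH1]].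
  set (d3 := Rmin (m / (2 * (ch + 1))) (Rmin 1 (eps * m / (4 * (cl * ch + 1))))).
  assert (P2 : 0 <= cl * ch) by (apply Rmult_le_pos; assumption).
  assert (Hd3 : 0 < d3).
  { repeat apply Rmin_glb_lt; try lra; apply Rdiv_lt_0_compat; lra. }
  exists (Rmin (Rmin d1 d2) (Rmin d d3)).
  split; [apply Rmin_glb_lt; apply Rmin_glb_lt; assumption|]. intros h Hh.
  assert (B1 : Cmod h < d1) by (eapply Rlt_le_trans; [exact Hh|]; eapply Rle_trans;
    [apply Rmin_l | apply Rmin_l]).
  assert (B2 : Cmod h < d2) by (eapply Rlt_le_trans; [exact Hh|]; eapply Rle_trans;
    [apply Rmin_l | apply Rmin_r]).
  assert (B3 : Cmod h < d) by (eapply Rlt_le_trans; [exact Hh|]; eapply Rle_trans;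
    [apply Rmin_r | apply Rmin_l]).
  assert (B4 : Cmod h < d3) by (eapply Rlt_le_trans; [exact Hh|]; eapply Rle_trans;
    [apply Rmin_r | apply Rmin_r]).
  assert (B5 : Cmod h < m / (2 * (ch + 1))) by (eapply Rlt_le_trans; [exact B4 | apply Rmin_l]).
  assert (B6 : Cmod h < 1) by (eapply Rlt_le_trans; [exact B4|]; eapply Rle_trans;
    [apply Rmin_r | apply Rmin_l]).
  assert (B7 : Cmod h < eps * m / (4 * (cl * ch + 1)))
    by (eapply Rlt_le_trans; [exact B4|]; eapply Rle_trans; [apply Rmin_r | apply Rmin_r]).
  clear B4 Hh.
  assert (B5' : Cmod h * (ch + 1) <= m / 2).
  { apply Rlt_le. apply Rmult_lt_compat_r with (r := ch + 1) in B5; [|lra].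
    replace (m / (2 * (ch + 1)) * (ch + 1)) with (m / 2) in B5 by (field; lra). exact B5. }
  assert (B7' : Cmod h * (cl * ch + 1) <= eps * m / 4).
  { apply Rlt_le. apply Rmult_lt_compat_r with (r := cl * ch + 1) in B7; [|lra].
    replace (eps * m / (4 * (cl * ch + 1)) * (cl * ch + 1)) with (eps * m / 4) in B7
      by (field; lra). exact B7. }
  set (a := (A (x + h) - A x - h * A')%C). set (b := (H (x + h) - H x - h * H')%C).
  assert (Ba : Cmod a <= e1 * Cmod h) by (apply HA1, B1).
  assert (Bb : Cmod b <= e1 * Cmod h) by (apply HH1, B2).
  set (t := Cmod h) in *. assert (Ht : 0 <= t) by apply Cmod_ge_0.
  assert (Bd : Cmod (H (x + h) - H x)%C <= m / 2).
  { replace (H (x + h) - H x)%C with (h * H' + b)%C by (unfold b; ring).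
    eapply Rle_trans; [apply Cmod_triangle|]. rewrite Cmod_mult. fold t ch. nra. }
  assert (BH : m / 2 <= Cmod (H (x + h)%C)).
  { assert (m <= Cmod (H (x + h)%C) + Cmod (H (x + h) - H x)%C); [|lra].
    unfold m. replace (H x) with (H (x + h)%C + - (H (x + h) - H x))%C at 1 by ring.
    eapply Rle_trans; [apply Cmod_triangle|]. rewrite Cmod_opp. lra. }
  assert (BH0 : H (x + h)%C <> RtoC 0).
  { apply Cmod_gt_0. lra. }
  set (phi := (f (x + h) - f x - h * l)%C).
  assert (E : (H (x + h) * phi)%C = (a - f x * b - h * l * (h * H' + b))%C).
  { unfold phi. rewrite (Hf h B3 BH0).
    replace (H (x + h) * (A (x + h) / H (x + h) - f x - h * l))%C with
      (A (x + h) - f x * H (x + h) - h * l * H (x + h))%C by (field; exact BH0).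
    replace (A (x + h)%C) with (A x + h * A' + a)%C by (unfold a; ring).
    replace (H (x + h)%C) with (H x + h * H' + b)%C by (unfold b; ring).
    replace (A x + h * A' + a - f x * (H x + h * H' + b) - h * l * (H x + h * H' + b))%C
      with ((A x - f x * H x) + h * (A' - f x * H' - l * H x)
        + (a - f x * b - h * l * (h * H' + b)))%C by ring.
    rewrite Hl. replace (A x - f x * H x)%C with (RtoC 0) by (rewrite fx; field; exact Hx).
    ring. }
  assert (Bphi : Cmod (H (x + h)%C) * Cmod phi <= eps * m / 2 * t).
  { rewrite <- Cmod_mult, E.
    apply Rle_trans with (Cmod a + cf * Cmod b + t * cl * (t * ch + Cmod b)).
    - unfold Cminus. eapply Rle_trans; [apply Cmod_triangle|]. rewrite Cmod_opp.
      apply Rplus_le_compat.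
      + eapply Rle_trans; [apply Cmod_triangle|]. rewrite Cmod_opp, Cmod_mult. apply Rle_refl.
      + rewrite !Cmod_mult. fold t cl. apply Rmult_le_compat_l; [apply Rmult_le_pos; assumption|].
        eapply Rle_trans; [apply Cmod_triangle|]. rewrite Cmod_mult. apply Rle_refl.
    - assert (0 <= Cmod b) by apply Cmod_ge_0.
      assert (cf * Cmod b <= cf * (e1 * t)) by (apply Rmult_le_compat_l; assumption).
      assert (t * cl * (t * ch + Cmod b) <= t * (cl * ch * t + cl * e1)).
      { replace (t * cl * (t * ch + Cmod b)) with (t * (cl * ch * t + cl * Cmod b)) by ring.
        apply Rmult_le_compat_l; [exact Ht|]. apply Rplus_le_compat_l.
        apply Rmult_le_compat_l; [exact Hcl|]. nra. }
      assert (e1 * t + cf * (e1 * t) + t * (cl * ch * t + cl * e1) <= eps * m / 2 * t).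
      { replace (e1 * t + cf * (e1 * t) + t * (cl * ch * t + cl * e1)) with
          ((e1 * (1 + cf + cl) + cl * ch * t) * t) by ring.
        apply Rmult_le_compat_r; [exact Ht|]. nra. }
      lra. }
  apply Rmult_le_reg_l with (m / 2); [lra|].
  apply Rle_trans with (Cmod (H (x + h)%C) * Cmod phi).
  - apply Rmult_le_compat_r; [apply Cmod_ge_0 | exact BH].
  - eapply Rle_trans; [exact Bphi|]. right. field.
Qed.

Lemma near0_neighbourhood P : near0 P ->
  near0 (fun p => exists d, 0 < d /\
    (forall h, Cmod h < d -> P (fst p + h, snd p)%C) /\
    (forall h, Cmod h < d -> P (fst p, snd p + h)%C)).
Proof.
  intros [r [Hr H]]. exists r. split; [exact Hr|]. intros x y Hx Hy.
  exists (Rmin (r - Cmod x) (r - Cmod y)). split; [apply Rmin_glb_lt; lra|].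
  split; intros h Hh; simpl.
  - apply H; [|exact Hy]. eapply Rle_lt_trans; [apply Cmod_triangle|].
    pose proof (Rmin_l (r - Cmod x) (r - Cmod y)). lra.
  - apply H; [exact Hx|]. eapply Rle_lt_trans; [apply Cmod_triangle|].
    pose proof (Rmin_r (r - Cmod x) (r - Cmod y)). lra.
Qed.

Lemma cderiv_near (a : S2) : conv a -> near0 (fun p =>
  cderiv (fun t => val a (t, snd p)) (fst p) (val (dx a) p) /\
  cderiv (fun t => val a (fst p, t)) (snd p) (val (dy a) p)).
Proof.
  intro Ca. destruct (val_cderiv_x a Ca) as [r [Hr H1]].
  destruct (val_cderiv_y a Ca) as [s [Hs H2]].
  apply near0_and; [exists r | exists s]; (split; [assumption|]);
    intros x y Hx Hy; [apply H1 | apply H2]; assumption.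
Qed.

Lemma partial_near f a : conv a -> near0 (fun p => f p = val a p) ->
  near0 (fun p => partial_x f p = val (dx a) p /\ partial_y f p = val (dy a) p).
Proof.
  intros Ca Hf. near (near0_neighbourhood _ Hf). 2: exact (cderiv_near a Ca).
  intros p [[d [Hd [Hx Hy]]] [D1 D2]]. split; apply cderiv_C_derive.
  - apply (cderiv_local (fun t => val a (t, snd p)) _ _ _ d Hd); [|exact D1].
    intros h Hh. symmetry. apply Hx, Hh.
  - apply (cderiv_local (fun t => val a (fst p, t)) _ _ _ d Hd); [|exact D2].
    intros h Hh. symmetry. apply Hy, Hh.
Qed.

Lemma partial_quotient f (A H : S2) : conv A -> conv H ->
  near0 (fun p => val H p <> RtoC 0 -> f p = (val A p / val H p)%C) ->
  near0 (fun p => val H p <> RtoC 0 ->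
    partial_x f p = ((val (dx A) p * val H p - val A p * val (dx H) p)
                     / (val H p * val H p))%C /\
    partial_y f p = ((val (dy A) p * val H p - val A p * val (dy H) p)
                     / (val H p * val H p))%C).
Proof.
  intros CA CH Hf. near (near0_neighbourhood _ Hf).
  2: near (cderiv_near A CA). 3: exact (cderiv_near H CH). 2: intros p HH; exact HH.
  intros p [[d [Hd [Hx Hy]]] [[A1 A2] [H1 H2]]] Hp.
  destruct p as [x y]. cbn [fst snd] in *.
  split; apply cderiv_C_derive; cbn [fst snd].
  - exact (cderiv_quotient (fun t => f (t, y)) (fun t => val A (t, y)) (fun t => val H (t, y))
      x _ _ d A1 H1 Hp Hd Hx).
  - exact (cderiv_quotient (fun t => f (x, t)) (fun t => val A (x, t)) (fun t => val H (x, t))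
      y _ _ d A2 H2 Hp Hd Hy).
Qed.

Lemma differential_near F (u v : S2) : conv u -> conv v ->
  near0 (fun p => F p = (val u p, val v p)) ->
  near0 (fun p => forall w, Defs.differential F p w =
    (val (dx u) p * fst w + val (dy u) p * snd w,
     val (dx v) p * fst w + val (dy v) p * snd w)%C).
Proof.
  intros Cu Cv HF.
  near (partial_near (fun q => fst (F q)) u Cu
    (near0_mono _ _ (fun p (E : F p = _) => f_equal fst E) HF)).
  2: exact (partial_near (fun q => snd (F q)) v Cv
    (near0_mono _ _ (fun p (E : F p = _) => f_equal snd E) HF)).
  intros p [[E1 E2] [E3 E4]] w. unfold Defs.differential. rewrite E1, E2, E3, E4. reflexivity.
Qed.

Open Scope C_scope.

Lemma holomorphic_map_series F : holomorphic_map F -> exists u v : S2,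
  conv u /\ conv v /\ near0 (fun p => F p = (val u p, val v p)).
Proof.
  intros [H1 H2]. destruct (holomorphic_germ_conv _ H1) as [u [Cu Eu]].
  destruct (holomorphic_germ_conv _ H2) as [v [Cv Ev]].
  exists u, v. split; [exact Cu|]. split; [exact Cv|].
  near Eu. 2: exact Ev. intros p [E1 E2].
  rewrite (surjective_pairing (F p)), E1, E2. reflexivity.
Qed.

(** ** Biholomorphic germs *)

Definition inverse_germs (X W u v : S2) : Prop :=
  conv X /\ conv W /\ conv u /\ conv v /\
  X O O = RtoC 0 /\ W O O = RtoC 0 /\ u O O = RtoC 0 /\ v O O = RtoC 0 /\
  near0 (fun p => (val u (val X p, val W p), val v (val X p, val W p)) = p) /\
  near0 (fun p => (val X (val u p, val v p), val W (val u p, val v p)) = p).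

Lemma inverse_germs_sym X W u v : inverse_germs X W u v -> inverse_germs u v X W.
Proof. unfold inverse_germs. tauto. Qed.

Lemma biholomorphic_series Phi : biholomorphic_germ Phi -> exists X W u v : S2,
  inverse_germs X W u v /\ near0 (fun p => Phi p = (val X p, val W p)).
Proof.
  intros [H1 [P0 [Psi [H2 [Q0 [E1 E2]]]]]].
  destruct (holomorphic_map_series _ H1) as [X [W [CX [CW EP]]]].
  destruct (holomorphic_map_series _ H2) as [u [v [Cu [Cv EQ]]]].
  pose proof (near0_at0 _ EP) as A1. cbv beta in A1. rewrite P0, !val_origin in A1 by assumption.
  pose proof (near0_at0 _ EQ) as A2. cbv beta in A2. rewrite Q0, !val_origin in A2 by assumption.
  unfold origin in A1, A2. injection A1 as X0 W0. injection A2 as u0 v0.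
  exists X, W, u, v. split; [|exact EP].
  assert (SX : X O O = RtoC 0) by (symmetry; exact X0).
  assert (SW : W O O = RtoC 0) by (symmetry; exact W0).
  assert (Su : u O O = RtoC 0) by (symmetry; exact u0).
  assert (Sv : v O O = RtoC 0) by (symmetry; exact v0).
  do 8 (split; [assumption|]). split.
  - near E1. 2: near EP. 3: exact (near0_comp X W _ CX CW SX SW EQ). 2: intros p HH; exact HH.
    intros p [F1 [F2 F3]]. rewrite <- F3, <- F2. exact F1.
  - near E2. 2: near EQ. 3: exact (near0_comp u v _ Cu Cv Su Sv EP). 2: intros p HH; exact HH.
    intros p [F1 [F2 F3]]. rewrite <- F3, <- F2. exact F1.
Qed.

Lemma biholomorphic_of_series X W u v : inverse_germs X W u v ->
  biholomorphic_germ (fun p => (val X p, val W p)).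
Proof.
  intros (CX & CW & Cu & Cv & X0 & W0 & u0 & v0 & E1 & E2).
  assert (refl : forall a, conv a -> holomorphic_germ (val a)).
  { intros a Ca. apply (holomorphic_germ_of_conv a); [exact Ca | apply near0_all; reflexivity]. }
  split; [split; apply refl; assumption|].
  split; [rewrite !val_origin, X0, W0 by assumption; reflexivity|].
  exists (fun p => (val u p, val v p)).
  split; [split; apply refl; assumption|].
  split; [rewrite !val_origin, u0, v0 by assumption; reflexivity|].
  split; assumption.
Qed.

Lemma generically_comp X W u v P : inverse_germs X W u v -> generically P ->
  generically (fun p => P (val X p, val W p)).
Proof.
  intros (CX & CW & Cu & Cv & X0 & W0 & u0 & v0 & E1 & E2) HP.
  destruct (generically_series P HP) as [a [Ca [Ha Ea]]].
  destruct (conv_compose2 a X W Ca CX CW X0 W0) as [Cc Ec].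
  apply (generically_of_series (compose2 a X W)); [exact Cc | |].
  - intro E. apply Ha, val_identity; [exact Ca|].
    near (near0_comp u v _ Cu Cv u0 v0 Ec). 2: exact E2.
    intros p [F1 F2]. rewrite F2, E, <- cst_0, val_cst in F1. symmetry. exact F1.
  - near Ec. 2: exact (near0_comp X W _ CX CW X0 W0 Ea).
    intros p [F1 F2] F3. apply F2. rewrite <- F1. exact F3.
Qed.

(** A map with a right inverse that has a right inverse itself is invertible. *)
Lemma inverse_germs_of_right_inverses X W u v X' W' :
  conv X -> conv W -> conv u -> conv v -> conv X' -> conv W' ->
  X O O = RtoC 0 -> W O O = RtoC 0 -> u O O = RtoC 0 -> v O O = RtoC 0 ->
  X' O O = RtoC 0 -> W' O O = RtoC 0 ->
  near0 (fun p => (val X (val u p, val v p), val W (val u p, val v p)) = p) ->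
  near0 (fun p => (val u (val X' p, val W' p), val v (val X' p, val W' p)) = p) ->
  inverse_germs X W u v.
Proof.
  intros CX CW Cu Cv CX' CW' X0 W0 u0 v0 X'0 W'0 E1 E2.
  do 8 (split; [assumption|]). split; [|exact E1].
  near E2. 2: exact (near0_comp X' W' _ CX' CW' X'0 W'0 E1).
  intros p [F1 F2].
  (* the right inverse of the right inverse is the map itself *)
  assert (F3 : (val X p, val W p) = (val X' p, val W' p)).
  { rewrite F1 in F2. exact F2. }
  pose proof (f_equal fst F3) as G1. pose proof (f_equal snd F3) as G2.
  cbn [fst snd] in G1, G2. rewrite G1, G2. exact F1.
Qed.

Lemma inverse_germs_near_identity (X W : S2) : conv X -> conv W ->
  ord (X - varx)%S 2 -> ord (W - vary)%S 2 ->
  exists u v, inverse_germs X W u v.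
Proof.
  intros CX CW OX OW.
  destruct (conv_right_inverse X W CX CW OX OW) as [u [v [Cu [Cv [Ou [Ov E1]]]]]].
  destruct (conv_right_inverse u v Cu Cv Ou Ov) as [X' [W' [CX' [CW' [OX' [OW' E2]]]]]].
  exists u, v.
  assert (zx : forall f : S2, ord (f - varx)%S 2 -> f O O = RtoC 0).
  { intros f Hf. specialize (Hf O O ltac:(lia)). rewrite sub_coef in Hf.
    transitivity ((f O O - varx O O) + varx O O)%C; [cring|]. rewrite Hf.
    apply Cplus_0_l. }
  assert (zy : forall f : S2, ord (f - vary)%S 2 -> f O O = RtoC 0).
  { intros f Hf. specialize (Hf O O ltac:(lia)). rewrite sub_coef in Hf.
    transitivity ((f O O - vary O O) + vary O O)%C; [cring|]. rewrite Hf.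
    apply Cplus_0_l. }
  apply (inverse_germs_of_right_inverses X W u v X' W'); auto.
Qed.

(** * The Lie algebra in terms of series *)

(** [Z] and [Y = (A / H, B / H)] as series. The relations [ld_bracket_1] and
    [ld_bracket_2] are the two components of [[Z, Y] = delta Y] times [H ^ 2]. *)
Record lie_data (Z Y : vfield) (l1 l2 delta : C) (z1 z2 A B H : S2) : Prop := {
  ld_z1 : conv z1; ld_z2 : conv z2; ld_A : conv A; ld_B : conv B; ld_H : conv H;
  ld_Z : near0 (fun p => Z p = (val z1 p, val z2 p));
  ld_Y : near0 (fun p => val H p <> RtoC 0 -> Y p = (val A p / val H p, val B p / val H p));
  ld_z1_lin : ord (z1 - cst l1 * varx)%S 2;
  ld_z2_lin : ord (z2 - cst l2 * vary)%S 2;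
  ld_H_neq_0 : H <> 0%S;
  ld_det : (z1 * B - z2 * A)%S <> 0%S;
  ld_bracket_1 : (vder z1 z2 A * H - A * vder z1 z2 H - H * vder A B z1)%S
    = (cst delta * (A * H))%S;
  ld_bracket_2 : (vder z1 z2 B * H - B * vder z1 z2 H - H * vder A B z2)%S
    = (cst delta * (B * H))%S }.

Arguments ld_z1 {_ _ _ _ _ _ _ _ _ _} _.
Arguments ld_z2 {_ _ _ _ _ _ _ _ _ _} _.
Arguments ld_A {_ _ _ _ _ _ _ _ _ _} _.
Arguments ld_B {_ _ _ _ _ _ _ _ _ _} _.
Arguments ld_H {_ _ _ _ _ _ _ _ _ _} _.
Arguments ld_Z {_ _ _ _ _ _ _ _ _ _} _.
Arguments ld_Y {_ _ _ _ _ _ _ _ _ _} _.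
Arguments ld_z1_lin {_ _ _ _ _ _ _ _ _ _} _.
Arguments ld_z2_lin {_ _ _ _ _ _ _ _ _ _} _.
Arguments ld_H_neq_0 {_ _ _ _ _ _ _ _ _ _} _.
Arguments ld_det {_ _ _ _ _ _ _ _ _ _} _.
Arguments ld_bracket_1 {_ _ _ _ _ _ _ _ _ _} _.
Arguments ld_bracket_2 {_ _ _ _ _ _ _ _ _ _} _.

Lemma meromorphic_series f : meromorphic_germ f -> exists g h : S2,
  conv g /\ conv h /\ h <> 0%S /\
  near0 (fun p => val h p <> RtoC 0 -> f p = val g p / val h p).
Proof.
  intros [g [h [Hg [Hh [Hn Hf]]]]].
  destruct (holomorphic_germ_conv g Hg) as [a [Ca Ea]].
  destruct (holomorphic_germ_conv h Hh) as [b [Cb Eb]].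
  exists a, b. split; [exact Ca|]. split; [exact Cb|]. split.
  - intro E. apply Hn. refine (near0_mono _ _ _ Eb). intros p Hp.
    rewrite Hp, E, <- cst_0. apply val_cst.
  - near Ea. 2: near Eb. 3: exact Hf. 2: intros p HH; exact HH.
    intros p [E1 [E2 E3]] Hb. rewrite <- E1, <- E2. apply E3. rewrite E2. exact Hb.
Qed.

Lemma linear_part_series Z (l1 l2 : C) (z1 z2 : S2) : conv z1 -> conv z2 ->
  near0 (fun p => Z p = (val z1 p, val z2 p)) -> has_diagonal_linear_part Z l1 l2 ->
  ord (z1 - cst l1 * varx)%S 2 /\ ord (z2 - cst l2 * vary)%S 2.
Proof.
  intros C1 C2 EZ [Z0 HZ].
  pose proof (near0_at0 _ EZ) as A0. cbv beta in A0. rewrite Z0, !val_origin in A0 by assumption.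
  pose proof (near0_at0 _ (differential_near Z z1 z2 C1 C2 EZ)) as DZ. cbv beta in DZ.
  assert (D : forall w : C * C, diag_vfield l1 l2 w =
    (z1 1%nat O * fst w + z1 O 1%nat * snd w, z2 1%nat O * fst w + z2 O 1%nat * snd w)).
  { intro w. rewrite <- HZ, DZ.
    rewrite !val_origin by (first [apply conv_dx | apply conv_dy]; assumption).
    rewrite !dx_coef, !dy_coef. simpl INR. unfold diag_vfield.
    f_equal; cring. }
  pose proof (D (RtoC 1, RtoC 0)) as Dx. pose proof (D (RtoC 0, RtoC 1)) as Dy.
  unfold diag_vfield in Dx, Dy. cbn [fst snd] in Dx, Dy.
  pose proof (f_equal fst Dx) as X1. pose proof (f_equal snd Dx) as X2.
  pose proof (f_equal fst Dy) as Y1. pose proof (f_equal snd Dy) as Y2.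
  pose proof (f_equal fst A0) as W1. pose proof (f_equal snd A0) as W2.
  cbn [fst snd] in X1, X2, Y1, Y2. unfold origin in W1, W2. cbn [fst snd] in W1, W2.
  assert (E1 : z1 1%nat O = l1).
  { transitivity (z1 1%nat O * 1 + z1 O 1%nat * 0)%C; [cring|]. rewrite <- X1. cring. }
  assert (E2 : z1 O 1%nat = RtoC 0).
  { transitivity (z1 1%nat O * 0 + z1 O 1%nat * 1)%C; [cring|]. rewrite <- Y1. cring. }
  assert (E3 : z2 1%nat O = RtoC 0).
  { transitivity (z2 1%nat O * 1 + z2 O 1%nat * 0)%C; [cring|]. rewrite <- X2. cring. }
  assert (E4 : z2 O 1%nat = l2).
  { transitivity (z2 1%nat O * 0 + z2 O 1%nat * 1)%C; [cring|]. rewrite <- Y2. cring. }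
  split; apply ord_2; rewrite sub_coef, cst_mul_coef; rewrite ?E1, ?E2, ?E3, ?E4, <- ?W1, <- ?W2.
  - change (0 - l1 * 0 = 0 :> C)%C. ring.
  - change (l1 - l1 * 1 = 0 :> C)%C. ring.
  - change (0 - l1 * 0 = 0 :> C)%C. ring.
  - change (0 - l2 * 0 = 0 :> C)%C. ring.
  - change (0 - l2 * 0 = 0 :> C)%C. ring.
  - change (l2 - l2 * 1 = 0 :> C)%C. ring.
Qed.

Lemma lie_data_exists Z Y (l1 l2 delta : C) :
  holomorphic_map Z -> has_diagonal_linear_part Z l1 l2 ->
  is_lie_algebra_of_ratio Z Y delta -> non_degenerate Z Y ->
  exists z1 z2 A B H, lie_data Z Y l1 l2 delta z1 z2 A B H.
Proof.
  intros HZ Hlin (_ & [HY1 HY2] & _ & _ & Hbr) Hnd.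
  destruct (holomorphic_map_series Z HZ) as [z1 [z2 [C1 [C2 EZ]]]].
  destruct (linear_part_series Z l1 l2 z1 z2 C1 C2 EZ Hlin) as [O1 O2].
  destruct (meromorphic_series _ HY1) as [a1 [h1 [Ca1 [Ch1 [Hh1 E1]]]]].
  destruct (meromorphic_series _ HY2) as [a2 [h2 [Ca2 [Ch2 [Hh2 E2]]]]].
  set (A := (a1 * h2)%S). set (B := (a2 * h1)%S). set (H := (h1 * h2)%S).
  assert (CA : conv A) by (apply conv_mul; assumption).
  assert (CB : conv B) by (apply conv_mul; assumption).
  assert (CH : conv H) by (apply conv_mul; assumption).
  assert (H0 : H <> 0%S) by (apply mul_neq_0; assumption).
  assert (EY : near0 (fun p => val H p <> RtoC 0 ->
    Y p = (val A p / val H p, val B p / val H p))).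
  { near E1. 2: near E2. 3: near (val_mul a1 h2 Ca1 Ch2). 4: near (val_mul a2 h1 Ca2 Ch1).
    5: exact (val_mul h1 h2 Ch1 Ch2). 2-4: intros p HH; exact HH.
    intros p [F1 [F2 [F3 [F4 F5]]]] Hp. fold A in F3. fold B in F4. fold H in F5.
    rewrite F5 in Hp.
    assert (N1 : val h1 p <> RtoC 0) by (intro E; apply Hp; rewrite E; ring).
    assert (N2 : val h2 p <> RtoC 0) by (intro E; apply Hp; rewrite E; ring).
    rewrite (surjective_pairing (Y p)), (F1 N1), (F2 N2), F3, F4, F5.
    f_equal; field; split; assumption. }
  assert (EA : near0 (fun p => val H p <> RtoC 0 -> fst (Y p) = val A p / val H p)).
  { refine (near0_mono _ _ _ EY). intros p Hp Hn. rewrite (Hp Hn). reflexivity. }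
  assert (EB : near0 (fun p => val H p <> RtoC 0 -> snd (Y p) = val B p / val H p)).
  { refine (near0_mono _ _ _ EY). intros p Hp Hn. rewrite (Hp Hn). reflexivity. }
  clearbody A B H. clear E1 E2.
  (* the bracket, cleared of denominators, at generic points *)
  assert (BR : generically (fun p =>
    ((val z1 p * val (dx A) p + val z2 p * val (dy A) p) * val H p
       - val A p * (val z1 p * val (dx H) p + val z2 p * val (dy H) p)
       - val H p * (val A p * val (dx z1) p + val B p * val (dy z1) p)
     = delta * (val A p * val H p)) /\
    ((val z1 p * val (dx B) p + val z2 p * val (dy B) p) * val H p
       - val B p * (val z1 p * val (dx H) p + val z2 p * val (dy H) p)
       - val H p * (val A p * val (dx z2) p + val B p * val (dy z2) p)
     = delta * (val B p * val H p)))).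
  { gen Hbr. 2: gen (generically_neq_0 H CH H0).
    3: apply generically_near; near EZ. 4: near EY.
    5: near (partial_quotient (fun q => fst (Y q)) A H CA CH EA).
    6: near (partial_quotient (fun q => snd (Y q)) B H CB CH EB).
    7: exact (differential_near Z z1 z2 C1 C2 EZ).
    2-6: intros p HH; exact HH.
    intros p [F1 [F2 [F3 [F4 [F5 [F6 F7]]]]]].
    unfold eq_vfield, lie_bracket, comb_vfield in F1.
    rewrite !F7 in F1. unfold Defs.differential in F1.
    destruct (F5 F2) as [X1 X2]. destruct (F6 F2) as [X3 X4].
    rewrite X1, X2, X3, X4, F3, (F4 F2) in F1. cbn [fst snd] in F1.
    pose proof (f_equal fst F1) as G1. pose proof (f_equal snd F1) as G2.
    cbn [fst snd] in G1, G2.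
    set (h := val H p) in *.
    split.
    - match type of G1 with ?lhs = ?rhs => transitivity (lhs * (h * h)) end;
        [field; exact F2|]. rewrite G1. field. exact F2.
    - match type of G2 with ?lhs = ?rhs => transitivity (lhs * (h * h)) end;
        [field; exact F2|]. rewrite G2. field. exact F2. }
  exists z1, z2, A, B, H. constructor; try assumption.
  - intro E. apply Hnd.
    gen (generically_neq_0 H CH H0). 2: apply generically_near; near EZ. 3: near EY.
    4: apply (is_germ_eq_near _ _ (fun p => val z1 p * val B p - val z2 p * val A p)
         (fun _ => RtoC 0) E); [germ | rewrite <- cst_0; apply is_germ_cst].
    2-3: intros p HH; exact HH.
    intros p [F1 [F2 [F3 F4]]]. rewrite F2, (F3 F1). cbn [fst snd].
    replace (val z1 p * (val B p / val H p) - val z2 p * (val A p / val H p))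
      with ((val z1 p * val B p - val z2 p * val A p) / val H p) by (field; exact F1).
    rewrite F4. field. exact F1.
  - eapply is_germ_eq; [germ | germ |].
    exact (generically_mono _ _ (fun p HH => proj1 HH) BR).
  - eapply is_germ_eq; [germ | germ |].
    exact (generically_mono _ _ (fun p HH => proj2 HH) BR).
Qed.

(** ** Arithmetic of the eigenvalues *)

Section Eigenvalues.
Variables (l1 l2 : C) (lambda : R).
Hypotheses (l2_neq_0 : l2 <> 0) (ratio : l1 / l2 = RtoC lambda)
  (lambda_neg : (lambda < 0)%R) (lambda_irr : forall q : Q, lambda <> Q2R q).

Lemma eigen_ratio : l1 = RtoC lambda * l2.
Proof. rewrite <- ratio. field. exact l2_neq_0. Qed.

Lemma irrational_nonresonant (n m : BinInt.Z) : IZR n * l1 + IZR m * l2 = 0 -> n = 0%Z /\ m = 0%Z.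
Proof.
  rewrite eigen_ratio. intro H.
  assert (E : RtoC (IZR n * lambda + IZR m)%R = 0).
  { rewrite RtoC_plus, RtoC_mult.
    transitivity ((IZR n * (RtoC lambda * l2) + IZR m * l2) / l2); [field; exact l2_neq_0|].
    rewrite H. field. exact l2_neq_0. }
  apply RtoC_inj in E.
  destruct (Z.eq_dec n 0) as [Hn|Hn].
  - subst n. split; [reflexivity|]. apply eq_IZR. lra.
  - exfalso. apply (lambda_irr (inject_Z (- m) / inject_Z n)%Q).
    assert (Hn' : IZR n <> 0%R) by (apply not_0_IZR, Hn).
    rewrite Q2R_div.
    + unfold inject_Z, Q2R. simpl. rewrite opp_IZR.
      apply (Rmult_eq_reg_l (IZR n)); [|exact Hn'].
      replace (IZR n * (- IZR m * / 1 / (IZR n * / 1)))%R with (- IZR m)%R by (field; exact Hn').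
      lra.
    + intro E0. apply Hn. unfold Qeq in E0. simpl in E0. lia.
Qed.

(** Here and in [gap_y] the ratio has to be negative: otherwise some divisor
    [j * l2 - l1] may be small. *)
Lemma gap_x j : (Cmod l2 * INR j <= Cmod (INR j * l2 - l1)%C)%R.
Proof.
  rewrite eigen_ratio.
  replace (INR j * l2 - RtoC lambda * l2) with (RtoC (INR j - lambda) * l2)
    by (rewrite RtoC_minus; ring).
  rewrite Cmod_mult, Cmod_R, Rmult_comm. apply Rmult_le_compat_r; [apply Cmod_ge_0|].
  pose proof (pos_INR j). rewrite Rabs_pos_eq; lra.
Qed.

Lemma gap_y j : (- lambda * Cmod l2 * INR j <= Cmod (INR j * l1 - l2)%C)%R.
Proof.
  rewrite eigen_ratio.
  replace (INR j * (RtoC lambda * l2) - l2) with (RtoC (INR j * lambda - 1) * l2)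
    by (rewrite RtoC_minus, RtoC_mult; ring).
  rewrite Cmod_mult, Cmod_R.
  replace (- lambda * Cmod l2 * INR j)%R with (- lambda * INR j * Cmod l2)%R by ring.
  apply Rmult_le_compat_r; [apply Cmod_ge_0|].
  pose proof (pos_INR j). rewrite Rabs_left1; nra.
Qed.

End Eigenvalues.

(** * Conjugacy to the normal form *)

Lemma Cpowz_mul (z : C) k : z <> RtoC 0 ->
  Cpowz z k * z ^ Z.to_nat (- k) = z ^ Z.to_nat k.
Proof.
  intro Hz. destruct k as [|q|q].
  - simpl. ring.
  - simpl. ring.
  - change (Z.to_nat (- Z.neg q)) with (Pos.to_nat q).
    change (Z.to_nat (Z.neg q)) with O.
    change (Cpowz z (Z.neg q)) with (/ (z ^ Pos.to_nat q)).
    change (z ^ 0) with (RtoC 1).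
    assert (N : z ^ Pos.to_nat q <> RtoC 0).
    { generalize (Pos.to_nat q). intro n. induction n as [|n IH]; simpl; [exact C1_nz|].
      apply Cmult_neq_0; assumption. }
    field. exact N.
Qed.

Lemma Cpow_neq_0 (z : C) n : z <> RtoC 0 -> z ^ n <> RtoC 0.
Proof.
  intro Hz. induction n as [|n IH]; simpl; [exact C1_nz | apply Cmult_neq_0; assumption].
Qed.

Lemma differential_comb Phi p a b (V W : C * C) :
  Defs.differential Phi p (a * fst V + b * fst W, a * snd V + b * snd W) =
  (a * fst (Defs.differential Phi p V) + b * fst (Defs.differential Phi p W),
   a * snd (Defs.differential Phi p V) + b * snd (Defs.differential Phi p W)).
Proof. unfold Defs.differential. cbn [fst snd]. f_equal; ring. Qed.

Lemma generically_comp_near X W u v Phi P : inverse_germs X W u v ->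
  near0 (fun p => Phi p = (val X p, val W p)) ->
  generically P -> generically (fun p => P (Phi p)).
Proof.
  intros HI HP HG. gen (generically_near _ HP). 2: exact (generically_comp X W u v P HI HG).
  intros p [E1 E2]. rewrite E1. exact E2.
Qed.

(** The differential is linear at each point, so that combinations with constant
    coefficients go through; the inverse germ gives the inclusion in the other
    direction. *)
Lemma conjugate_of_generators Phi Z Y Z' Y' : biholomorphic_germ Phi ->
  is_pushforward Phi Z Z' -> is_pushforward Phi Y Y' ->
  analytically_conjugate (lie_algebra Z Y) (lie_algebra Z' Y').
Proof.
  intros HB HZ HY. exists Phi. split; [exact HB|]. intro X'.
  destruct (biholomorphic_series Phi HB) as [X [W [u [v [HI EP]]]]].
  assert (HI' := inverse_germs_sym _ _ _ _ HI).
  split.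
  - intros [a [b Hab]]. exists (comb_vfield a Z b Y). split.
    + exists a, b. apply generically_near, near0_all. reflexivity.
    + gen HZ. 2: gen HY. 3: exact (generically_comp_near X W u v Phi _ HI EP Hab).
      2: intros p HH; exact HH.
      intros p [E1 [E2 E3]]. unfold comb_vfield at 1.
      rewrite differential_comb, E1, E2, E3. reflexivity.
  - intros [V [[a [b Hab]] HV]]. exists a, b.
    assert (H1 : generically (fun p => X' (val X p, val W p)
      = comb_vfield a Z' b Y' (val X p, val W p))).
    { gen HZ. 2: gen HY. 3: gen HV. 4: gen Hab. 5: exact (generically_near _ EP).
      2-4: intros p HH; exact HH.
      intros p [E1 [E2 [E3 [E4 E5]]]]. rewrite <- E5, <- E3, E4. unfold comb_vfield.
      rewrite differential_comb, E1, E2. reflexivity. }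
    pose proof (generically_comp u v X W _ HI' H1) as H2. cbv beta in H2.
    destruct HI as (_ & _ & _ & _ & _ & _ & _ & _ & _ & E2).
    gen H2. 2: exact (generically_near _ E2).
    intros p [F1 F2]. rewrite F2 in F1. exact F1.
Qed.

Lemma normal_form_conjugacy Z Y (l1 l2 delta : C) (z1 z2 A B H X W : S2) n m d c :
  lie_data Z Y l1 l2 delta z1 z2 A B H ->
  conv X -> conv W -> ord (X - varx)%S 2 -> ord (W - vary)%S 2 ->
  vder z1 z2 X = (cst l1 * X)%S -> vder z1 z2 W = (cst l2 * W)%S ->
  (vder A B X * monomial X W (Z.to_nat (- n)) (Z.to_nat (- m)))%S
    = (cst d * (H * X * monomial X W (Z.to_nat n) (Z.to_nat m)))%S ->
  (vder A B W * monomial X W (Z.to_nat (- n)) (Z.to_nat (- m)))%S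
    = (cst c * (H * W * monomial X W (Z.to_nat n) (Z.to_nat m)))%S ->
  analytically_conjugate (lie_algebra Z Y)
    (lie_algebra (diag_vfield l1 l2) (monomial_vfield n m d c)).
Proof.
  intros LD CX CW OX OW EX EW RX RW.
  pose proof (ld_z1 LD) as C1. pose proof (ld_z2 LD) as C2.
  pose proof (ld_A LD) as CA. pose proof (ld_B LD) as CB.
  pose proof (ld_H LD) as CH. pose proof (ld_H_neq_0 LD) as H0.
  destruct (inverse_germs_near_identity X W CX CW OX OW) as [u [v HI]].
  set (Phi := fun p => (val X p, val W p)).
  assert (EP : near0 (fun p => Phi p = (val X p, val W p))) by (apply near0_all; reflexivity).
  pose proof (differential_near Phi X W CX CW EP) as DP.
  assert (X0 : X <> 0%S) by (apply (neq_0_of_coef _ _ _ _ (proj2 (from_near_x X OX))), C1_nz).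
  assert (W0 : W <> 0%S) by (apply (neq_0_of_coef _ _ _ _ (proj2 (from_near_y W OW))), C1_nz).
  apply (conjugate_of_generators Phi).
  - apply (biholomorphic_of_series X W u v HI).
  - apply generically_near.
    near DP. 2: near (ld_Z LD).
    3: near (is_germ_eq_near _ _ _ _ EX (is_germ_vder z1 z2 X C1 C2 CX)
        (is_germ_mul _ _ _ _ (is_germ_cst l1) (is_germ_val X CX))).
    4: exact (is_germ_eq_near _ _ _ _ EW (is_germ_vder z1 z2 W C1 C2 CW)
        (is_germ_mul _ _ _ _ (is_germ_cst l2) (is_germ_val W CW))).
    2-3: intros p HH; exact HH.
    intros p [F1 [F2 [F3 F4]]]. rewrite F1, F2. cbn [fst snd].
    unfold diag_vfield, Phi. cbn [fst snd]. rewrite <- F3, <- F4. f_equal; ring.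
  - gen (generically_near _ DP). 2: gen (generically_near _ (ld_Y LD)).
    3: gen (generically_neq_0 H CH H0). 4: gen (generically_neq_0 X CX X0).
    5: gen (generically_neq_0 W CW W0).
    6: apply generically_near; unfold monomial in RX, RW.
    6: near (is_germ_eq_near _ _ (fun p => (val A p * val (dx X) p + val B p * val (dy X) p)
         * (val X p ^ Z.to_nat (- n) * val W p ^ Z.to_nat (- m)))
         (fun p => d * (val H p * val X p * (val X p ^ Z.to_nat n * val W p ^ Z.to_nat m)))
         RX ltac:(germ) ltac:(germ)).
    7: exact (is_germ_eq_near _ _ (fun p => (val A p * val (dx W) p + val B p * val (dy W) p)
         * (val X p ^ Z.to_nat (- n) * val W p ^ Z.to_nat (- m)))
         (fun p => c * (val H p * val W p * (val X p ^ Z.to_nat n * val W p ^ Z.to_nat m)))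
         RW ltac:(germ) ltac:(germ)).
    2-6: intros p HH; exact HH.
    intros p [F1 [F2 [F3 [F4 [F5 [F6 F7]]]]]].
    rewrite F1, (F2 F3). cbn [fst snd]. unfold monomial_vfield, Phi. cbn [fst snd].
    rewrite <- (Cpowz_mul (val X p) n F4), <- (Cpowz_mul (val W p) m F5) in F6, F7.
    pose proof (Cpow_neq_0 (val X p) (Z.to_nat (- n)) F4) as N1.
    pose proof (Cpow_neq_0 (val W p) (Z.to_nat (- m)) F5) as N2.
    set (s := val X p ^ Z.to_nat (- n)) in *. set (t := val W p ^ Z.to_nat (- m)) in *.
    assert (N : val H p * (s * t) <> RtoC 0) by (repeat apply Cmult_neq_0; assumption).
    f_equal.
    + transitivity ((val A p * val (dx X) p + val B p * val (dy X) p) * (s * t)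
        / (val H p * (s * t))); [field; repeat split; assumption|].
      rewrite F6. field. repeat split; assumption.
    + transitivity ((val A p * val (dx W) p + val B p * val (dy W) p) * (s * t)
        / (val H p * (s * t))); [field; repeat split; assumption|].
      rewrite F7. field. repeat split; assumption.
Qed.

(** * Uniqueness *)

(** A member [V] is pushed to the field that the inverse germ defines, and this
    field belongs to the second Lie algebra. *)
Lemma pushed_members Z Y Z' Y' :
  analytically_conjugate (lie_algebra Z Y) (lie_algebra Z' Y') ->
  exists X W u v, inverse_germs X W u v /\
    forall V, lie_algebra Z Y V -> exists a b, generically (fun p =>
      Defs.differential (fun q => (val X q, val W q)) p (V p)
      = comb_vfield a Z' b Y' (val X p, val W p)).
Proof.
  intros [Phi [HB HL]].
  destruct (biholomorphic_series Phi HB) as [X [W [u [v [HI EP]]]]].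
  exists X, W, u, v. split; [exact HI|]. intros V HV.
  pose proof HI as (CX & CW & Cu & Cv & X0 & W0 & u0 & v0 & E1 & E2).
  set (Phi' := fun q => (val X q, val W q)).
  assert (EP' : near0 (fun p => Phi' p = (val X p, val W p))) by (apply near0_all; reflexivity).
  pose proof (differential_near Phi X W CX CW EP) as D.
  pose proof (differential_near Phi' X W CX CW EP') as D'.
  (* the pushforward of V, defined through the inverse germ *)
  set (V' := fun q => Defs.differential Phi' (val u q, val v q) (V (val u q, val v q))).
  assert (HV' : is_pushforward Phi V V').
  { apply generically_near. near EP. 2: near E1. 3: near D. 4: exact D'.
    2-3: intros p HH; exact HH.
    intros p [F1 [F2 [F3 F4]]]. rewrite F1. unfold V'. rewrite F2, F3, F4. reflexivity. }
  destruct (proj2 (HL V') (ex_intro _ V (conj HV HV'))) as [a [b Hab]].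
  exists a, b.
  gen (generically_comp X W u v _ HI Hab). 2: exact (generically_near _ E1).
  intros p [F1 F2]. rewrite <- F1. unfold V'. rewrite F2. reflexivity.
Qed.

Lemma cst_mul_eq_0 c (f : S2) : f <> 0%S -> (cst c * f)%S = 0%S -> c = 0.
Proof.
  intros Hf E. destruct (S2_integral _ _ E) as [E'|E']; [|contradiction].
  apply (f_equal (fun g : S2 => g O O)) in E'. rewrite cst_coef in E'. exact E'.
Qed.

Lemma monomial_log_derivative V1 V2 (X W w s1 s2 h : S2) i j :
  (w * vder V1 V2 X)%S = (X * s1 * h)%S -> (w * vder V1 V2 W)%S = (W * s2 * h)%S ->
  (w * vder V1 V2 (monomial X W i j))%S
  = (monomial X W i j * (cst (INR i) * s1 + cst (INR j) * s2) * h)%S.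
Proof.
  intros HX HW.
  assert (pow : forall (f s : S2) n, (w * vder V1 V2 f)%S = (f * s * h)%S ->
    (w * vder V1 V2 (rpow f n))%S = (rpow f n * (cst (INR n) * s) * h)%S).
  { intros f s n Hf. induction n as [|n IH].
    - change (rpow f 0) with (cst (RtoC 1)). rewrite vder_cst, cst_INR_0. ring.
    - change (rpow f (S n)) with (f * rpow f n)%S. rewrite vder_mul, cst_INR_S.
      replace (w * (vder V1 V2 f * rpow f n + f * vder V1 V2 (rpow f n)))%S with
        (w * vder V1 V2 f * rpow f n + f * (w * vder V1 V2 (rpow f n)))%S by ring.
      rewrite Hf, IH. ring. }
  unfold monomial. rewrite vder_mul.
  replace (w * (vder V1 V2 (rpow X i) * rpow W j + rpow X i * vder V1 V2 (rpow W j)))%S with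
    (w * vder V1 V2 (rpow X i) * rpow W j + rpow X i * (w * vder V1 V2 (rpow W j)))%S by ring.
  rewrite (pow X s1 i HX), (pow W s2 j HW). ring.
Qed.

Section Relations.
Variables (Z Y : vfield) (l1 l2 delta : C) (z1 z2 A B H : S2).
Hypothesis LD : lie_data Z Y l1 l2 delta z1 z2 A B H.
Variables (X W : S2) (n1 n2 m1 m2 : nat) (d c al be al' be' : C).
Hypotheses (X_neq_0 : X <> 0%S) (W_neq_0 : W <> 0%S) (J_neq_0 : jacobian X W <> 0%S).

Let w := monomial X W n2 m2.
Let v := monomial X W n1 m1.
Let s1 := (cst (al * l1) * w + cst (be * d) * v)%S.
Let s2 := (cst (al * l2) * w + cst (be * c) * v)%S.
Let t1 := (cst (al' * l1) * w + cst (be' * d) * v)%S.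
Let t2 := (cst (al' * l2) * w + cst (be' * c) * v)%S.

(* [Z] is pushed to [al Z0 + be Y'], and [Y] to [al' Z0 + be' Y'], where [Y'] is
   [v / w] times the linear field with eigenvalues [d], [c]. *)
Hypothesis ZX : (w * vder z1 z2 X)%S = (X * s1 * 1)%S.
Hypothesis ZW : (w * vder z1 z2 W)%S = (W * s2 * 1)%S.
Hypothesis YX : (w * vder A B X)%S = (X * t1 * H)%S.
Hypothesis YW : (w * vder A B W)%S = (W * t2 * H)%S.

Let dp := (INR n1 - INR n2) * l1 + (INR m1 - INR m2) * l2.

Let w_neq_0 : w <> 0%S.
Proof. apply mul_neq_0; apply rpow_neq_0; assumption. Qed.
Let v_neq_0 : v <> 0%S.
Proof. apply mul_neq_0; apply rpow_neq_0; assumption. Qed.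

Lemma v_w_derivative V1 V2 (r1 r2 h : S2) :
  (w * vder V1 V2 X)%S = (X * r1 * h)%S -> (w * vder V1 V2 W)%S = (W * r2 * h)%S ->
  (w * vder V1 V2 v - v * vder V1 V2 w)%S
  = (v * ((cst (INR n1) - cst (INR n2)) * r1 + (cst (INR m1) - cst (INR m2)) * r2) * h)%S.
Proof.
  intros HX HW.
  assert (E : vder V1 V2 w = ((cst (INR n2) * r1 + cst (INR m2) * r2) * h)%S).
  { apply (S2_cancel w); [exact w_neq_0|].
    transitivity (w * vder V1 V2 (monomial X W n2 m2))%S; [reflexivity|].
    rewrite (monomial_log_derivative V1 V2 X W w r1 r2 h n2 m2 HX HW). unfold w. ring. }
  rewrite E. unfold v at 1.
  rewrite (monomial_log_derivative V1 V2 X W w r1 r2 h n1 m1 HX HW). fold v. ring.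
Qed.

(** [[Z, Y] = delta Y] on a coordinate [f], which is [X] or [W] with [l], [e] the
    eigenvalues of [Z0] and of the linear factor of [Y']: the left-hand side is the
    image of [[al Z0 + be Y', al' Z0 + be' Y'] = (al be' - al' be) dp Y']. *)
Lemma bracket_relation f l e : f <> 0%S ->
  (w * vder z1 z2 f)%S = (f * (cst (al * l) * w + cst (be * e) * v) * 1)%S ->
  (w * vder A B f)%S = (f * (cst (al' * l) * w + cst (be' * e) * v) * H)%S ->
  (cst (e * dp * (al * be' - al' * be)) * v)%S
  = (cst delta * (cst (al' * l) * w + cst (be' * e) * v))%S.
Proof.
  intros Hf Zf Yf.
  set (s := (cst (al * l) * w + cst (be * e) * v)%S) in *.
  set (t := (cst (al' * l) * w + cst (be' * e) * v)%S) in *.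
  pose proof (bracket_act delta z1 z2 A B H (ld_bracket_1 LD)
    (ld_bracket_2 LD) f) as R.
  set (Zd := vder z1 z2) in *. set (Yd := vder A B) in *.
  assert (Z_mul : forall g h, Zd (g * h)%S = (Zd g * h + g * Zd h)%S) by (intros; apply vder_mul).
  assert (Y_mul : forall g h, Yd (g * h)%S = (Yd g * h + g * Yd h)%S) by (intros; apply vder_mul).
  assert (A1 : (w * Zd (Yd f))%S = (Zd f * t * H + f * Zd t * H + f * t * Zd H - Zd w * Yd f)%S).
  { apply (f_equal Zd) in Yf. rewrite !Z_mul in Yf.
    replace (w * Zd (Yd f))%S with ((Zd w * Yd f + w * Zd (Yd f)) - Zd w * Yd f)%S by ring.
    rewrite Yf. ring. }
  assert (A2 : (w * Yd (Zd f))%S = (Yd f * s + f * Yd s - Yd w * Zd f)%S).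
  { replace (f * s * 1)%S with (f * s)%S in Zf by ring.
    apply (f_equal Yd) in Zf. rewrite !Y_mul in Zf.
    replace (w * Yd (Zd f))%S with ((Yd w * Zd f + w * Yd (Zd f)) - Yd w * Zd f)%S by ring.
    rewrite Zf. ring. }
  assert (T : (H * (w * Zd t - t * Zd w) - (w * Yd s - s * Yd w))%S
    = (cst delta * (H * w * t))%S).
  { apply (S2_cancel (H * f)%S); [apply mul_neq_0; [apply (ld_H_neq_0 LD) | exact Hf]|].
    transitivity (w * w * (H * (Zd (Yd f) - Yd (Zd f))) - w * (w * Yd f) * Zd H)%S.
    - replace (w * w * (H * (Zd (Yd f) - Yd (Zd f))))%S with
        (w * H * (w * Zd (Yd f) - w * Yd (Zd f)))%S by ring.
      rewrite A1, A2.
      replace (w * H * (Zd f * t * H + f * Zd t * H + f * t * Zd H - Zd w * Yd f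
        - (Yd f * s + f * Yd s - Yd w * Zd f)))%S with
        (H * (w * Zd f * t * H + w * f * Zd t * H + w * f * t * Zd H - Zd w * (w * Yd f)
        - (w * Yd f * s + w * f * Yd s - Yd w * (w * Zd f))))%S by ring.
      rewrite Zf, Yf. ring.
    - rewrite R.
      replace (w * w * ((Zd H + cst delta * H) * Yd f))%S with
        (w * (Zd H + cst delta * H) * (w * Yd f))%S by ring.
      rewrite Yf. ring. }
  assert (Zt : (w * Zd t - t * Zd w)%S = (cst (be' * e) * (w * Zd v - v * Zd w))%S).
  { unfold t. unfold Zd. rewrite vder_add, !vder_cst_mul. fold Zd. ring. }
  assert (Ys : (w * Yd s - s * Yd w)%S = (cst (be * e) * (w * Yd v - v * Yd w))%S).
  { unfold s. unfold Yd. rewrite vder_add, !vder_cst_mul. fold Yd. ring. }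
  rewrite Zt, Ys in T. unfold Zd, Yd in T.
  rewrite (v_w_derivative z1 z2 s1 s2 1%S ZX ZW), (v_w_derivative A B t1 t2 H YX YW) in T.
  apply (S2_cancel (H * w)%S);
    [apply mul_neq_0; [apply (ld_H_neq_0 LD) | exact w_neq_0]|].
  transitivity (cst delta * (H * w * t))%S; [|ring].
  rewrite <- T. unfold s1, s2, t1, t2, dp.
  rewrite !cst_mul, !cst_sub, !cst_add, !cst_mul, !cst_sub. ring.
Qed.

(** The determinant of the pushed fields is a non-zero multiple of that of [Z], [Y]. *)
Lemma relations_determinant :
  (al * be' - al' * be) * (l1 * c - l2 * d) <> 0.
Proof.
  intro E.
  apply (mul_neq_0 _ _ (mul_neq_0 _ _ (ld_det LD) J_neq_0)
    (mul_neq_0 _ _ w_neq_0 w_neq_0)).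
  rewrite <- jacobian_vder.
  transitivity ((w * vder z1 z2 X) * (w * vder A B W) - (w * vder z1 z2 W) * (w * vder A B X))%S;
    [ring|].
  rewrite ZX, ZW, YX, YW.
  transitivity (cst ((al * be' - al' * be) * (l1 * c - l2 * d)) * (H * X * W * w * v))%S.
  - unfold s1, s2, t1, t2. rewrite !cst_mul, !cst_sub, !cst_mul. ring.
  - rewrite E, cst_0. ring.
Qed.

(** If [delta] is not 0, then the derived algebra is spanned by [Y] on one side and
    by [Y'] on the other, so [al' = 0], and only [al] affects the ratio. *)
Lemma ratio_relation : delta = al * dp /\ (delta = 0 -> dp = 0).
Proof.
  pose proof relations_determinant as HD.
  set (D := al * be' - al' * be) in *.
  assert (D0 : D <> 0) by (intro E; apply HD; rewrite E; ring).
  assert (L0 : l1 * c - l2 * d <> 0) by (intro E; apply HD; rewrite E; ring).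
  pose proof (bracket_relation X l1 d X_neq_0 ZX YX) as R1.
  pose proof (bracket_relation W l2 c W_neq_0 ZW YW) as R2.
  fold D in R1, R2.
  destruct (Ceq_dec delta 0) as [E|E].
  - rewrite E, cst_0 in R1, R2.
    assert (K1 : d * dp * D = 0).
    { apply (cst_mul_eq_0 _ v v_neq_0). rewrite R1. ring. }
    assert (K2 : c * dp * D = 0).
    { apply (cst_mul_eq_0 _ v v_neq_0). rewrite R2. ring. }
    assert (dp0 : dp = 0).
    { apply NNPP. intro Hdp. apply HD.
      assert (Hd : d = 0).
      { apply NNPP. intro Hd. exact (Cmult_neq_0 _ _ (Cmult_neq_0 _ _ Hd Hdp) D0 K1). }
      assert (Hc : c = 0).
      { apply NNPP. intro Hc. exact (Cmult_neq_0 _ _ (Cmult_neq_0 _ _ Hc Hdp) D0 K2). }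
      rewrite Hd, Hc. ring. }
    split; [rewrite dp0, E; ring | intros _; exact dp0].
  - split; [|intro; contradiction].
    assert (al'0 : al' = 0).
    { assert (K : delta * al' * (l1 * c - l2 * d) = 0).
      { apply (cst_mul_eq_0 _ w w_neq_0).
        transitivity (cst c * (cst delta * (cst (al' * l1) * w + cst (be' * d) * v))
          - cst d * (cst delta * (cst (al' * l2) * w + cst (be' * c) * v)))%S.
        - rewrite !cst_mul, !cst_sub, !cst_mul. ring.
        - rewrite <- R1, <- R2. rewrite !cst_mul. ring. }
      apply NNPP. intro Hal. exact (Cmult_neq_0 _ _ (Cmult_neq_0 _ _ E Hal) L0 K). }
    assert (be'0 : be' <> 0).
    { intro Hb. apply D0. unfold D. rewrite al'0, Hb. ring. }
    assert (DE : D = al * be') by (unfold D; rewrite al'0; ring).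
    assert (K : forall e, (cst (e * dp * D) * v)%S = (cst delta * (cst (be' * e) * v))%S ->
      e * (al * dp - delta) = 0).
    { intros e R.
      assert (K : e * (al * dp - delta) * be' = 0).
      { apply (cst_mul_eq_0 _ v v_neq_0).
        transitivity (cst (e * dp * D) * v - cst delta * (cst (be' * e) * v))%S;
          [rewrite DE, !cst_mul, !cst_sub, !cst_mul; ring | rewrite R; ring]. }
      apply NNPP. intro HN. exact (Cmult_neq_0 _ _ HN be'0 K). }
    assert (K1 : d * (al * dp - delta) = 0).
    { apply K. rewrite R1, al'0. replace (0 * l1) with (RtoC 0) by ring. rewrite cst_0. ring. }
    assert (K2 : c * (al * dp - delta) = 0).
    { apply K. rewrite R2, al'0. replace (0 * l2) with (RtoC 0) by ring. rewrite cst_0. ring. }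
    apply NNPP. intro HN.
    assert (HN' : al * dp - delta <> 0).
    { intro E0. apply HN. replace delta with (al * dp - (al * dp - delta)) by ring.
      rewrite E0. ring. }
    apply L0.
    assert (Hd : d = 0) by (apply NNPP; intro Hd; exact (Cmult_neq_0 _ _ Hd HN' K1)).
    assert (Hc : c = 0) by (apply NNPP; intro Hc; exact (Cmult_neq_0 _ _ Hc HN' K2)).
    rewrite Hd, Hc. ring.
Qed.

End Relations.

(** ** Linear parts *)

Lemma compose2_coef_1 f X W i j : ord X 1 -> ord W 1 -> (i + j = 1)%nat ->
  compose2 f X W i j = f 1%nat O * X i j + f O 1%nat * W i j.
Proof.
  intros HX HW E. pose proof (compose2_linear_part f X W HX HW i j ltac:(lia)) as L.
  rewrite sub_coef, !add_coef, !cst_mul_coef, cst_coef in L.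
  set (g := compose2 f X W i j) in *.
  replace (match i with O => match j with O => f O O | _ => RtoC 0 end | _ => RtoC 0 end)
    with (RtoC 0) in L by (destruct i, j; reflexivity || lia).
  transitivity (g - (RtoC 0 + f 1%nat O * X i j + f O 1%nat * W i j)
    + (f 1%nat O * X i j + f O 1%nat * W i j))%C; [cring|].
  rewrite L. cring.
Qed.

Lemma vder_coef_1 l1 l2 z1 z2 X i j : ord (z1 - cst l1 * varx)%S 2 ->
  ord (z2 - cst l2 * vary)%S 2 -> ord X 1 -> (i + j = 1)%nat ->
  vder z1 z2 X i j = weight l1 l2 i j * X i j.
Proof.
  intros H1 H2 HX E. rewrite (vder_split l1 l2), add_coef, vder_linear_coef.
  rewrite (ord_vder _ _ X 1 H1 H2 HX) by lia. cring.
Qed.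

Lemma rpow_xy_mul_coef i0 : forall j0 (f : S2) i j,
  (rpow varx i0 * rpow vary j0 * f)%S (i0 + i)%nat (j0 + j)%nat = f i j.
Proof.
  induction i0 as [|i0 IH]; intros j0 f i j.
  - induction j0 as [|j0 IHj].
    + replace (rpow varx 0 * rpow vary 0 * f)%S with f; [reflexivity|].
      change (f = 1 * 1 * f)%S. ring.
    + replace (rpow varx 0 * rpow vary (S j0) * f)%S with
        (vary * (rpow varx 0 * rpow vary j0 * f))%S
        by (change (rpow vary (S j0)) with (vary * rpow vary j0)%S; ring).
      change (S j0 + j)%nat with (S (j0 + j)). rewrite vary_mul_S. exact IHj.
  - replace (rpow varx (S i0) * rpow vary j0 * f)%S with
      (varx * (rpow varx i0 * rpow vary j0 * f))%S
      by (change (rpow varx (S i0)) with (varx * rpow varx i0)%S; ring).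
    change (S i0 + i)%nat with (S (i0 + i)). rewrite varx_mul_S. apply IH.
Qed.

Lemma inverse_germs_linear X W u v : inverse_germs X W u v ->
  X 1%nat O * W O 1%nat - X O 1%nat * W 1%nat O <> 0.
Proof.
  intros (CX & CW & Cu & Cv & X0 & W0 & u0 & v0 & E1 & E2).
  assert (OX : ord X 1) by (apply ord_1, X0). assert (OW : ord W 1) by (apply ord_1, W0).
  destruct (conv_compose2 u X W Cu CX CW X0 W0) as [C1 V1].
  destruct (conv_compose2 v X W Cv CX CW X0 W0) as [C2 V2].
  assert (F1 : compose2 u X W = varx).
  { apply val_inj; [exact C1 | apply conv_varx|]. near V1. 2: exact E1.
    intros p [G1 G2]. rewrite G1, val_varx. exact (f_equal fst G2). }
  assert (F2 : compose2 v X W = vary).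
  { apply val_inj; [exact C2 | apply conv_vary|]. near V2. 2: exact E1.
    intros p [G1 G2]. rewrite G1, val_vary. exact (f_equal snd G2). }
  pose proof (compose2_coef_1 u X W 1 0 OX OW eq_refl) as A1.
  pose proof (compose2_coef_1 u X W 0 1 OX OW eq_refl) as A2.
  pose proof (compose2_coef_1 v X W 1 0 OX OW eq_refl) as A3.
  pose proof (compose2_coef_1 v X W 0 1 OX OW eq_refl) as A4.
  rewrite F1 in A1, A2. rewrite F2 in A3, A4.
  change (varx 1%nat O) with (RtoC 1) in A1. change (varx O 1%nat) with (RtoC 0) in A2.
  change (vary 1%nat O) with (RtoC 0) in A3. change (vary O 1%nat) with (RtoC 1) in A4.
  intro E.
  (* the product of the two Jacobian determinants is 1 *)
  assert (K : (u 1%nat O * v O 1%nat - u O 1%nat * v 1%nat O)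
    * (X 1%nat O * W O 1%nat - X O 1%nat * W 1%nat O) = RtoC 1).
  { transitivity ((u 1%nat O * X 1%nat O + u O 1%nat * W 1%nat O)
      * (v 1%nat O * X O 1%nat + v O 1%nat * W O 1%nat)
      - (u 1%nat O * X O 1%nat + u O 1%nat * W O 1%nat)
      * (v 1%nat O * X 1%nat O + v O 1%nat * W 1%nat O))%C; [cring|].
    rewrite <- A1, <- A2, <- A3, <- A4. ring. }
  rewrite E, Cmult_0_r in K. apply C1_nz. symmetry. exact K.
Qed.

(** In the coordinates [X], [W] the series [P] is [k * X ^ (n + i) * W ^ (m + j)], with
    [n = n1 - n2] and [m = m1 - m2] not both 0. This is not the monomial
    [X ^ i * W ^ j], whose coefficient in [P'] therefore vanishes. *)
Lemma pulled_back_monomial X W u v (P : S2) n1 n2 m1 m2 k i j :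
  inverse_germs X W u v -> conv P ->
  (monomial X W n2 m2 * P)%S = (cst k * (monomial X W (n1 + i) (m1 + j)))%S ->
  (n1, m1) <> (n2, m2) ->
  exists P' : S2, compose2 P' X W = P /\ P' i j = RtoC 0.
Proof.
  intros HI CP EP Hne.
  pose proof HI as (CX & CW & Cu & Cv & X0 & W0 & u0 & v0 & E1 & E2).
  destruct (conv_compose2 P u v CP Cu Cv u0 v0) as [C1 V1].
  set (P' := compose2 P u v) in *.
  destruct (conv_compose2 P' X W C1 CX CW X0 W0) as [C2 V2].
  exists P'. split.
  - apply val_inj; [exact C2 | exact CP|].
    near V2. 2: near (near0_comp X W _ CX CW X0 W0 V1). 3: exact E1. 2: intros p HH; exact HH.
    intros p [F1 [F2 F3]]. rewrite F1, F2, F3. reflexivity.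
  - assert (EM : (rpow varx n2 * rpow vary m2 * P')%S
      = (cst k * (rpow varx (n1 + i) * rpow vary (m1 + j)))%S).
    { apply (is_germ_eq _ _ (fun p => val varx p ^ n2 * val vary p ^ m2 * val P' p)
        (fun p => k * (val varx p ^ (n1 + i) * val vary p ^ (m1 + j))));
      [pose proof conv_varx; pose proof conv_vary; clearbody P'; germ
      |pose proof conv_varx; pose proof conv_vary; germ|].
      apply generically_near.
      unfold monomial in EP.
      near V1. 2: near E2.
      3: exact (near0_comp u v _ Cu Cv u0 v0 (is_germ_eq_near _ _
           (fun p => val X p ^ n2 * val W p ^ m2 * val P p)
           (fun p => k * (val X p ^ (n1 + i) * val W p ^ (m1 + j))) EP ltac:(germ) ltac:(germ))).
      2: intros p HH; exact HH.
      intros p [F1 [F2 F3]]. cbv beta in F3. cbv beta.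
      rewrite !val_varx, !val_vary, F1.
      pose proof (f_equal fst F2) as G1. pose proof (f_equal snd F2) as G2.
      cbn [fst snd] in G1, G2. rewrite G1, G2 in F3. exact F3. }
    apply (f_equal (fun f : S2 => f (n2 + i)%nat (m2 + j)%nat)) in EM.
    rewrite rpow_xy_mul_coef, cst_mul_coef, rpow_xy_coef in EM. rewrite EM.
    destruct (Nat.eqb_spec (n2 + i) (n1 + i)); [destruct (Nat.eqb_spec (m2 + j) (m1 + j))|];
      simpl; try apply Cmult_0_r.
    exfalso. apply Hne. f_equal; lia.
Qed.

(** The trace of the linear part is invariant, and a monomial field whose exponents
    are not both 0 adds nothing to it. So [l1 + l2 = al * (l1 + l2)]. *)
Lemma trace_relation l1 l2 z1 z2 X W u v al be d c n1 n2 m1 m2 :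
  conv z1 -> conv z2 ->
  ord (z1 - cst l1 * varx)%S 2 -> ord (z2 - cst l2 * vary)%S 2 ->
  inverse_germs X W u v -> (n1, m1) <> (n2, m2) -> l1 + l2 <> 0 ->
  (monomial X W n2 m2 * (vder z1 z2 X - cst (al * l1) * X))%S
    = (cst (be * d) * monomial X W (n1 + 1) (m1 + 0))%S ->
  (monomial X W n2 m2 * (vder z1 z2 W - cst (al * l2) * W))%S
    = (cst (be * c) * monomial X W (n1 + 0) (m1 + 1))%S ->
  al = 1.
Proof.
  intros C1 C2 O1 O2 HI Hne Htr EP EQ.
  pose proof (inverse_germs_linear X W u v HI) as J0.
  pose proof HI as (CX & CW & Cu & Cv & X0 & W0 & u0 & v0 & E1 & E2).
  assert (OX : ord X 1) by (apply ord_1, X0). assert (OW : ord W 1) by (apply ord_1, W0).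
  set (P := (vder z1 z2 X - cst (al * l1) * X)%S) in *.
  set (Q := (vder z1 z2 W - cst (al * l2) * W)%S) in *.
  assert (CP : conv P).
  { apply conv_sub; [apply conv_vder; assumption | apply conv_mul;
    [apply conv_cst | assumption]]. }
  assert (CQ : conv Q).
  { apply conv_sub; [apply conv_vder; assumption | apply conv_mul;
    [apply conv_cst | assumption]]. }
  destruct (pulled_back_monomial X W u v P n1 n2 m1 m2 _ 1 0 HI CP EP Hne) as [P' [HP P0]].
  destruct (pulled_back_monomial X W u v Q n1 n2 m1 m2 _ 0 1 HI CQ EQ Hne) as [Q' [HQ Q0]].
  assert (LP : forall i j, (i + j = 1)%nat ->
    weight l1 l2 i j * X i j - al * l1 * X i j = P' O 1%nat * W i j).
  { intros i j E. rewrite <- (vder_coef_1 l1 l2 z1 z2 X i j O1 O2 OX E).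
    transitivity (P i j); [unfold P; rewrite sub_coef, cst_mul_coef; reflexivity|].
    rewrite <- HP, compose2_coef_1, P0 by assumption. cring. }
  assert (LQ : forall i j, (i + j = 1)%nat ->
    weight l1 l2 i j * W i j - al * l2 * W i j = Q' 1%nat O * X i j).
  { intros i j E. rewrite <- (vder_coef_1 l1 l2 z1 z2 W i j O1 O2 OW E).
    transitivity (Q i j); [unfold Q; rewrite sub_coef, cst_mul_coef; reflexivity|].
    rewrite <- HQ, compose2_coef_1, Q0 by assumption. cring. }
  pose proof (LP 1%nat O eq_refl) as A1. pose proof (LP O 1%nat eq_refl) as A2.
  pose proof (LQ 1%nat O eq_refl) as A3. pose proof (LQ O 1%nat eq_refl) as A4.
  unfold weight in A1, A2, A3, A4. simpl INR in A1, A2, A3, A4.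
  set (x1 := X 1%nat O) in *. set (x2 := X O 1%nat) in *.
  set (w1 := W 1%nat O) in *. set (w2 := W O 1%nat) in *.
  set (kp := P' O 1%nat) in *. set (kq := Q' 1%nat O) in *.
  clearbody x1 x2 w1 w2 kp kq.
  change C in x1, x2, w1, w2, kp, kq.
  assert (K : (1 - al) * (l1 + l2) * (x1 * w2 - x2 * w1) = 0).
  { transitivity ((((1 * l1 + 0 * l2) * x1 - al * l1 * x1) * w2
      - ((0 * l1 + 1 * l2) * x2 - al * l1 * x2) * w1)
      + (((0 * l1 + 1 * l2) * w2 - al * l2 * w2) * x1
      - ((1 * l1 + 0 * l2) * w1 - al * l2 * w1) * x2))%C; [ring|].
    rewrite A1, A2, A3, A4. ring. }
  apply NNPP. intro HN.
  assert (HN' : 1 - al <> 0).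
  { intro E. apply HN. replace al with (1 - (1 - al)) by ring. rewrite E. ring. }
  exact (Cmult_neq_0 _ _ (Cmult_neq_0 _ _ HN' Htr) J0 K).
Qed.

(** ** The ratio is an invariant *)

(** The defining relations, cleared of denominators and read as identities between
    series, feed [ratio_relation] and [trace_relation]. *)
Lemma ratio_of_conjugate Z Y (l1 l2 delta : C) (z1 z2 A B H : S2) n m d c :
  lie_data Z Y l1 l2 delta z1 z2 A B H -> l1 + l2 <> 0 ->
  analytically_conjugate (lie_algebra Z Y)
    (lie_algebra (diag_vfield l1 l2) (monomial_vfield n m d c)) ->
  delta = IZR n * l1 + IZR m * l2.
Proof.
  intros LD Htr HC.
  destruct (pushed_members _ _ _ _ HC) as [X [W [u [v [HI HV]]]]].
  pose proof HI as (CX & CW & Cu & Cv & X0 & W0 & u0 & v0 & E1 & E2).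
  pose proof (ld_z1 LD) as C1. pose proof (ld_z2 LD) as C2.
  pose proof (ld_A LD) as CA. pose proof (ld_B LD) as CB.
  pose proof (ld_H LD) as CH. pose proof (ld_H_neq_0 LD) as H0.
  pose proof (inverse_germs_linear X W u v HI) as J0.
  assert (trivial : forall a b V, (forall p, V p = comb_vfield a Z b Y p) -> lie_algebra Z Y V).
  { intros a b V E. exists a, b. apply generically_near, near0_all, E. }
  destruct (HV Z) as [al [be PZ]].
  { apply (trivial 1 0). intro p. unfold comb_vfield.
    rewrite (surjective_pairing (Z p)) at 1. f_equal; ring. }
  destruct (HV Y) as [al' [be' PY]].
  { apply (trivial 0 1). intro p. unfold comb_vfield.
    rewrite (surjective_pairing (Y p)) at 1. f_equal; ring. }
  clear HC HV trivial.
  set (n1 := Z.to_nat n). set (n2 := Z.to_nat (- n)).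
  set (m1 := Z.to_nat m). set (m2 := Z.to_nat (- m)).
  assert (X_neq : X <> 0%S) by (intro E; apply J0; rewrite E;
    change (0 * W O 1%nat - 0 * W 1%nat O = 0)%C; cring).
  assert (W_neq : W <> 0%S) by (intro E; apply J0; rewrite E;
    change (X 1%nat O * 0 - X O 1%nat * 0 = 0)%C; cring).
  assert (Jac : jacobian X W <> 0%S).
  { apply (neq_0_of_coef _ O O _ eq_refl). unfold jacobian.
    rewrite sub_coef, !mul_coef_00, !dx_coef, !dy_coef. simpl INR.
    intro E. apply J0. rewrite <- E. cring. }
  set (Phi := fun q => (val X q, val W q)) in *.
  assert (EPhi : near0 (fun p => Phi p = (val X p, val W p))) by (apply near0_all; reflexivity).
  pose proof (differential_near Phi X W CX CW EPhi) as DP.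
  set (w := monomial X W n2 m2). set (v' := monomial X W n1 m1).
  assert (RZ : generically (fun p =>
    (val X p ^ n2 * val W p ^ m2 * (val z1 p * val (dx X) p + val z2 p * val (dy X) p)
     = val X p * (al * l1 * (val X p ^ n2 * val W p ^ m2)
       + be * d * (val X p ^ n1 * val W p ^ m1)) * 1) /\
    (val X p ^ n2 * val W p ^ m2 * (val z1 p * val (dx W) p + val z2 p * val (dy W) p)
     = val W p * (al * l2 * (val X p ^ n2 * val W p ^ m2)
       + be * c * (val X p ^ n1 * val W p ^ m1)) * 1))).
  { gen PZ. 2: gen (generically_near _ DP). 3: gen (generically_near _ (ld_Z LD)).
    4: gen (generically_neq_0 X CX X_neq). 5: exact (generically_neq_0 W CW W_neq).
    2-4: intros p HH; exact HH.
    intros p [F1 [F2 [F3 [F4 F5]]]]. rewrite F2, F3 in F1.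
    unfold comb_vfield, diag_vfield, monomial_vfield in F1.
    cbn [fst snd] in F1.
    pose proof (f_equal fst F1) as G1. pose proof (f_equal snd F1) as G2. cbn [fst snd] in G1, G2.
    pose proof (Cpowz_mul (val X p) n F4) as K1. pose proof (Cpowz_mul (val W p) m F5) as K2.
    fold n1 n2 in K1. fold m1 m2 in K2.
    rewrite <- K1, <- K2. split.
    - rewrite (Cmult_comm (val z1 p)), (Cmult_comm (val z2 p)), G1. ring.
    - rewrite (Cmult_comm (val z1 p)), (Cmult_comm (val z2 p)), G2. ring. }
  assert (RY : generically (fun p =>
    (val X p ^ n2 * val W p ^ m2 * (val A p * val (dx X) p + val B p * val (dy X) p)
     = val X p * (al' * l1 * (val X p ^ n2 * val W p ^ m2)
       + be' * d * (val X p ^ n1 * val W p ^ m1)) * val H p) /\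
    (val X p ^ n2 * val W p ^ m2 * (val A p * val (dx W) p + val B p * val (dy W) p)
     = val W p * (al' * l2 * (val X p ^ n2 * val W p ^ m2)
       + be' * c * (val X p ^ n1 * val W p ^ m1)) * val H p))).
  { gen PY. 2: gen (generically_near _ DP). 3: gen (generically_near _ (ld_Y LD)).
    4: gen (generically_neq_0 X CX X_neq). 5: gen (generically_neq_0 W CW W_neq).
    6: exact (generically_neq_0 H CH H0).
    2-5: intros p HH; exact HH.
    intros p [F1 [F2 [F3 [F4 [F5 F6]]]]]. rewrite F2, (F3 F6) in F1.
    unfold comb_vfield, diag_vfield, monomial_vfield in F1.
    cbn [fst snd] in F1.
    pose proof (f_equal fst F1) as G1. pose proof (f_equal snd F1) as G2. cbn [fst snd] in G1, G2.
    pose proof (Cpowz_mul (val X p) n F4) as K1. pose proof (Cpowz_mul (val W p) m F5) as K2.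
    fold n1 n2 in K1. fold m1 m2 in K2.
    rewrite <- K1, <- K2. split.
    - transitivity (val X p ^ n2 * val W p ^ m2 * val H p *
        (val (dx X) p * (val A p / val H p) + val (dy X) p * (val B p / val H p)));
        [field; exact F6|]. rewrite G1. ring.
    - transitivity (val X p ^ n2 * val W p ^ m2 * val H p *
        (val (dx W) p * (val A p / val H p) + val (dy W) p * (val B p / val H p)));
        [field; exact F6|]. rewrite G2. ring. }
  assert (ZX : (w * vder z1 z2 X)%S = (X * (cst (al * l1) * w + cst (be * d) * v') * 1)%S).
  { rewrite one_cst. unfold w, v', monomial. eapply is_germ_eq; [germ | germ |].
    exact (generically_mono _ _ (fun p HH => proj1 HH) RZ). }
  assert (ZW : (w * vder z1 z2 W)%S = (W * (cst (al * l2) * w + cst (be * c) * v') * 1)%S).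
  { rewrite one_cst. unfold w, v', monomial. eapply is_germ_eq; [germ | germ |].
    exact (generically_mono _ _ (fun p HH => proj2 HH) RZ). }
  assert (YX : (w * vder A B X)%S = (X * (cst (al' * l1) * w + cst (be' * d) * v') * H)%S).
  { unfold w, v', monomial. eapply is_germ_eq; [germ | germ |].
    exact (generically_mono _ _ (fun p HH => proj1 HH) RY). }
  assert (YW : (w * vder A B W)%S = (W * (cst (al' * l2) * w + cst (be' * c) * v') * H)%S).
  { unfold w, v', monomial. eapply is_germ_eq; [germ | germ |].
    exact (generically_mono _ _ (fun p HH => proj2 HH) RY). }
  destruct (ratio_relation Z Y l1 l2 delta z1 z2 A B H LD X W n1 n2 m1 m2 d c al be al' be'
    X_neq W_neq Jac ZX ZW YX YW) as [R1 R2].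
  assert (IZR_nat : forall k, RtoC (IZR k) = INR (Z.to_nat k) - INR (Z.to_nat (- k))).
  { intro k. rewrite !INR_IZR_INZ, <- RtoC_minus, <- minus_IZR. do 2 f_equal. lia. }
  rewrite (IZR_nat n), (IZR_nat m). fold n1 n2 m1 m2.
  set (dp := (INR n1 - INR n2) * l1 + (INR m1 - INR m2) * l2) in *.
  destruct (Ceq_dec dp 0) as [E|E]; [rewrite R1, E; ring|].
  assert (Hne : (n1, m1) <> (n2, m2)).
  { intro E'. apply E. unfold dp. injection E' as -> ->. ring. }
  assert (al1 : al = 1).
  { apply (trace_relation l1 l2 z1 z2 X W u v al be d c n1 n2 m1 m2 C1 C2
      (ld_z1_lin LD) (ld_z2_lin LD) HI Hne Htr).
    - fold w. replace (w * (vder z1 z2 X - cst (al * l1) * X))%S with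
        (w * vder z1 z2 X - w * (cst (al * l1) * X))%S by ring.
      rewrite ZX. rewrite Nat.add_1_r, Nat.add_0_r. unfold v', monomial.
      change (rpow X (S n1)) with (X * rpow X n1)%S. ring.
    - fold w. replace (w * (vder z1 z2 W - cst (al * l2) * W))%S with
        (w * vder z1 z2 W - w * (cst (al * l2) * W))%S by ring.
      rewrite ZW. rewrite Nat.add_1_r, Nat.add_0_r. unfold v', monomial.
      change (rpow W (S m1)) with (W * rpow W m1)%S. ring. }
  rewrite R1, al1. ring.
Qed.

Theorem theorem3p1 (Z : vfield) (lambda1 lambda2 : C) (lambda : R)
  (hZ : holomorphic_map Z)
  (hlin : has_diagonal_linear_part Z lambda1 lambda2)
  (hlambda2 : lambda2 <> 0)
  (hratio : lambda1 / lambda2 = RtoC lambda)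
  (hneg : (lambda < 0)%R)
  (hirr : forall q : Q, lambda <> Q2R q)
  (Y : vfield) (delta : C)
  (hL : is_lie_algebra_of_ratio Z Y delta)
  (hnd : non_degenerate Z Y) :
  exists nm : BinInt.Z * BinInt.Z,
    unique (fun nm' : BinInt.Z * BinInt.Z =>
      exists d c : C,
        analytically_conjugate (lie_algebra Z Y)
          (lie_algebra (diag_vfield lambda1 lambda2)
             (monomial_vfield (fst nm') (snd nm') d c))) nm /\
    delta = RtoC (IZR (fst nm)) * lambda1 + RtoC (IZR (snd nm)) * lambda2.
Proof.
  destruct (lie_data_exists Z Y lambda1 lambda2 delta hZ hlin hL hnd)
    as [z1 [z2 [A [B [H LD]]]]].
  pose proof (irrational_nonresonant lambda1 lambda2 lambda hlambda2 hratio hirr) as NR.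
  assert (l2pos : (0 < Cmod lambda2)%R) by (apply Cmod_gt_0, hlambda2).
  assert (k2pos : (0 < - lambda * Cmod lambda2)%R) by nra.
  destruct LD as [C1 C2 CA CB CH EZ EY O1 O2 H0 Hdet B1 B2] eqn:ELD. clear ELD.
  destruct (normal_form lambda1 lambda2 delta z1 z2 A B H C1 C2 CA CB CH O1 O2 NR H0 Hdet B1 B2
    _ _ l2pos k2pos (gap_x lambda1 lambda2 lambda hlambda2 hratio hneg)
    (gap_y lambda1 lambda2 lambda hlambda2 hratio hneg))
    as [X [W [n [m [d [c [CX [CW [OX [OW [EX [EW [Hd [RX RW]]]]]]]]]]]]]].
  assert (Htr : lambda1 + lambda2 <> 0).
  { intro E. destruct (NR 1%Z 1%Z) as [E' _]; [|discriminate E'].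
    rewrite <- E. ring. }
  exists (n, m). split; [split|exact Hd].
  - exists d, c.
    exact (normal_form_conjugacy Z Y lambda1 lambda2 delta z1 z2 A B H X W n m d c LD
      CX CW OX OW EX EW RX RW).
  - intros [n' m'] [d' [c' HC]]. cbn [fst snd] in HC.
    pose proof (ratio_of_conjugate Z Y lambda1 lambda2 delta z1 z2 A B H n' m' d' c' LD Htr HC)
      as E.
    destruct (NR (n - n')%Z (m - m')%Z) as [E1 E2].
    + rewrite !minus_IZR, !RtoC_minus.
      replace ((IZR n - IZR n') * lambda1 + (IZR m - IZR m') * lambda2) with
        ((IZR n * lambda1 + IZR m * lambda2) - (IZR n' * lambda1 + IZR m' * lambda2)) by ring.
      rewrite <- Hd, <- E. ring.
    + f_equal; lia.
Qed.
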